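(* Let $P, Q, R \in \mathbf{C}^{N\times N}$ be pairwise commuting matrices such that $Q$, $R$ and $R-Q$ are positive stable. Then for every $z\in\mathbf{C}$ with $|z|<1$, $${}_3F_2\left(P,\tfrac{Q}{2},\tfrac{Q+I}{2};\tfrac{R}{2},\tfrac{R+I}{2};z\right) = \Gamma(R)\,\Gamma(Q)^{-1}\,\Gamma(R-Q)^{-1} \int_0^1 u^{Q-I} (1-u)^{R-Q-I} (1-zu^2)^{-P}\, du.$$
   Context: $\mathbf{C}^{N\times N}$ is the space of complex $N\times N$ matrices, $I$ is the identity matrix. A matrix $A\in\mathbf{C}^{N\times N}$ is positive stable if $\Re(\lambda)>0$ for every eigenvalue $\lambda$ of $A$. For a positive stable matrix $A$, $\Gamma(A)=\int_0^\infty e^{-t}t^{A-I}\,dt$. For a scalar $c$, $c^{A}=\exp(A\log c)$, with the real logarithm for $c>0$ and the principal logarithm for other complex $c$. The matrix Pochhammer symbol is $(A)_0=I$, $(A)_m=A(A+I)\cdots(A+(m-1)I)$ for $m\ge 1$. The generalized hypergeometric matrix function is defined by $${}_pF_q(P_1,\dots,P_p;Q_1,\dots,Q_q;z)=\sum_{m=0}^\infty \frac{(P_1)_m\cdots(P_p)_m(Q_1)_m^{-1}\cdots(Q_q)_m^{-1}}{m!}z^m,$$ where $P_i,Q_j\in\mathbf{C}^{N\times N}$ and each $Q_j+mI$ is invertible for all integers $m\ge 0$. *)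

(* Defs.v *)
From mathcomp Require Import all_boot all_order all_algebra.
From mathcomp Require Import complex.
From mathcomp Require Import all_classical all_reals all_analysis.

Set Implicit Arguments.
Unset Strict Implicit.
Unset Printing Implicit Defensive.

Import Order.TTheory GRing.Theory Num.Theory.
Import numFieldNormedType.Exports.

Local Open Scope classical_set_scope.
Local Open Scope ring_scope.
Local Open Scope complex_scope.

Section Scalars.
Variable R : realType.

(* Principal argument, in ]-pi, pi]; the value at 0 is irrelevant. *)
Definition Carg (z : R[i]) : R :=
  let t := acos (complex.Re z / ComplexField.Normc.normc z) in
  if 0 <= complex.Im z then t else - t.

(* Principal logarithm; it agrees with [ln] on the positive reals. *)
Definition Clog (z : R[i]) : R[i] :=
  ln (ComplexField.Normc.normc z) +i* Carg z.

End Scalars.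

Section Matrices.
Variables (R : realType) (N : nat).
Local Notation mat := 'M[R[i]]_N.

Definition positive_stable (A : mat) : Prop :=
  forall a : R[i], eigenvalue A a -> 0 < complex.Re a.

(* [R[i]] itself carries no topology in the library: the type annotation with
   [R[i]^o] selects the usual topology of the plane, hence the entrywise
   topology on matrices. *)
Definition mx_series_cvg (u : nat -> mat) : Prop :=
  cvgn (series (u : nat -> 'M[R[i]^o]_N)).

Definition mx_series_sum (u : nat -> mat) : mat :=
  limn (series (u : nat -> 'M[R[i]^o]_N)).

Definition mx_exp (A : mat) : mat :=
  mx_series_sum (fun k => (k`!%:R^-1 : R[i]) *: A ^+ k).

Definition mx_cpow (c : R[i]) (A : mat) : mat := mx_exp (Clog c *: A).

(* Lebesgue integral of a matrix-valued function, taken on the real and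
   imaginary parts of each entry. *)
Definition mx_integrable (D : set R) (F : R -> mat) : Prop :=
  forall i j : 'I_N,
    lebesgue_measure.-integrable D (fun t => (complex.Re (F t i j))%:E) /\
    lebesgue_measure.-integrable D (fun t => (complex.Im (F t i j))%:E).

Definition mx_integral (D : set R) (F : R -> mat) : mat :=
  \matrix_(i, j)
    ((\int[lebesgue_measure]_(t in D) complex.Re (F t i j)) +i*
     (\int[lebesgue_measure]_(t in D) complex.Im (F t i j))).

Definition Gamma_integrand (A : mat) (t : R) : mat :=
  (expR (- t))%:C *: mx_cpow t%:C (A - 1%:M).

Definition mx_Gamma (A : mat) : mat :=
  mx_integral `]0, +oo[ (Gamma_integrand A).

Definition mx_pochhammer (A : mat) (m : nat) : mat :=
  \prod_(k < m) (A + k%:R%:M).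

Definition pFq_term (Ps Qs : seq mat) (z : R[i]) (m : nat) : mat :=
  (z ^+ m / m`!%:R) *:
    ((\prod_(P <- Ps) mx_pochhammer P m) *
     (\prod_(Q <- Qs) invmx (mx_pochhammer Q m))).

(* The series is meaningful: its denominators are invertible, and it
   converges. *)
Definition pFq_defined (Ps Qs : seq mat) (z : R[i]) : Prop :=
  (forall Q, Q \in Qs -> forall m : nat, Q + m%:R%:M \in unitmx) /\
  mx_series_cvg (pFq_term Ps Qs z).

Definition pFq (Ps Qs : seq mat) (z : R[i]) : mat :=
  mx_series_sum (pFq_term Ps Qs z).

End Matrices.

(* Main.v *)
Require Import Defs.
From mathcomp Require Import all_boot all_order all_algebra.
From mathcomp Require Import complex.
From mathcomp Require Import all_classical all_reals all_analysis.
From mathcomp Require Import measurable_realfun.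
From mathcomp Require Import ring lra.

(* Write B(Q, T) for the integral of u^(Q-1) (1-u)^(T-1) over ]0, 1[, with T = S - Q.
   Integrating the derivative of u^A (1-u)^B gives (A+B) B(A, B+1) = B B(A, B) and
   (A+B) B(A+1, B) = A B(A, B).  Dominated convergence after the substitution u = t/n
   gives n^A B(A, B+n) -> Gamma(A); with the functional equation in the second argument
   this yields B(A, B) Gamma(A+B) = Gamma(B) Gamma(A), and Gamma(A) is invertible because
   the inverses of the approximants n^A B(A, n+1) stay bounded.  The integrability bounds
   rest on |u^A| <= C u^a for 0 < u <= 1, which holds for some a > 0 when A is positive
   stable (Cayley-Hamilton).  Expanding (1-z u^2)^(-P) in its binomial series, integrating
   term by term and using (Q)_2m = 4^m (Q/2)_m ((Q+1)/2)_m gives the theorem.  The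
   binomial series is summed by differentiating its product with (1-z t)^P. *)

Set Implicit Arguments.
Unset Strict Implicit.
Unset Printing Implicit Defensive.

Import Order.TTheory GRing.Theory Num.Theory.
Import numFieldNormedType.Exports.

Local Open Scope classical_set_scope.
Local Open Scope ring_scope.
Local Open Scope complex_scope.

(** * Entrywise topology of complex matrices *)

(** Commuting matrices need not be simultaneously diagonalisable, so nothing is reduced to scalars:
    stability is used through norm bounds on [u ^ A] and through the invertibility of [A + n].
    Limits, derivatives and integrals are taken on the [2 N^2] real coordinates [co], estimates in
    one submultiplicative norm [nrm], and noncommutative rearrangements are isolated as identities
    that list the commutations they use. The beta-gamma relation does not come from a double
    integral: for each finite [n] it is an exact identity between Gauss products in which only a
    Pochhammer symbol is cancelled, and this one is invertible by stability. Hence [mx_Gamma] has to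
    be inverted only at the very end. The hypergeometric series is not estimated term by term
    either: its partial sums, multiplied by the invertible matrix [mbeta Q (S - Q)], are integrals
    that converge by domination, and the convergence of the series is read off from theirs. *)

Local Notation normc := ComplexField.Normc.normc.

Section ComplexParts.
Variable R : realType.
Implicit Types x y : R[i].

Lemma ReD x y : complex.Re (x + y) = complex.Re x + complex.Re y.
Proof. by case: x; case: y. Qed.

Lemma ImD x y : complex.Im (x + y) = complex.Im x + complex.Im y.
Proof. by case: x; case: y. Qed.

Lemma ReN x : complex.Re (- x) = - complex.Re x.
Proof. by case: x. Qed.

Lemma ImN x : complex.Im (- x) = - complex.Im x.
Proof. by case: x. Qed.

Lemma ReM x y : complex.Re (x * y) =
  complex.Re x * complex.Re y - complex.Im x * complex.Im y.
Proof. by case: x; case: y. Qed.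

Lemma ImM x y : complex.Im (x * y) =
  complex.Re x * complex.Im y + complex.Im x * complex.Re y.
Proof. by case: x; case: y. Qed.

Lemma Re_sum I (r : seq I) (F : I -> R[i]) :
  complex.Re (\sum_(i <- r) F i) = \sum_(i <- r) complex.Re (F i).
Proof. exact: (big_morph _ ReD (erefl _)). Qed.

Lemma Im_sum I (r : seq I) (F : I -> R[i]) :
  complex.Im (\sum_(i <- r) F i) = \sum_(i <- r) complex.Im (F i).
Proof. exact: (big_morph _ ImD (erefl _)). Qed.

Lemma normc_ge0 x : 0 <= normc x.
Proof. by case: x => a b /=; rewrite sqrtr_ge0. Qed.

Lemma normc_real (c : R) : normc c%:C = `|c|.
Proof. by rewrite /= expr0n addr0 sqrtr_sqr. Qed.

Lemma Re_le_normc x : `|complex.Re x| <= normc x.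
Proof.
case: x => a b /=; rewrite -sqrtr_sqr ler_wsqrtr//.
by rewrite lerDl sqr_ge0.
Qed.

Lemma Im_le_normc x : `|complex.Im x| <= normc x.
Proof.
case: x => a b /=; rewrite -sqrtr_sqr ler_wsqrtr//.
by rewrite lerDr sqr_ge0.
Qed.

Lemma normc_le_parts x : normc x <= `|complex.Re x| + `|complex.Im x|.
Proof.
case: x => a b /=; have h : 0 <= `|a| + `|b| by rewrite addr_ge0.
rewrite -[leRHS](ger0_norm h) -[leRHS]sqrtr_sqr ler_wsqrtr//.
rewrite sqrrD !real_normK ?num_real// -addrA [X in _ <= _ + X]addrC addrA lerDl.
by rewrite mulrn_wge0 ?mulr_ge0.
Qed.

End ComplexParts.

(* ['M_N] is an algebra in the library only for [N] of the form [n.+1]. *)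
Section Scaling.
Variables (K : comPzRingType) (N : nat).
Implicit Types (A B : 'M[K]_N) (a b : K).

Lemma scaleMl a A B : a *: A * B = a *: (A * B).
Proof. exact: (esym (scalemxAl a A B)). Qed.

Lemma scaleMr a A B : A * (a *: B) = a *: (A * B).
Proof. exact: (esym (scalemxAr a A B)). Qed.

Lemma expZmx a A n : (a *: A) ^+ n = a ^+ n *: A ^+ n.
Proof.
elim: n => [|n IH]; first by rewrite !expr0 scale1r.
by rewrite !exprS IH scaleMl scaleMr scalerA.
Qed.

End Scaling.

Section Coordinates.
Variables (R : realType) (N : nat).
Local Notation mat := 'M[R[i]]_N.
Local Notation idx := (bool * ('I_N * 'I_N))%type.
Implicit Types (A B M : mat) (k : idx).

(** The real coordinates of a matrix: the boolean selects the real ([true]) or imaginary part, the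
    pair selects the entry. Real analysis is applied to each coordinate separately. *)
Definition co k M : R :=
  if k.1 then complex.Re (M k.2.1 k.2.2) else complex.Im (M k.2.1 k.2.2).

Lemma coP A B : (forall k, co k A = co k B) -> A = B.
Proof.
move=> h; apply/matrixP => i j.
have := h (true, (i, j)); have := h (false, (i, j)).
by rewrite /co /=; case: (A i j) => a b; case: (B i j) => c d /= -> ->.
Qed.

Lemma coD k A B : co k (A + B) = co k A + co k B.
Proof. by rewrite /co !mxE; case: k.1; rewrite ?ReD ?ImD. Qed.

Lemma coN k A : co k (- A) = - co k A.
Proof. by rewrite /co !mxE; case: k.1; rewrite ?ReN ?ImN. Qed.

Lemma coB k A B : co k (A - B) = co k A - co k B.
Proof. by rewrite coD coN. Qed.

Lemma co0 k : co k (0 : mat) = 0.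
Proof. by rewrite /co mxE; case: k.1. Qed.

Lemma co_sum k I (r : seq I) (F : I -> mat) :
  co k (\sum_(i <- r) F i) = \sum_(i <- r) co k (F i).
Proof. exact: (big_morph _ (coD k) (co0 k)). Qed.

Lemma coZ k (c : R) A : co k (c%:C *: A) = c * co k A.
Proof.
by rewrite /co !mxE; case: k.1; rewrite ?ReM ?ImM/= !mul0r ?subr0 ?addr0.
Qed.

(** One formula for both parts of a complex product; the flip [~~ k.1] and the sign distinguish
    them. It makes a product bilinear in real coordinates, which gives limits, continuity and
    derivatives of products at once. *)
Lemma coM k A B : co k (A * B) = \sum_(l < N)
  (co (true, (k.2.1, l)) A * co (k.1, (l, k.2.2)) B +
   (if k.1 then -1 else 1) * (co (false, (k.2.1, l)) A * co (~~ k.1, (l, k.2.2)) B)).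
Proof.
case: k => -[] [i j]; rewrite /co /= mxE ?Re_sum ?Im_sum;
  apply: eq_bigr => l _; rewrite ?ReM ?ImM; ring.
Qed.

(* Sealed: comparing two distinct norms by conversion would unfold the matrices. *)
Fact nrm_subproof : {f : mat -> R | forall M, f M = \sum_i \sum_j normc (M i j)}.
Proof. by exists (fun M => \sum_i \sum_j normc (M i j)). Qed.

Definition nrm : mat -> R := sval nrm_subproof.

Lemma nrmE M : nrm M = \sum_i \sum_j normc (M i j).
Proof. exact: (svalP nrm_subproof). Qed.

Lemma nrm_ge0 A : 0 <= nrm A.
Proof.
by rewrite nrmE; apply: sumr_ge0 => i _; apply: sumr_ge0 => j _; exact: normc_ge0.
Qed.

Lemma nrm0 : nrm 0 = 0.
Proof.
by rewrite !nrmE big1// => i _; rewrite big1// => j _; rewrite mxE ComplexField.Normc.normc0.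
Qed.

Lemma nrmD A B : nrm (A + B) <= nrm A + nrm B.
Proof.
rewrite !nrmE -big_split/=; apply: ler_sum => i _.
by rewrite -big_split/=; apply: ler_sum => j _; rewrite mxE le_normcD.
Qed.

Lemma nrmZ (c : R[i]) A : nrm (c *: A) = normc c * nrm A.
Proof.
rewrite !nrmE mulr_sumr; apply: eq_bigr => i _; rewrite mulr_sumr.
by apply: eq_bigr => j _; rewrite mxE ComplexField.Normc.normcM.
Qed.

Lemma nrmN A : nrm (- A) = nrm A.
Proof. by rewrite -scaleN1r nrmZ normcN ComplexField.Normc.normc1 mul1r. Qed.

Lemma nrmB A B : nrm (A - B) <= nrm A + nrm B.
Proof. by rewrite -(nrmN B) nrmD. Qed.

Lemma nrm_sum I (r : seq I) (F : I -> mat) :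
  nrm (\sum_(i <- r) F i) <= \sum_(i <- r) nrm (F i).
Proof.
elim: r => [|i r IH]; first by rewrite !big_nil nrm0.
by rewrite !big_cons (le_trans (nrmD _ _))// lerD2l.
Qed.

Lemma normc_sum I (r : seq I) (F : I -> R[i]) :
  normc (\sum_(i <- r) F i) <= \sum_(i <- r) normc (F i).
Proof.
elim: r => [|i r IH]; first by rewrite !big_nil ComplexField.Normc.normc0.
by rewrite !big_cons (le_trans (le_normcD _ _))// lerD2l.
Qed.

Lemma nrmM A B : nrm (A * B) <= nrm A * nrm B.
Proof.
rewrite nrmE.
apply: (@le_trans _ _ (\sum_i \sum_l normc (A i l) * \sum_j normc (B l j))).
  apply: ler_sum => i _; under [leRHS]eq_bigr do rewrite mulr_sumr.
  rewrite exchange_big/=; apply: ler_sum => j _; rewrite mxE.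
  apply: le_trans (normc_sum _ _) _.
  by apply: ler_sum => l _; rewrite ComplexField.Normc.normcM.
rewrite !nrmE mulr_suml; apply: ler_sum => i _; rewrite mulr_suml.
apply: ler_sum => l _; apply: ler_wpM2l; first exact: normc_ge0.
rewrite [leRHS](bigD1 l)//= lerDl.
by apply: sumr_ge0 => m _; apply: sumr_ge0 => j _; exact: normc_ge0.
Qed.

(** The entrywise sum norm of the identity is [N], not 1, so the factor [nrm 1] is carried along,
    here and in all later bounds on exponentials. *)
Lemma nrmX A n : nrm (A ^+ n) <= nrm 1 * nrm A ^+ n.
Proof.
elim: n => [|n IH]; first by rewrite !expr0 mulr1.
rewrite exprSr (le_trans (nrmM _ _))// exprSr mulrA.
by rewrite ler_wpM2r ?nrm_ge0.
Qed.

Lemma normc_le_nrm A i j : normc (A i j) <= nrm A.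
Proof.
rewrite !nrmE (bigD1 i)//= (bigD1 j)//= -addrA lerDl.
apply: addr_ge0; first by apply: sumr_ge0 => l _; exact: normc_ge0.
by apply: sumr_ge0 => l _; apply: sumr_ge0 => m _; exact: normc_ge0.
Qed.

Lemma co_le_nrm k A : `|co k A| <= nrm A.
Proof.
apply: (le_trans _ (normc_le_nrm A k.2.1 k.2.2)).
by rewrite /co; case: k.1; [exact: Re_le_normc|exact: Im_le_normc].
Qed.

Lemma nrm_le_co A : nrm A <= \sum_k `|co k A|.
Proof.
rewrite -(pair_bigA _ (fun b p => `|co (b, p) A|))/= big_bool/= -big_split/=.
rewrite -(pair_bigA _ (fun i j => `|co (true, (i, j)) A| + `|co (false, (i, j)) A|))/=.
by rewrite !nrmE; apply: ler_sum => i _; apply: ler_sum => j _; exact: normc_le_parts.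
Qed.

End Coordinates.

Local Notation normcM := ComplexField.Normc.normcM.
Local Notation normc1 := ComplexField.Normc.normc1.
Local Notation normc0 := ComplexField.Normc.normc0.

Lemma cvgr_sum (T : Type) (F : set_system T) {FF : Filter F} (R : realType)
    (I : Type) (r : seq I) (f : I -> T -> R) (a : I -> R) :
  (forall i, f i x @[x --> F] --> a i) ->
  \sum_(i <- r) f i x @[x --> F] --> \sum_(i <- r) a i.
Proof. by move=> h; apply: cvg_big => //; exact: add_continuous. Qed.

(** * Coordinatewise limits and their link with the matrix topology *)

Section Limits.
Variables (R : realType) (N : nat).
Local Notation mat := 'M[R[i]]_N.
Local Notation idx := (bool * ('I_N * 'I_N))%type.
Implicit Types (A B M l : mat) (k : idx) (u v : nat -> mat).

Definition mcvg u l := forall k, (fun n => co k (u n)) @ \oo --> co k l.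

Lemma mcvg_unique u l l' : mcvg u l -> mcvg u l' -> l = l'.
Proof. by move=> h h'; apply: coP => k; exact: (cvg_unique _ (h k) (h' k)). Qed.

Lemma mcvg_cst l : mcvg (fun=> l) l.
Proof. by move=> k; exact: cvg_cst. Qed.

Lemma mcvg_ext u v l : (forall n, u n = v n) -> mcvg u l -> mcvg v l.
Proof. by move=> /funext ->. Qed.

Lemma mcvgM u v l m : mcvg u l -> mcvg v m -> mcvg (fun n => u n * v n) (l * m).
Proof.
move=> hu hv k; rewrite coM; under eq_fun do rewrite coM.
apply: (@cvgr_sum _ \oo) => i; apply: cvgD; first exact: cvgM.
by apply: cvgM; [exact: cvg_cst|exact: cvgM].
Qed.

Lemma mcvg_shift u l m : mcvg u l -> mcvg (fun n => u (n + m)%N) l.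
Proof. by move=> h k; have := h k; rewrite -(cvg_shiftn m). Qed.

Lemma mcvg_nrm0 u l : (fun n => nrm (u n - l)) @ \oo --> (0 : R) -> mcvg u l.
Proof.
move=> h k; apply/cvgrPdist_le => e e0; near=> n.
rewrite -coB (le_trans (co_le_nrm _ _))// -opprB nrmN.
have : `|0 - nrm (u n - l)| <= e by near: n; move/cvgrPdist_le : h; apply.
by rewrite sub0r normrN ger0_norm ?nrm_ge0.
Unshelve. all: by end_near. Qed.

Lemma mcvg_nrm u l : mcvg u l -> (fun n => nrm (u n - l)) @ \oo --> (0 : R).
Proof.
move=> h; apply: (@squeeze_cvgr _ _ _ _ (fun=> 0) (fun n => \sum_k `|co k (u n - l)|)).
- by apply: nearW => n; rewrite nrm_ge0 nrm_le_co.
- exact: cvg_cst.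
- suff : (fun n => \sum_k `|co k (u n - l)|) @ \oo --> \sum_(k : idx) (0 : R).
    by rewrite big1.
  apply: (@cvgr_sum _ \oo) => k; rewrite -(@normr0 _ R); apply: cvg_norm.
  under eq_fun do rewrite coB.
  by rewrite -(subrr (co k l)); apply: cvgB; [exact: h|exact: cvg_cst].
Qed.

Lemma nrm_lim u l (c : R) : mcvg u l -> (forall n, nrm (u n) <= c) -> nrm l <= c.
Proof.
move=> /mcvg_nrm hu hc; apply/ler_addgt0Pr => e e0.
have /cvgrPdist_le /(_ e e0) [n _ /(_ n (leqnn n))] /= := hu.
rewrite sub0r normrN ger0_norm ?nrm_ge0// => h.
rewrite -[l](subKr (u n)); apply: le_trans (nrmB _ _) _.
by rewrite lerD.
Qed.

(** The bridge from coordinatewise convergence to the topological limit in which [mx_exp] and [pFq]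
    are defined; everything else stays with [mcvg]. *)
Lemma mx_series_cvgP (u : nat -> mat) l : mcvg (series u) l ->
  mx_series_cvg u /\ mx_series_sum u = l.
Proof.
move=> h.
have H : series (u : nat -> 'M[R[i]^o]_N) @ \oo --> (l : 'M[R[i]^o]_N).
  (* The radius of a ball is a positive element of [R[i]]; positivity there forces a zero imaginary
     part, so it is a real number. *)
  apply/cvg_ballP => e e0; have := e0; rewrite ltcE/= => /andP[/eqP ie re0].
  have eE : e = (complex.Re e)%:C by move: ie; clear; case: e => a b /= ->.
  have /mcvg_nrm/cvgrPdist_lt /(_ _ re0) h' := h.
  near=> n; split => // i j.
  rewrite -ball_normE/= eE.
  have : nrm (series u n - l) < complex.Re e.
    suff : `|0 - nrm (series u n - l)| < complex.Re e.
      by rewrite sub0r normrN ger0_norm ?nrm_ge0.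
    by near: n.
  move=> hn; rewrite distrC.
  have -> : series (u : nat -> 'M[R[i]^o]_N) n i j - l i j = (series u n - l) i j.
    by rewrite !mxE.
  by rewrite [`|_|]/(normc _)%:C ltcR; apply: le_lt_trans hn; exact: normc_le_nrm.
split; first by apply/cvg_ex; exists l.
exact: (cvg_lim (@norm_hausdorff _ _)) H.
Unshelve. all: by end_near. Qed.

(* A normally convergent series of matrices converges entrywise. *)
Lemma mcvg_normal (u : nat -> mat) (a : nat -> R) : (forall n, nrm (u n) <= a n) ->
  cvgn (series a) -> exists l, mcvg (series u) l.
Proof.
move=> hu ha.
have hk k : cvgn (series (fun n => co k (u n))).
  apply: normed_cvg; apply: series_le_cvg ha => n //=.
    exact: le_trans (nrm_ge0 _) (hu n).
  exact: le_trans (co_le_nrm _ _) (hu n).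
pose S k := limn (series (fun n => co k (u n))).
exists (\matrix_(i, j) (S (true, (i, j)) +i* S (false, (i, j)))) => -[b [i j]].
under eq_fun do rewrite co_sum.
have -> : co (b, (i, j)) (\matrix_(i, j) (S (true, (i, j)) +i* S (false, (i, j)))) = S (b, (i, j)).
  by rewrite /co mxE /=; case: b.
exact: hk.
Qed.

End Limits.

Arguments mcvg_cst {R N} l.

(** * Derivatives of matrix functions and a mean value inequality *)

Section Derivatives.
Variables (R : realType) (N : nat).
Local Notation mat := 'M[R[i]]_N.
Local Notation idx := (bool * ('I_N * 'I_N))%type.
Implicit Types (A B M D : mat) (k : idx) (F G : R -> mat) (t x y : R).

Definition mderiv F t D := forall k, is_derive t 1 (fun s => co k (F s)) (co k D).

Lemma is_derive_ext (f g : R -> R) t d : (forall s, f s = g s) ->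
  is_derive t 1 f d -> is_derive t 1 g d.
Proof. by move=> /funext ->. Qed.

Lemma mderiv_ext F G t D : (forall s, F s = G s) -> mderiv F t D -> mderiv G t D.
Proof. by move=> /funext ->. Qed.

Lemma mderiv_eq F t D D' : mderiv F t D -> D = D' -> mderiv F t D'.
Proof. by move=> h <-. Qed.

Lemma mderiv_cst M t : mderiv (fun=> M) t 0.
Proof. by move=> k; rewrite co0; exact: is_derive_cst. Qed.

Lemma mderivD F G t D E : mderiv F t D -> mderiv G t E ->
  mderiv (fun s => F s + G s) t (D + E).
Proof.
move=> hF hG k; rewrite coD; apply: is_derive_ext (is_deriveD (hF k) (hG k)) => s.
by rewrite coD.
Qed.

Lemma is_deriveMr (f g : R -> R) t a b : is_derive t 1 f a -> is_derive t 1 g b ->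
  is_derive t 1 (fun s => f s * g s) (a * g t + f t * b).
Proof.
move=> hf hg; apply: (@is_derive_eq _ _ _ _ _ _ _ _ (is_deriveM hf hg)).
by rewrite addrC [X in X + _]mulrC.
Qed.

Lemma is_derive_sumr (I : Type) (r : seq I) (f : I -> R -> R) (d : I -> R) t :
  (forall i, is_derive t 1 (f i) (d i)) ->
  is_derive t 1 (fun s => \sum_(i <- r) f i s) (\sum_(i <- r) d i).
Proof.
move=> h; elim: r => [|i r IH].
  rewrite big_nil; apply: is_derive_ext (is_derive_cst (0 : R) t 1) => s.
  by rewrite big_nil.
rewrite big_cons; apply: is_derive_ext (is_deriveD (h i) IH) => s.
by rewrite big_cons.
Qed.

Lemma mderivM F G t D E : mderiv F t D -> mderiv G t E ->
  mderiv (fun s => F s * G s) t (D * G t + F t * E).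
Proof.
move=> hF hG k; rewrite coD !coM -big_split/=.
apply: (@is_derive_ext (fun s => \sum_(l < N)
  (co (true, (k.2.1, l)) (F s) * co (k.1, (l, k.2.2)) (G s) +
   (if k.1 then -1 else 1) * (co (false, (k.2.1, l)) (F s) * co (~~ k.1, (l, k.2.2)) (G s))))).
  by move=> s; rewrite coM.
apply: is_derive_sumr => l.
have h1 := is_deriveMr (hF (true, (k.2.1, l))) (hG (k.1, (l, k.2.2))).
have h2 := is_deriveMr (hF (false, (k.2.1, l))) (hG (~~ k.1, (l, k.2.2))).
have h3 := is_deriveMr (is_derive_cst (if k.1 then -1 else 1 : R) t 1) h2.
apply: (@is_derive_eq _ _ _ _ _ _ _ _ (is_deriveD h1 h3)).
rewrite /cst; case: k.1; ring.
Qed.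

Lemma mderivMl M F t D : mderiv F t D -> mderiv (fun s => M * F s) t (M * D).
Proof. by move=> h; apply: mderiv_eq (mderivM (mderiv_cst M t) h) _; rewrite mul0r add0r. Qed.

Lemma mderivZ (c : R -> R) F t c' D : is_derive t 1 c c' -> mderiv F t D ->
  mderiv (fun s => (c s)%:C *: F s) t (c'%:C *: F t + (c t)%:C *: D).
Proof.
move=> hc hF k; rewrite coD !coZ.
by apply: is_derive_ext (is_deriveMr hc (hF k)) => s; rewrite coZ.
Qed.

Lemma mderiv_comp F (g : R -> R) t g' D : mderiv F (g t) D -> is_derive t 1 g g' ->
  mderiv (fun s => F (g s)) t (g'%:C *: D).
Proof.
move=> hF hg k; rewrite coZ mulrC.
by apply: is_derive_ext (is_derive1_comp (hF k) hg).
Qed.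

Lemma mderiv0_cst F x y : (forall t, mderiv F t 0) -> F x = F y.
Proof.
move=> h; apply: coP => k; apply: (@is_derive_0_is_cst _ (fun s => co k (F s))) => t.
by have := h t k; rewrite co0.
Qed.

Lemma derive_ge0_le (f f' : R -> R) x y : x <= y ->
  (forall t, x <= t <= y -> is_derive t 1 f (f' t)) ->
  (forall t, x <= t <= y -> 0 <= f' t) -> f x <= f y.
Proof.
rewrite le_eqVlt => /predU1P[->//|xy] hf h.
have [||c cab E] := @MVT _ f f' x y xy.
- by move=> t; rewrite in_itv/= => /andP[a b]; apply: hf; rewrite !ltW.
- apply: derivable_within_continuous => t; rewrite in_itv/= => ab.
  by have := hf t ab.
rewrite -subr_ge0 E mulr_ge0 ?subr_ge0 ?(ltW xy)//.
by move: cab; rewrite in_itv/= => /andP[a b]; apply: h; rewrite !ltW.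
Qed.

(** For every coordinate, [g - co k F] and [g + co k F] are nondecreasing, since their derivatives
    are nonnegative. Summing over the coordinates costs the factor [2 N^2], which is absorbed into
    constants later. *)
Lemma mderiv_ineq F (F' : R -> mat) (g g' : R -> R) x y : x <= y ->
  (forall t, x <= t <= y -> mderiv F t (F' t)) ->
  (forall t, x <= t <= y -> is_derive t 1 g (g' t)) ->
  (forall t, x <= t <= y -> nrm (F' t) <= g' t) ->
  nrm (F y - F x) <= #|{: idx}|%:R * (g y - g x).
Proof.
move=> xy hF hg hb; apply: le_trans (nrm_le_co _) _.
rewrite mulr_natl -sumr_const; apply: ler_sum => k _; rewrite coB ler_norml.
have h1 : g x - co k (F x) <= g y - co k (F y).
  apply: (@derive_ge0_le (fun s => g s - co k (F s)) (fun s => g' s - co k (F' s))) => // t ht.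
    exact: is_deriveB (hg t ht) (hF t ht k).
  rewrite subr_ge0 (le_trans _ (hb t ht))// (le_trans (ler_norm _))//; exact: co_le_nrm.
have h2 : g x + co k (F x) <= g y + co k (F y).
  apply: (@derive_ge0_le (fun s => g s + co k (F s)) (fun s => g' s + co k (F' s))) => // t ht.
    exact: is_deriveD (hg t ht) (hF t ht k).
  have := le_trans (co_le_nrm k (F' t)) (hb t ht); rewrite ler_norml => /andP[+ _]; lra.
by apply/andP; split; lra.
Qed.

End Derivatives.

(** * The matrix exponential *)

(** The left side is the derivative of [exp (s (A + B)) exp (- s A) exp (- s B)], the three factors
    being [X], [Y], [Z]. *)
Local Lemma exp_derivative_cancel (T : pzRingType) (A B X Y Z : T) :
  GRing.comm A X -> GRing.comm B X -> GRing.comm B Y ->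
  ((A + B) * X * Y + X * (- A * Y)) * Z + X * Y * (- B * Z) = 0.
Proof.
move=> AX BX BY.
have -> : X * (- A * Y) = - (A * X * Y) by rewrite mulNr mulrN mulrA AX.
have -> : X * Y * (- B * Z) = - (B * X * Y * Z).
  by rewrite mulNr mulrN !mulrA -(mulrA X Y B) -BY mulrA BX.
by rewrite !mulrDl mulNr (addrC (A * X * Y * Z)) addrK subrr.
Qed.

Local Lemma eq_mul_of_inverses (T : pzRingType) (e a b a' b' : T) :
  e * a' * b' = 1 -> a' * a = 1 -> b' * b = 1 -> GRing.comm a b -> e = a * b.
Proof.
move=> h ha hb ab; rewrite ab -[b * a]mul1r -h !mulrA -(mulrA _ b' b) hb mulr1.
by rewrite -mulrA ha mulr1.
Qed.

Section Exponential.
Variables (R : realType) (N : nat).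
Local Notation mat := 'M[R[i]]_N.
Local Notation idx := (bool * ('I_N * 'I_N))%type.
Implicit Types (A B M D : mat) (k : idx) (s t x y : R).

Let eterm A (n : nat) : mat := (n`!%:R^-1 : R[i]) *: A ^+ n.

Lemma nrm_eterm A n : nrm (eterm A n) <= (nrm (1 : mat)) * exp_coeff (nrm A) n.
Proof.
rewrite /eterm nrmZ.
have -> : normc (n`!%:R^-1 : R[i]) = n`!%:R^-1.
  have -> : (n`!%:R^-1 : R[i]) = (n`!%:R^-1 : R)%:C by rewrite fmorphV rmorph_nat.
  by rewrite normc_real ger0_norm// invr_ge0.
rewrite /exp_coeff/= mulrC mulrA; apply: ler_wpM2r; first by rewrite invr_ge0.
exact: nrmX.
Qed.

Lemma mx_expP A : mcvg (series (eterm A)) (mx_exp A).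
Proof.
have [l hl] : exists l, mcvg (series (eterm A)) l.
  apply: mcvg_normal (nrm_eterm A) _.
  exact: is_cvg_seriesZ (is_cvg_series_exp_coeff (nrm A)).
by rewrite /mx_exp (mx_series_cvgP hl).2.
Qed.

Arguments mx_expP : clear implicits.

Lemma nrm_mx_exp A : nrm (mx_exp A) <= nrm (1 : mat) * expR (nrm A).
Proof.
apply: nrm_lim (mx_expP A) _ => n; apply: le_trans (nrm_sum _ _) _.
apply: (@le_trans _ _ (\sum_(0 <= i < n) nrm (1 : mat) * exp_coeff (nrm A) i)).
  by apply: ler_sum => i _; exact: nrm_eterm.
rewrite -mulr_sumr; apply: ler_wpM2l; first exact: nrm_ge0.
apply: nondecreasing_cvgn_le (is_cvg_series_exp_coeff (nrm A)) n.
by apply: nondecreasing_series => i _ _; rewrite /exp_coeff/= divr_ge0// exprn_ge0// nrm_ge0.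
Qed.

(** Coefficients of the real power series of [s -> co k (B * exp (s A))]. The left factor [B] keeps
    the family stable under termwise differentiation, which replaces [B] by [B * A]. *)
Let cf B A k n : R := co k (B * A ^+ n) / n`!%:R.

Lemma pseries_mx_exp B A k s :
  pseries (cf B A k) s @ \oo --> co k (B * mx_exp (s%:C *: A)).
Proof.
have h := mcvgM (mcvg_cst B) (mx_expP (s%:C *: A)).
apply: cvg_trans (h k); apply: near_eq_cvg; apply: nearW => n.
rewrite /= mulr_sumr co_sum; apply: eq_bigr => i _.
rewrite /eterm expZmx -rmorphXn/=.
have -> : (i`!%:R^-1 : R[i]) = (i`!%:R^-1 : R)%:C by rewrite fmorphV rmorph_nat.
by rewrite !scaleMr !coZ /cf; ring.
Qed.

Lemma mderiv_exp A t : mderiv (fun s => mx_exp (s%:C *: A)) t (A * mx_exp (t%:C *: A)).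
Proof.
have diffs B k : pseries_diffs (cf B A k) = cf (B * A) A k.
  apply/funext => n; rewrite /pseries_diffs /cf -(mulrA B A) -exprS factS natrM.
  have h1 : (n.+1%:R : R) != 0 by rewrite pnatr_eq0.
  have h2 : (n`!%:R : R) != 0 by rewrite pnatr_eq0 -lt0n fact_gt0.
  set c := co _ _; move: c (n.+1%:R) (n`!%:R) h1 h2 => c a b h1 h2.
  by field; rewrite h1 h2.
have cv B k s : cvgn (pseries (cf B A k) s).
  by apply/cvg_ex; eexists; exact: pseries_mx_exp.
move=> k.
have -> : (fun s => co k (mx_exp (s%:C *: A))) = fun s => limn (pseries (cf 1 A k) s).
  apply/funext => s; rewrite -[mx_exp _]mul1r; apply/esym/cvg_lim => //.
  exact: pseries_mx_exp.
have := @pseries_snd_diffs R (cf 1 A k) (`|t| + 1) t.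
rewrite !diffs !mul1r => /(_ (cv _ _ _) (cv _ _ _) (cv _ _ _)).
have -> : limn (pseries (cf A A k) t) = co k (A * mx_exp (t%:C *: A)).
  by apply/cvg_lim => //; exact: pseries_mx_exp.
apply; rewrite [ltRHS]ger0_norm ?addr_ge0//; lra.
Qed.

Lemma mx_exp0 : mx_exp (0 : mat) = 1.
Proof.
apply: (mcvg_unique (@mcvg_shift _ _ _ _ 1 (mx_expP 0))).
apply: mcvg_ext (mcvg_cst 1) => n; apply/esym.
rewrite /series/= addn1 big_nat_recl// big1 ?addr0 => [|i _].
  by rewrite /eterm expr0 fact0 invr1 scale1r.
by rewrite /eterm expr0n scaler0.
Qed.

Lemma comm_mx_exp A B : GRing.comm A B -> GRing.comm A (mx_exp B).
Proof.
move=> h; apply: (mcvg_unique (mcvgM (mcvg_cst A) (mx_expP B))).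
apply: mcvg_ext (mcvgM (mx_expP B) (mcvg_cst A)) => n.
rewrite /= mulr_sumr mulr_suml; apply: eq_bigr => i _.
by rewrite /eterm scaleMl scaleMr (commrX i h).
Qed.

Lemma comm_exp_exp A B : GRing.comm A B -> GRing.comm (mx_exp A) (mx_exp B).
Proof. by move=> h; apply/comm_mx_exp/commr_sym/comm_mx_exp/commr_sym. Qed.

Lemma commZ A B (c : R[i]) : GRing.comm A B -> GRing.comm A (c *: B).
Proof. by rewrite /GRing.comm scaleMr scaleMl => ->. Qed.

(** A derivative argument in place of a Cauchy product of series: the same product along [s A],
    [s B] has zero derivative and equals 1 at [s = 0]. *)
Let expDN A B : GRing.comm A B -> mx_exp (A + B) * mx_exp (- A) * mx_exp (- B) = 1.
Proof.
move=> AB.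
pose F s := mx_exp (s%:C *: (A + B)) * mx_exp (s%:C *: (- A)) * mx_exp (s%:C *: (- B)).
have : F 1 = F 0.
  apply: mderiv0_cst => t.
  pose X := mx_exp (t%:C *: (A + B)).
  pose Y := mx_exp (t%:C *: (- A)); pose Z := mx_exp (t%:C *: (- B)).
  have dF : mderiv F t (((A + B) * X * Y + X * (- A * Y)) * Z + X * Y * (- B * Z)).
    exact: (mderivM (mderivM (mderiv_exp (A + B) t) (mderiv_exp (- A) t)) (mderiv_exp (- B) t)).
  have cX : GRing.comm A X.
    by apply/comm_mx_exp/commZ; apply: commrD.
  have cX' : GRing.comm B X.
    by apply/comm_mx_exp/commZ; apply: commrD => //; exact: commr_sym.
  have cY : GRing.comm B Y.
    by apply/comm_mx_exp/commZ; apply: commrN; exact: commr_sym.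
  by rewrite (@exp_derivative_cancel _ A B X Y Z cX cX' cY) in dF.
by rewrite /F !scale1r !scale0r mx_exp0 !mulr1.
Qed.

Lemma mx_expN A : mx_exp A * mx_exp (- A) = 1.
Proof. by have := @expDN A 0 (commr0 A); rewrite addr0 oppr0 mx_exp0 mulr1. Qed.

Lemma mx_expD A B : GRing.comm A B -> mx_exp (A + B) = mx_exp A * mx_exp B.
Proof.
move=> AB; have h := expDN AB.
have hA : mx_exp (- A) * mx_exp A = 1 by have := mx_expN (- A); rewrite opprK.
have hB : mx_exp (- B) * mx_exp B = 1 by have := mx_expN (- B); rewrite opprK.
exact: (@eq_mul_of_inverses _ _ _ _ _ _ h hA hB (comm_exp_exp AB)).
Qed.

Lemma mderiv_exp_comp A (g : R -> R) g' t : is_derive t 1 g g' ->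
  mderiv (fun s => mx_exp ((g s)%:C *: A)) t (g'%:C *: (A * mx_exp ((g t)%:C *: A))).
Proof. exact: (mderiv_comp (F := fun s => mx_exp (s%:C *: A)) (mderiv_exp A (g t))). Qed.

End Exponential.

Arguments mx_expP {R N} A.

(** * Exponential decay under positive stability *)

Section Decay.
Variables (R : realType).
Implicit Types (s t x y : R) (c r : R[i]).

Definition cexp c : R[i] :=
  (expR (complex.Re c) * cos (complex.Im c)) +i* (expR (complex.Re c) * sin (complex.Im c)).

Lemma normc_cexp c : normc (cexp c) = expR (complex.Re c).
Proof.
rewrite /cexp /= !exprMn -mulrDr cos2Dsin2 mulr1 sqrtr_sqr ger0_norm//.
Qed.

Variable N : nat.
Local Notation mat := 'M[R[i]]_N.
Implicit Types (A B M : mat).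

Lemma comm_scalar A c : GRing.comm A c%:M.
Proof. exact: scalar_mxC. Qed.

(** The product of [cexp (s c)] and [exp (- s c)] is constant in [s], hence 1. The function [F]
    splits [cexp] into its real and imaginary parts because [mderivZ] handles real coefficients. *)
Lemma mx_exp_scalar c : mx_exp (c%:M : mat) = (cexp c)%:M.
Proof.
case: c => a b.
pose X s := mx_exp (s%:C *: (- (a +i* b)%:M : mat)).
pose F s := (expR (s * a) * cos (s * b))%:C *: X s +
            (expR (s * a) * sin (s * b))%:C *: ('i *: X s).
have dX t : mderiv X t (- (a +i* b)%:M * X t) by exact: mderiv_exp.
have dl t (u : R) : is_derive t 1 (fun s => s * u) u.
  by apply: is_derive_eq; rewrite /GRing.scale/=; ring.
have de t : is_derive t 1 (fun s => expR (s * a)) (a * expR (t * a)).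
  by apply: is_derive_eq; rewrite /GRing.scale/=; ring.
have dc t : is_derive t 1 (fun s => cos (s * b)) (- b * sin (t * b)).
  by apply: is_derive_eq; rewrite /GRing.scale/=; ring.
have ds t : is_derive t 1 (fun s => sin (s * b)) (b * cos (t * b)).
  by apply: is_derive_eq; rewrite /GRing.scale/=; ring.
have E : F 1 = F 0.
  apply: mderiv0_cst => t.
  have diX : mderiv (fun s => 'i *: X s) t ('i *: (- (a +i* b)%:M * X t)).
    have := mderivMl ('i%:M) (dX t).
    rewrite mulrA; set Y := _ * X t.
    have -> : Y = 'i *: (- (a +i* b)%:M * X t) by rewrite /Y -mulrA; exact: mul_scalar_mx.
    by apply: mderiv_ext => s; exact: mul_scalar_mx.
  apply: mderiv_eq (mderivD (mderivZ (is_deriveMr (de t) (dc t)) (dX t))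
     (mderivZ (is_deriveMr (de t) (ds t)) diX)) _.
  have -> : - (a +i* b)%:M * X t = - ((a +i* b) *: X t).
    by rewrite mulNr; congr (- _); exact: mul_scalar_mx.
  move: (X t) (expR (t * a)) (cos (t * b)) (sin (t * b)) => Z e co' si.
  rewrite -!scaleNr !scalerA -!scalerDl.
  set u := (X in X *: _); have -> : u = 0; last by rewrite scale0r.
  by rewrite /u; apply/eqP; rewrite eq_complex /=; apply/andP; split; apply/eqP; ring.
have F0 : F 0 = 1.
  by rewrite /F /X !mul0r expR0 cos0 sin0 !mul1r rmorph0 rmorph1 !scale0r scale1r addr0 mx_exp0.
have F1 : F 1 = (cexp (a +i* b))%:M * mx_exp (- (a +i* b)%:M).
  rewrite /F /X !mul1r scale1r scalerA -scalerDl.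
  have -> : (cexp (a +i* b))%:M * mx_exp (- (a +i* b)%:M) =
     cexp (a +i* b) *: mx_exp (- (a +i* b)%:M : mat) by exact: mul_scalar_mx.
  congr (_ *: _); rewrite /cexp /=.
  by apply/eqP; rewrite eq_complex /=; apply/andP; split; apply/eqP; ring.
have h := mx_expN (- (a +i* b)%:M : mat).
rewrite opprK in h.
rewrite -[LHS]mul1r -F0 -E F1 -mulrA h mulr1//.
Qed.

Lemma nrm_scalar_mul c M : nrm (c%:M * M) = normc c * nrm M.
Proof.
have -> : c%:M * M = c *: M by exact: mul_scalar_mx.
exact: nrmZ.
Qed.

End Decay.

Section SpectralBound.
Variables (R : realType) (n : nat).
Local Notation mat := 'M[R[i]]_n.+1.
Implicit Types (A M : mat) (rs : seq R[i]) (s t : R).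
Local Notation K := (#|{: bool * ('I_n.+1 * 'I_n.+1)}|%:R : R).

(* Induction on the factors [A - r] that annihilate [M]: the derivative of
   [exp(s (r - A)) M] is [- exp(s (r - A)) (A - r) M], where [(A - r) M] is killed by
   one factor less, and this bound is integrated over [0, s]. *)
Lemma decay_aux A (a : R) rs : (forall r, r \in rs -> a < complex.Re r) ->
  forall M, horner_mx A (\prod_(r <- rs) ('X - r%:P)) * M = 0 ->
  exists C : R, 0 <= C /\
    forall s, 0 <= s -> nrm (mx_exp ((- s)%:C *: A) * M) <= C * expR (- (a * s)).
Proof.
elim: rs => [_ M|r rs IH hrs M].
  rewrite big_nil rmorph1 mul1r => ->; exists 0; split=> // s _.
  by rewrite mulr0 nrm0 mul0r.
rewrite big_cons mulrC rmorphM/= rmorphB/= horner_mx_X horner_mx_C -mulrA => hM.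
have [|C [C0 hC]] := IH _ _ hM.
  by move=> x xrs; apply: hrs; rewrite inE xrs orbT.
have ra : a < complex.Re r by apply: hrs; rewrite mem_head.
set rho := complex.Re r in ra.
have K0 : 0 <= K by [].
have ra0 : 0 < rho - a by rewrite subr_gt0.
pose G s := mx_exp (s%:C *: (r%:M - A)) * M.
have expG s : mx_exp (s%:C *: (r%:M - A)) = (cexp (s%:C * r))%:M * mx_exp ((- s)%:C *: A).
  have -> : s%:C *: (r%:M - A) = (s%:C * r)%:M + (- s)%:C *: A.
    by rewrite scalerBr scale_scalar_mx rmorphN scaleNr.
  rewrite mx_expD ?mx_exp_scalar//; apply: commr_sym; exact: comm_scalar.
have nG s B : nrm (mx_exp (s%:C *: (r%:M - A)) * B) =
    expR (s * rho) * nrm (mx_exp ((- s)%:C *: A) * B).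
  rewrite expG -mulrA nrm_scalar_mul normc_cexp; congr (expR _ * _).
  by rewrite ReM /= mul0r subr0.
have dG t : mderiv G t (- (mx_exp (t%:C *: (r%:M - A)) * ((A - r%:M) * M))).
  apply: mderiv_eq (mderivM (mderiv_exp _ t) (mderiv_cst M t)) _.
  rewrite mulr0 addr0 mulrA -mulNr; congr (_ * _).
  have c : GRing.comm (r%:M - A) (mx_exp (t%:C *: (r%:M - A))).
    exact/comm_mx_exp/commZ.
  by rewrite c -mulrN opprB.
have G0 : G 0 = M by rewrite /G scale0r mx_exp0 mul1r.
have nGs s : nrm (G s) = expR (s * rho) * nrm (mx_exp ((- s)%:C *: A) * M) by exact: nG.
clearbody G.
(* Initial value of [G] plus the integral of the bound on its derivative, which is
   [C * expR ((rho - a) * s)]. Since [a < rho], this exponential is at least 1 and also absorbs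
   [nrm M]; the strict gap replaces the polynomial factors of Jordan blocks. *)
exists (nrm M + K * (C / (rho - a))); split.
  by rewrite addr_ge0 ?nrm_ge0// mulr_ge0// divr_ge0// ltW.
move=> s s0.
have h := @mderiv_ineq R _ G _ (fun t => C / (rho - a) * expR ((rho - a) * t))
   (fun t => C * expR ((rho - a) * t)) 0 s s0 (fun t _ => dG t).
have {}h : nrm (G s - G 0) <= K * (C / (rho - a) * expR ((rho - a) * s)).
  apply: le_trans (h _ _) _.
  - move=> t _; apply: is_derive_eq.
    by rewrite /GRing.scale/=; field; rewrite gt_eqF.
  - move=> t /andP[t0 _]; rewrite nrmN nG.
    apply: le_trans (ler_wpM2l (expR_ge0 _) (hC t t0)) _.
    by rewrite mulrCA -expRD; apply: ler_wpM2l => //; rewrite ler_expR; lra.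
  - apply: ler_wpM2l => //; rewrite lerBlDr lerDl mulr_ge0 ?expR_ge0//.
    by rewrite divr_ge0// ltW.
have hs : nrm (G s) <= nrm M + K * (C / (rho - a) * expR ((rho - a) * s)).
  by rewrite -[G s](subrK (G 0)) addrC {1}G0; apply: le_trans (nrmD _ _) _; rewrite lerD2l.
have : nrm (G s) <= (nrm M + K * (C / (rho - a))) * expR ((rho - a) * s).
  apply: le_trans hs _; rewrite [leRHS]mulrDl -(mulrA K) lerD2r.
  by rewrite ler_peMr ?nrm_ge0// -expR0 ler_expR mulr_ge0// ltW.
rewrite nGs => h2.
have E : expR ((rho - a) * s) = expR (s * rho) * expR (- (a * s)).
  by rewrite -expRD; congr expR; ring.
have := expR_gt0 (s * rho); move: h2; rewrite E; move: (expR (s * rho)) => e h2 e0.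
by rewrite -(ler_pM2l e0) mulrCA.
Qed.

End SpectralBound.

Section StableDecay.
Variables (R : realType) (N : nat).
Local Notation mat := 'M[R[i]]_N.

Lemma positive_stable_decay (A : mat) : positive_stable A ->
  exists a C : R, [/\ 0 < a, 0 <= C &
    forall s, 0 <= s -> nrm (mx_exp ((- s)%:C *: A)) <= C * expR (- (a * s))].
Proof.
(* In size 0 every norm is an empty sum; Horner evaluation at a matrix is used in size [n.+1]. *)
case: N A => [|n] A hA.
  by exists 1, 0; split => // s _; rewrite nrmE big_ord0 mul0r.
have [rs hrs] := closed_field_poly_normal (char_poly A).
rewrite (monicP (char_poly_monic A)) scale1r in hrs.
have pos r : r \in rs -> 0 < complex.Re r.
  by move=> rrs; apply: hA; rewrite eigenvalue_root_char hrs root_prod_XsubC.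
have [a a0 ha] : exists2 a : R, 0 < a & forall r, r \in rs -> a < complex.Re r.
  elim: rs pos {hrs} => [_|r rs IH pos]; first by exists 1.
  have [|a a0 ha] := IH; first by move=> x xrs; apply: pos; rewrite inE xrs orbT.
  have r0 : 0 < complex.Re r by apply: pos; rewrite mem_head.
  exists (Num.min a (complex.Re r / 2)); first by rewrite lt_min a0/=; lra.
  move=> x; rewrite inE => /predU1P[->|/ha]; rewrite gt_min.
    by apply/orP; right; lra.
  by move=> ->.
(* With [M = 1] the annihilation hypothesis is Cayley-Hamilton, the factors being those of the
   characteristic polynomial. *)
have [|C [C0 hC]] := @decay_aux R n A a rs ha 1.
  by rewrite -hrs Cayley_Hamilton mul0r.
by exists a, C; split => // s /hC; rewrite mulr1.
Qed.

End StableDecay.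

(** * Improper integrals *)

Section Exhaustion.
Variable R : realType.
Implicit Types (D : set R) (al be : nat -> R) (f g F G : R -> R) (x y t c M : R).
Local Notation mu := (@lebesgue_measure R).

(** Increasing closed intervals filling [D]. The fundamental theorem and the change of variables are
    applied on these intervals and carried to the open domain by a limit. *)
Definition exhausts al be D :=
  [/\ {homo al : m n / (m <= n)%N >-> n <= m}, {homo be : m n / (m <= n)%N >-> m <= n},
      forall n, al n < be n & D = \bigcup_n `[al n, be n]%classic].

Lemma exhausts_measurable al be D : exhausts al be D ->
  measurable (D : set (measurableTypeR R)).
Proof. by case=> _ _ _ ->; apply: bigcup_measurable => n _; exact: measurable_itv. Qed.

Lemma exhausts_sub al be D n x : exhausts al be D -> al n <= x <= be n -> D x.
Proof. by case=> _ _ _ -> h; exists n => //=; rewrite in_itv. Qed.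

Lemma measurable_of_continuous al be D f : exhausts al be D ->
  (forall x, D x -> {for x, continuous f}) -> measurable_fun D f.
Proof.
move=> DE cf; have [_ _ _ ->] := DE; apply/measurable_fun_bigcup => n.
  exact: measurable_itv.
apply: subspace_continuous_measurable_fun; first exact: measurable_itv.
apply: continuous_in_subspaceT => x; rewrite inE/= in_itv/= => xK.
by apply: cf; exact: exhausts_sub DE xK.
Qed.

(** Dominated convergence with majorant [|f|]: at each point of [D] the truncated functions
    eventually coincide with [f]. *)
Lemma Rintegral_exhausts_cvg al be D f : exhausts al be D ->
  mu.-integrable D (EFin \o f) ->
  (fun n => \int[mu]_(x in `[al n, be n]%classic) f x) @ \oo --> \int[mu]_(x in D) f x.
Proof.
move=> DE fD; have mD := exhausts_measurable DE.
have KD n : `[al n, be n]%classic `<=` D.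
  by move=> x /=; rewrite in_itv/=; exact: exhausts_sub DE.
have mf : measurable_fun D (EFin \o f) by case/integrableP : fD.
have [nal nbe _ DD] := DE.
pose fn n := (EFin \o f) \_ `[al n, be n]%classic.
have [] := @dominated_convergence _ _ _ mu D mD fn (EFin \o f) (fun x => `|(f x)%:E|%E).
- move=> n; have : measurable_fun (D `&` `[al n, be n]%classic) (EFin \o f).
    by apply: measurable_funS mf => //; exact: subIsetl.
  exact: (measurable_restrict _ (measurable_itv _) mD).1.
- by [].
- apply: aeW => x Dx; move: (Dx); rewrite {1}DD => -[n _ /= xn].
  apply: cvg_near_cst; exists n => // m /= nm.
  rewrite /fn patchE mem_set//=; move: xn; rewrite !in_itv/= => /andP[a b].
  by rewrite (le_trans (nal _ _ nm) a) (le_trans b (nbe _ _ nm)).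
- exact: integrable_abse.
- by apply: aeW => x n Dx; rewrite /fn patchE; case: ifPn => //; rewrite abse0.
move=> _ _ h; apply: fine_cvg.
rewrite fineK; last by apply: integrable_fin_num.
apply: cvg_trans h; apply: near_eq_cvg; apply: nearW => n /=.
by rewrite -integral_mkcondr (setIidr (KD n)).
Qed.

Lemma Rintegral_FTC_itv f F x y : x < y ->
  (forall t, x <= t <= y -> is_derive t 1 F (f t)) ->
  (forall t, x <= t <= y -> {for t, continuous f}) ->
  (\int[mu]_(t in `[x, y]) (f t)%:E = (F y - F x)%:E)%E.
Proof.
move=> xy dF cf.
have cF t : x <= t <= y -> {for t, continuous F}.
  by move=> ht; have [+ _] := dF t ht => /derivable1_diffP/differentiable_continuous.
rewrite (@continuous_FTC2 _ f F)//.
- by apply: continuous_in_subspaceT => t; rewrite inE/= in_itv/=; exact: cf.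
- split.
  + by move=> t; rewrite in_itv/= => /andP[a b]; have [] := dF t; rewrite ?ltW.
  + by apply: cvg_at_right_filter; apply: cF; rewrite lexx ltW.
  + by apply: cvg_at_left_filter; apply: cF; rewrite lexx ltW.
- move=> t; rewrite in_itv/= => /andP[a b].
  have h : x <= t <= y by rewrite !ltW.
  by have dFt := dF t h; rewrite derive1E derive_val.
Qed.

Lemma Rintegral_FTC al be D f F l1 l2 : exhausts al be D ->
  mu.-integrable D (EFin \o f) ->
  (forall t, D t -> is_derive t 1 F (f t)) ->
  (forall t, D t -> {for t, continuous f}) ->
  F (al n) @[n --> \oo] --> l1 -> F (be n) @[n --> \oo] --> l2 ->
  \int[mu]_(t in D) f t = l2 - l1.
Proof.
move=> DE fD dF cf h1 h2; have [_ _ ab _] := DE.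
have H := Rintegral_exhausts_cvg DE fD.
suff H' : (fun n => \int[mu]_(x in `[al n, be n]%classic) f x) @ \oo --> l2 - l1.
  exact: (cvg_unique _ H H').
apply: cvg_trans (cvgB h2 h1); apply: near_eq_cvg; apply: nearW => n.
have E := @Rintegral_FTC_itv f F _ _ (ab n)
  (fun t ht => dF t (exhausts_sub DE ht)) (fun t ht => cf t (exhausts_sub DE ht)).
by rewrite /Rintegral E.
Qed.

(** By monotone convergence: over each closed interval the integral of [g] is a difference of two
    values of [G], hence at most [M + M]. Every dominating function below is obtained from this
    criterion. *)
Lemma integrable_of_antiderivative al be D g G M : exhausts al be D ->
  (forall t, D t -> is_derive t 1 G (g t)) ->
  (forall t, D t -> {for t, continuous g}) ->
  (forall t, D t -> 0 <= g t) -> (forall t, D t -> `|G t| <= M) ->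
  mu.-integrable D (EFin \o g).
Proof.
move=> DE dG cg g0 GM; have [nal nbe ab DD] := DE.
have mg := measurable_of_continuous DE cg.
apply/integrableP; split; first exact/measurable_EFinP.
rewrite (_ : (\int[mu]_(x in D) _)%E = (\int[mu]_(x in D) (EFin \o g) x)%E); last first.
  by apply: eq_integral => x; rewrite inE => Dx; rewrite gee0_abs ?lee_fin ?g0.
have KD n : `[al n, be n]%classic `<=` D.
  by move=> x /=; rewrite in_itv/=; exact: exhausts_sub DE.
have h : (\int[mu]_(x in `[al n, be n]%classic) (EFin \o g) x)%E @[n --> \oo] -->
    (\int[mu]_(x in D) (EFin \o g) x)%E.
  rewrite [in X in _ --> X]DD; apply: ge0_nondecreasing_set_cvg_integral.
  - move=> n m nm; apply/subsetPset => x /=; rewrite !in_itv/= => /andP[a b].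
    by rewrite (le_trans (nal _ _ nm) a) (le_trans b (nbe _ _ nm)).
  - by move=> n; exact: measurable_itv.
  - move=> n; apply: measurable_funS (exhausts_measurable DE) (KD n) _.
    exact/measurable_EFinP.
  - by move=> n x /KD/g0; rewrite lee_fin.
apply: (@le_lt_trans _ _ (M + M)%:E); last exact: ltry.
rewrite -(cvg_lim _ h)//; apply: lime_le; first by apply/cvg_ex; eexists; exact: h.
apply: nearW => n; have E := @Rintegral_FTC_itv g G _ _ (ab n)
  (fun t ht => dG t (exhausts_sub DE ht)) (fun t ht => cg t (exhausts_sub DE ht)).
rewrite E lee_fin; apply: le_trans (ler_norm _) _; apply: le_trans (ler_normB _ _) _.
by apply: lerD; apply: GM; apply: (@exhausts_sub _ _ _ n _ DE); rewrite ?lexx ?ltW ?ab.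
Qed.

(** The shift by 3 makes already the first interval, from 1/3 to 2/3, nondegenerate. *)
Lemma exhausts_itv01 : exhausts (fun n => n.+3%:R^-1) (fun n => 1 - n.+3%:R^-1) `]0, 1[%classic.
Proof.
have h (m n : nat) : (m <= n)%N -> (n.+3%:R^-1 : R) <= m.+3%:R^-1.
  by move=> mn; rewrite lef_pV2 ?posrE ?ltr0n// ler_nat.
split.
- exact: h.
- by move=> m n /h mn; rewrite lerD2l lerN2.
- move=> n; have : (n.+3%:R^-1 : R) <= 3^-1 by rewrite lef_pV2 ?posrE ?ltr0n// ler_nat.
  by move: (n.+3%:R^-1) => e; lra.
apply/seteqP; split => x /=; rewrite in_itv/=.
  move=> /andP[x0 x1]; have x1' : 0 < 1 - x by rewrite subr_gt0.
  have := near_infty_natSinv_lt (PosNum x0); have := near_infty_natSinv_lt (PosNum x1').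
  move=> [n1 _ h1] [n2 _ h2]; exists (n1 + n2)%N => //=; rewrite in_itv/=.
  have /= := h1 (n1 + n2).+2 (leq_trans (leq_addr _ _) (leqW (leqnSn _))).
  have /= := h2 (n1 + n2).+2 (leq_trans (leq_addl _ _) (leqW (leqnSn _))).
  by move: (_%:R^-1) => e; lra.
move=> [n _ /=]; rewrite in_itv/= => /andP[a b].
have : (0 : R) < n.+3%:R^-1 by rewrite invr_gt0 ltr0n.
by move: a b; move: (n.+3%:R^-1) => e; lra.
Qed.

Lemma exhausts_itv0y : exhausts (fun n => n.+2%:R^-1) (fun n => n.+2%:R) `]0, +oo[%classic.
Proof.
split.
- by move=> m n mn; rewrite lef_pV2 ?posrE ?ltr0n// ler_nat.
- by move=> m n mn; rewrite ler_nat.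
- move=> n; apply: (@lt_trans _ _ 1); last by rewrite ltr1n.
  by rewrite invf_lt1 ?ltr0n// ltr1n.
apply/seteqP; split => x /=; rewrite in_itv/= ?andbT.
  move=> x0; have [n1 _ h1] := near_infty_natSinv_lt (PosNum x0).
  pose m := Num.truncn x.
  exists (n1 + m)%N => //=; rewrite in_itv/=; apply/andP; split.
    by apply: ltW; apply: (h1 (n1 + m).+1); rewrite /= leqW ?leq_addr.
  apply: (@le_trans _ _ m.+1%:R); first by apply: ltW; exact: truncnS_gt.
  by rewrite ler_nat ltnS leqW ?leq_addl.
move=> [n _ /=]; rewrite in_itv/= => /andP[a b].
by apply: lt_le_trans a; rewrite invr_gt0 ltr0n.
Qed.

Lemma exhausts_itv0c c : 0 < c ->
  exhausts (fun n => c * n.+3%:R^-1) (fun n => c * (1 - n.+3%:R^-1)) `]0, c[%classic.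
Proof.
move=> c0; have [h1 h2 h3 h4] := exhausts_itv01; split.
- by move=> m n /h1; rewrite ler_pM2l.
- by move=> m n /h2; rewrite ler_pM2l.
- by move=> n; rewrite ltr_pM2l.
apply/seteqP; split => x /=; rewrite in_itv/=.
  move=> xc; have : `]0, 1[%classic (x / c).
    by rewrite /= in_itv/= ltr_pdivrMr// mul1r divr_gt0//; case/andP : xc.
  rewrite h4 => -[n _ /=]; rewrite in_itv/= => H; exists n => //=; rewrite in_itv/=.
  by move: H; rewrite ler_pdivlMr// ler_pdivrMr// ![c * _]mulrC.
move=> [n _ /=]; rewrite in_itv/= => H.
have : `]0, 1[%classic (x / c).
  rewrite h4; exists n => //=; rewrite in_itv/=.
  by rewrite ler_pdivlMr// ler_pdivrMr// ![_ * c]mulrC.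
by rewrite /= in_itv/= ltr_pdivrMr// mul1r ltr_pdivlMr// mul0r.
Qed.

(** Both integrals are limits along exhaustions that correspond under [u = t / c]; on the closed
    intervals the substitution theorem applies. *)
Lemma Rintegral_scale c f : 0 < c ->
  (forall x, 0 < x < 1 -> {for x, continuous f}) ->
  mu.-integrable `]0, 1[ (EFin \o f) ->
  mu.-integrable `]0, c[ (EFin \o (fun t => f (t / c) * c^-1)) ->
  \int[mu]_(t in `]0, c[) (f (t / c) * c^-1) = \int[mu]_(u in `]0, 1[) f u.
Proof.
move=> c0 cf f1 fc.
have h1 := Rintegral_exhausts_cvg exhausts_itv01 f1.
have h2 := Rintegral_exhausts_cvg (exhausts_itv0c c0) fc.
suff H : (fun n => \int[mu]_(x in `[c * n.+3%:R^-1, c * (1 - n.+3%:R^-1)]%classic)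
    (f (x / c) * c^-1)) @ \oo --> \int[mu]_(u in `]0, 1[) f u.
  exact: (cvg_unique _ h2 H).
apply: cvg_trans h1; apply: near_eq_cvg; apply: nearW => n.
have [_ _ ab _] := exhausts_itv01; move: (ab n).
set a := n.+3%:R^-1; set b := 1 - a => abn.
pose F (t : R) := t / c.
have Fc t : F (c * t) = t by rewrite /F mulrC mulKf// gt_eqF.
have dF t : is_derive t 1 F c^-1.
  by rewrite /F; apply: is_derive_eq; rewrite /GRing.scale/=; ring.
have F' : F^`()%classic = cst c^-1 by apply/funext => t; rewrite derive1E; exact: derive_val.
have cF t : {for t, continuous F}.
  by have [+ _] := dF t => /derivable1_diffP/differentiable_continuous.
have := @integration_by_substitution_increasing R F f (c * a) (c * b).
rewrite !Fc F' => /(_ _ _ _ _ _ _ _) H.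
rewrite /Rintegral H//.
- by rewrite ler_pM2l// ltW.
- by move=> x y _ _ xy; rewrite /F ltr_pM2r// invr_gt0.
- by move=> x _; exact: cst_continuous.
- exact: is_cvg_cst.
- exact: is_cvg_cst.
- split.
  + by move=> t _; have [] := dF t.
  + by apply: cvg_at_right_filter; exact: cF.
  + by apply: cvg_at_left_filter; exact: cF.
- apply: continuous_in_subspaceT => x; rewrite inE/= in_itv/= => xK.
  apply: cf; have := exhausts_sub exhausts_itv01 xK.
  by rewrite /= in_itv.
Qed.

End Exhaustion.

(** * Integrals of matrix functions *)

Section MatrixIntegral.
Variables (R : realType) (N : nat).
Local Notation mat := 'M[R[i]]_N.
Local Notation idx := (bool * ('I_N * 'I_N))%type.
Local Notation mu := (@lebesgue_measure R).
Implicit Types (M : mat) (k : idx) (F G H : R -> mat) (D : set R) (t x y c : R)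
  (al be : nat -> R) (g : R -> R).

Lemma mx_integrableP D F : mx_integrable D F <->
  forall k, mu.-integrable D (EFin \o (fun t => co k (F t))).
Proof.
split=> [h [b [i j]]|h i j]; first by have [h1 h2] := h i j; case: b.
by split; [exact: (h (true, (i, j)))|exact: (h (false, (i, j)))].
Qed.

Lemma co_mx_integral k D F : co k (mx_integral D F) = \int[mu]_(t in D) co k (F t).
Proof. by case: k => -[] [i j]; rewrite /co mxE. Qed.

Lemma eq_mx_integral D F G : (forall t, D t -> F t = G t) ->
  mx_integral D F = mx_integral D G.
Proof.
move=> h; apply: coP => k; rewrite !co_mx_integral; apply: eq_Rintegral => t.
by rewrite inE => /h ->.
Qed.

Lemma eq_mx_integrable D F G : measurable (D : set (measurableTypeR R)) -> (forall t, D t -> F t = G t) ->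
  mx_integrable D F -> mx_integrable D G.
Proof.
move=> mD h /mx_integrableP hF; apply/mx_integrableP => k.
by apply: eq_integrable (hF k) => // t; rewrite inE => /h /= ->.
Qed.

Lemma integrable_sumr (D : set R) I (r : seq I) (f : I -> R -> R) : measurable (D : set (measurableTypeR R)) ->
  (forall i, mu.-integrable D (EFin \o f i)) ->
  mu.-integrable D (EFin \o (fun t => \sum_(i <- r) f i t)) /\
  \int[mu]_(t in D) (\sum_(i <- r) f i t) = \sum_(i <- r) \int[mu]_(t in D) f i t.
Proof.
move=> mD h; elim: r => [|i r [IH1 IH2]].
  have -> : (fun t => \sum_(i <- [::]) f i t) = (cst 0 : R -> R).
    by apply/funext => t; rewrite big_nil.
  split; last by rewrite big_nil /Rintegral/= integral0.
  exact: integrable0.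
have -> : (fun t => \sum_(i <- i :: r) f i t) = fun t => f i t + \sum_(i <- r) f i t.
  by apply/funext => t; rewrite big_cons.
rewrite big_cons; split.
  have := integrableD mD (h i) IH1.
  by apply: eq_integrable => // t _; rewrite /= EFinD.
by rewrite RintegralD// IH2.
Qed.

Definition cobase k : mat := (if k.1 then 1 else 'i) *: delta_mx k.2.1 k.2.2.

Lemma co_decomposition M : M = \sum_k (co k M)%:C *: cobase k.
Proof.
rewrite {1}[M]matrix_sum_delta.
rewrite -(pair_bigA _ (fun b p => (co (b, p) M)%:C *: cobase (b, p)))/= big_bool/= -big_split/=.
rewrite -(pair_bigA _ (fun i j => (co (true, (i, j)) M)%:C *: cobase (true, (i, j)) +
  (co (false, (i, j)) M)%:C *: cobase (false, (i, j))))/=.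
apply: eq_bigr => i _; apply: eq_bigr => j _.
rewrite /cobase/= !scalerA -scalerDl /co/= mulr1; congr (_ *: _).
by rewrite {1}[M i j]complexE mulrC.
Qed.

(** Expanding in the real basis [cobase], each coordinate of [phi (F t)] is a fixed real combination
    of the coordinates of [F t]. Left and right multiplication are the instances used. *)
Lemma mx_integral_linear D (phi : mat -> mat) F :
  (forall A B, phi (A + B) = phi A + phi B) ->
  (forall c A, phi (c%:C *: A) = c%:C *: phi A) ->
  measurable (D : set (measurableTypeR R)) -> mx_integrable D F ->
  mx_integrable D (fun t => phi (F t)) /\
  mx_integral D (fun t => phi (F t)) = phi (mx_integral D F).
Proof.
move=> phiD phiZ mD /mx_integrableP hF.
have phi0 : phi 0 = 0 by have := phiZ 0 0; rewrite rmorph0 !scale0r.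
have E k M : co k (phi M) = \sum_j co k (phi (cobase j)) * co j M.
  rewrite {1}(co_decomposition M) (big_morph phi phiD phi0) co_sum.
  by apply: eq_bigr => j _; rewrite phiZ coZ mulrC.
have Et k : (fun t => co k (phi (F t))) =
    fun t => \sum_j co k (phi (cobase j)) * co j (F t).
  by apply/funext => t; rewrite E.
have hs k j : mu.-integrable D (EFin \o (fun t => co k (phi (cobase j)) * co j (F t))).
  exact: (integrableZl mD _ (hF j)).
split; first by apply/mx_integrableP => k; rewrite Et; apply: (integrable_sumr _ _ _).1.
apply: coP => k; rewrite co_mx_integral Et E (integrable_sumr _ mD (hs k)).2.
by apply: eq_bigr => j _; rewrite co_mx_integral (RintegralZl _ mD (hF j)).
Qed.

Lemma mx_integralMl D M F : measurable (D : set (measurableTypeR R)) ->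
  mx_integrable D F ->
  mx_integrable D (fun t => M * F t) /\
  mx_integral D (fun t => M * F t) = M * mx_integral D F.
Proof.
apply: (@mx_integral_linear _ (fun X => M * X)) => [A B|c A].
  exact: mulrDr.
exact: scaleMr.
Qed.

Lemma mx_integralMr D M F : measurable (D : set (measurableTypeR R)) ->
  mx_integrable D F ->
  mx_integrable D (fun t => F t * M) /\
  mx_integral D (fun t => F t * M) = mx_integral D F * M.
Proof.
apply: (@mx_integral_linear _ (fun X => X * M)) => [A B|c A].
  exact: mulrDl.
exact: scaleMl.
Qed.

Lemma comm_mx_integral D M F : measurable (D : set (measurableTypeR R)) ->
  mx_integrable D F -> (forall t, D t -> GRing.comm M (F t)) ->
  GRing.comm M (mx_integral D F).
Proof.
move=> mD hF h; rewrite /GRing.comm -(mx_integralMl M mD hF).2 -(mx_integralMr M mD hF).2.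
exact: eq_mx_integral.
Qed.

Lemma mx_integralD D F G : measurable (D : set (measurableTypeR R)) -> mx_integrable D F -> mx_integrable D G ->
  mx_integrable D (fun t => F t + G t) /\
  mx_integral D (fun t => F t + G t) = mx_integral D F + mx_integral D G.
Proof.
move=> mD /mx_integrableP hF /mx_integrableP hG; split.
  apply/mx_integrableP => k; have := integrableD mD (hF k) (hG k).
  by apply: eq_integrable => // t _ /=; rewrite coD.
apply: coP => k; rewrite coD !co_mx_integral.
by under eq_Rintegral do rewrite coD; rewrite RintegralD.
Qed.

Lemma mx_integrable0 D : mx_integrable D (fun=> 0 : mat).
Proof.
by apply/mx_integrableP => k; rewrite (_ : _ \o _ = cst 0%E) ?integrable0//;
  apply/funext => t /=; rewrite co0.
Qed.

Lemma mx_integral_sum D (f : nat -> R -> mat) n : measurable (D : set (measurableTypeR R)) ->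
  (forall i, mx_integrable D (f i)) ->
  mx_integrable D (fun t => \sum_(0 <= i < n) f i t) /\
  mx_integral D (fun t => \sum_(0 <= i < n) f i t) = \sum_(0 <= i < n) mx_integral D (f i).
Proof.
move=> mD h; elim: n => [|n [IH1 IH2]].
  have -> : (fun t => \sum_(0 <= i < 0) f i t) = fun=> 0.
    by apply/funext => t; rewrite big_geq.
  rewrite big_geq//.
  split; first exact: mx_integrable0.
  apply: coP => k; rewrite co_mx_integral co0.
  by rewrite Rintegral_cst// mul0r.
have -> : (fun t => \sum_(0 <= i < n.+1) f i t) = fun t => \sum_(0 <= i < n) f i t + f n t.
  by apply/funext => t; rewrite big_nat_recr.
by rewrite big_nat_recr//= -IH2; exact: mx_integralD.
Qed.

Lemma mx_integral_patch D E F : measurable (D : set (measurableTypeR R)) ->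
  measurable (E : set (measurableTypeR R)) -> E `<=` D ->
  mx_integrable D (fun t => if t \in E then F t else 0) ->
  mx_integrable E F /\
  mx_integral D (fun t => if t \in E then F t else 0) = mx_integral E F.
Proof.
move=> mD mE ED h; split.
  move/mx_integrableP in h.
  apply/mx_integrableP => k.
  apply: eq_integrable (integrableS mD mE ED (h k)) => // t tE /=.
  by rewrite tE.
apply: coP => k; rewrite !co_mx_integral -[in RHS](setIidr ED) Rintegral_mkcondr.
by apply: eq_Rintegral => t _; rewrite patchE; case: ifP => //; rewrite co0.
Qed.

Definition mcont F t := forall k, {for t, continuous (fun s => co k (F s))}.

Lemma mderiv_cont F t M : mderiv F t M -> mcont F t.
Proof.
by move=> h k; have [+ _] := h k => /derivable1_diffP/differentiable_continuous.
Qed.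

Lemma mcontM F G t : mcont F t -> mcont G t -> mcont (fun s => F s * G s) t.
Proof.
move=> hF hG k; rewrite /prop_for /continuous_at coM.
rewrite (_ : (fun s => _) = fun s => \sum_(l < N)
  (co (true, (k.2.1, l)) (F s) * co (k.1, (l, k.2.2)) (G s) +
   (if k.1 then -1 else 1) * (co (false, (k.2.1, l)) (F s) * co (~~ k.1, (l, k.2.2)) (G s)))).
  apply: (@cvgr_sum _ (nbhs t)) => l; apply: cvgD; first by apply: cvgM; [exact: hF|exact: hG].
  by apply: cvgM; [exact: cvg_cst|apply: cvgM; [exact: hF|exact: hG]].
by apply/funext => s; rewrite coM.
Qed.

Lemma mcontZ g F t : {for t, continuous g} -> mcont F t ->
  mcont (fun s => (g s)%:C *: F s) t.
Proof.
move=> hg hF k; rewrite /prop_for /continuous_at coZ.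
under eq_fun do rewrite coZ.
by apply: cvgM; [exact: hg|exact: hF].
Qed.

Definition mmeas D F := forall k, measurable_fun D (fun t => co k (F t)).

Lemma mcont_meas al be D F : exhausts al be D -> (forall t, D t -> mcont F t) -> mmeas D F.
Proof.
by move=> DE h k; apply: measurable_of_continuous DE _ => t Dt; exact: h.
Qed.

Lemma mmeas_patch D E F : measurable (D : set (measurableTypeR R)) ->
  measurable (E : set (measurableTypeR R)) -> E `<=` D -> mmeas E F ->
  mmeas D (fun t => if t \in E then F t else 0).
Proof.
move=> mD mE ED mF k.
have -> : (fun t => co k (if t \in E then F t else 0)) = (fun t => co k (F t)) \_ E.
  by apply/funext => t; rewrite patchE; case: ifP => //; rewrite co0.
by apply: (measurable_restrict _ mE mD).1; rewrite (setIidr ED); exact: mF.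
Qed.

Lemma mx_integrable_le D F g : measurable (D : set (measurableTypeR R)) -> mmeas D F ->
  (forall t, D t -> nrm (F t) <= g t) -> mu.-integrable D (EFin \o g) ->
  mx_integrable D F.
Proof.
move=> mD mF h hg; apply/mx_integrableP => k; apply: (le_integrable mD _ _ hg).
  by apply/measurable_EFinP; exact: mF.
move=> t Dt; rewrite /= lee_fin; apply: le_trans (co_le_nrm _ _) _.
exact: le_trans (h _ Dt) (ler_norm _).
Qed.

Lemma mx_dominated D (Fn : nat -> R -> mat) F g : measurable (D : set (measurableTypeR R)) ->
  (forall n, mmeas D (Fn n)) -> mmeas D F ->
  (forall t, D t -> mcvg (fun n => Fn n t) (F t)) ->
  (forall n t, D t -> nrm (Fn n t) <= g t) -> mu.-integrable D (EFin \o g) ->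
  mx_integrable D F /\ mcvg (fun n => mx_integral D (Fn n)) (mx_integral D F).
Proof.
move=> mD mFn mF hcv hb hg.
have H k := @dominated_convergence _ _ _ mu D mD (fun n t => (co k (Fn n t))%:E)
  (fun t => (co k (F t))%:E) (EFin \o g).
have {}H k : mu.-integrable D (EFin \o (fun t => co k (F t))) /\
   (fun n => \int[mu]_(t in D) co k (Fn n t)) @ \oo --> \int[mu]_(t in D) co k (F t).
  have [] := H k.
  - by move=> n; apply/measurable_EFinP; exact: mFn.
  - by apply/measurable_EFinP; exact: mF.
  - by apply: aeW => t Dt; apply: cvg_EFin; [exact: nearW|exact: hcv].
  - exact: hg.
  - apply: aeW => t n Dt; rewrite /= lee_fin; apply: le_trans (co_le_nrm _ _) _.
    exact: hb.
  move=> i _ h; split => //; apply: fine_cvg; rewrite fineK//.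
  exact: integrable_fin_num.
split; first by apply/mx_integrableP => k; have [] := H k.
move=> k; rewrite co_mx_integral; under eq_fun do rewrite co_mx_integral.
by have [] := H k.
Qed.

Lemma mx_FTC al be D F (F' : R -> mat) l1 l2 : exhausts al be D -> mx_integrable D F' ->
  (forall t, D t -> mderiv F t (F' t)) -> (forall t, D t -> mcont F' t) ->
  mcvg (fun n => F (al n)) l1 -> mcvg (fun n => F (be n)) l2 ->
  mx_integral D F' = l2 - l1.
Proof.
move=> DE /mx_integrableP hF' dF cF' h1 h2; apply: coP => k.
rewrite co_mx_integral coB.
exact: (Rintegral_FTC DE (hF' k) (fun t Dt => dF t Dt k) (fun t Dt => cF' t Dt k)
  (h1 k) (h2 k)).
Qed.

Lemma mx_integral_scale c F : 0 < c -> (forall t, 0 < t < 1 -> mcont F t) ->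
  mx_integrable `]0, 1[ F -> mx_integrable `]0, c[ (fun t => (c^-1)%:C *: F (t / c)) ->
  mx_integral `]0, c[ (fun t => (c^-1)%:C *: F (t / c)) = mx_integral `]0, 1[ F.
Proof.
move=> c0 cF /mx_integrableP hF /mx_integrableP hG; apply: coP => k.
rewrite !co_mx_integral -(@Rintegral_scale _ c)//.
- by apply: eq_Rintegral => t _; rewrite coZ mulrC.
- by move=> x x01; exact: cF.
- by apply: eq_integrable (hG k) => // t _; rewrite /= coZ mulrC.
Qed.

End MatrixIntegral.

(** * Real powers with matrix exponents *)

Section RealPower.
Variables (R : realType) (N : nat).
Local Notation mat := 'M[R[i]]_N.
Implicit Types (A B M : mat) (u v a t : R).

(* [pw u A] is [u ^ A]; sealed for the same reason as [nrm]. *)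
Fact pw_subproof : {f : R -> mat -> mat | forall u A, f u A = mx_exp ((ln u)%:C *: A)}.
Proof. by exists (fun u A => mx_exp ((ln u)%:C *: A)). Qed.

Definition pw : R -> mat -> mat := sval pw_subproof.

Lemma pwE u A : pw u A = mx_exp ((ln u)%:C *: A).
Proof. exact: (svalP pw_subproof). Qed.

Lemma mx_cpow_real u A : 0 < u -> mx_cpow u%:C A = pw u A.
Proof.
move=> u0; rewrite /mx_cpow pwE.
suff -> : Clog u%:C = (ln u)%:C by [].
by rewrite /Clog /Carg normc_real (ger0_norm (ltW u0)) /= lexx mulfV ?gt_eqF// acos1.
Qed.

Lemma pw1 A : pw 1 A = 1.
Proof. by rewrite !pwE ln1 scale0r mx_exp0. Qed.

Lemma pwD u A B : GRing.comm A B -> pw u (A + B) = pw u A * pw u B.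
Proof.
move=> AB; rewrite !pwE scalerDr mx_expD//.
exact/commZ/commr_sym/commZ/commr_sym.
Qed.

Lemma comm_pw u A B : GRing.comm A B -> GRing.comm A (pw u B).
Proof. by move=> AB; rewrite pwE; exact/comm_mx_exp/commZ. Qed.

Lemma pwM u v A : 0 < u -> 0 < v -> pw (u * v) A = pw u A * pw v A.
Proof.
move=> u0 v0; have E : ln (u * v) = ln u + ln v by rewrite lnM ?posrE.
rewrite !pwE E rmorphD scalerDl mx_expD; last exact/commZ/commr_sym/commZ.
by [].
Qed.

Lemma pw_scalar u a : pw u (a%:C%:M) = (expR (a * ln u))%:C%:M.
Proof.
rewrite !pwE scale_scalar_mx mx_exp_scalar /cexp; congr (_%:M).
by rewrite /= !mul0r !mulr0 subr0 addr0 cos0 sin0 mulr1 mulr0 mulrC.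
Qed.

Lemma pw_addr u A a : pw u (A + a%:C%:M) = (expR (a * ln u))%:C *: pw u A.
Proof.
rewrite addrC pwD; last exact/commr_sym/comm_scalar.
by rewrite pw_scalar; exact: mul_scalar_mx.
Qed.

Lemma pw_add1 u A : 0 < u -> pw u (A + 1) = u%:C *: pw u A.
Proof. by move=> u0; have := pw_addr u A 1; rewrite mul1r lnK. Qed.

Lemma pw_sub1 u A : 0 < u -> pw u (A - 1) = (u^-1)%:C *: pw u A.
Proof.
move=> u0; rewrite -{2}(subrK 1 A) pw_add1// scalerA -rmorphM mulVf ?gt_eqF//.
by rewrite scale1r.
Qed.

Lemma pw_addn u A n : 0 < u -> pw u (A + n%:R%:M) = (u ^+ n)%:C *: pw u A.
Proof.
move=> u0; have := pw_addr u A n%:R; rewrite rmorph_nat => ->.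
by rewrite expRM_natl lnK.
Qed.

Lemma pwV u A : pw u A * pw u (- A) = 1.
Proof. by rewrite !pwE scalerN mx_expN. Qed.

Lemma pwVl u A : pw u (- A) * pw u A = 1.
Proof. by have := pwV u (- A); rewrite opprK. Qed.

Lemma pw_inv u A : 0 < u -> pw u^-1 A = pw u (- A).
Proof.
move=> u0; have E : ln u^-1 = - ln u by rewrite lnV ?posrE.
by rewrite !pwE E rmorphN scaleNr scalerN.
Qed.

Lemma mderiv_pw A u : 0 < u -> mderiv (fun v => pw v A) u ((u^-1)%:C *: (A * pw u A)).
Proof.
move=> u0; rewrite pwE; apply: (mderiv_ext (F := fun v => mx_exp ((ln v)%:C *: A))).
  by move=> v; rewrite pwE.
exact/mderiv_exp_comp/is_derive1_ln.
Qed.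

Lemma is_derive_onem u : is_derive u 1 (fun v => 1 - v) (-1).
Proof. by apply: is_derive_eq; ring. Qed.

Lemma mderiv_pw_onem A u : u < 1 ->
  mderiv (fun v => pw (1 - v) A) u (- (((1 - u)^-1)%:C *: (A * pw (1 - u) A))).
Proof.
move=> u1; have u1' : 0 < 1 - u by rewrite subr_gt0.
have := mderiv_comp (F := fun v => pw v A) (g := fun v => 1 - v) (mderiv_pw A u1') (is_derive_onem u).
by rewrite rmorphN rmorph1 scaleN1r.
Qed.

Lemma nrm_pw_ge1 A u : 1 <= u -> nrm (pw u A) <= nrm (1 : mat) * expR (nrm A * ln u).
Proof.
move=> u1; rewrite pwE; apply: le_trans (nrm_mx_exp _) _; apply: ler_wpM2l; first exact: nrm_ge0.
by rewrite ler_expR nrmZ normc_real ger0_norm ?ln_ge0// mulrC.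
Qed.

(** This is the decay of [exp (- s A)] read at [s = - ln u], which is nonnegative for [u <= 1]. *)
Lemma nrm_pw_le1 A : positive_stable A ->
  exists a C : R, [/\ 0 < a, 0 <= C &
    forall u, 0 < u <= 1 -> nrm (pw u A) <= C * expR (a * ln u)].
Proof.
move=> /positive_stable_decay[a [C [a0 C0 h]]]; exists a, C; split=> // u /andP[u0 u1].
have := h (- ln u); rewrite pwE opprK mulrN opprK; apply.
by rewrite oppr_ge0 ln_le0.
Qed.

Lemma nrmZr (c : R) M : 0 <= c -> nrm (c%:C *: M) = c * nrm M.
Proof. by move=> c0; rewrite nrmZ normc_real ger0_norm. Qed.

Lemma nrm_pw_sub1 u A : 0 < u -> nrm (pw u (A - 1)) = u^-1 * nrm (pw u A).
Proof. by move=> u0; rewrite pw_sub1// nrmZr// invr_ge0 ltW. Qed.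

End RealPower.


(** * Integrable majorants for the beta and gamma integrands *)

Section Dominating.
Variable R : realType.
Local Notation mu := (@lebesgue_measure R).
Implicit Types (a b u t x : R).

Lemma integrable_real_Zl (D : set R) (c : R) (f : R -> R) :
  measurable (D : set (measurableTypeR R)) -> mu.-integrable D (EFin \o f) ->
  mu.-integrable D (EFin \o (fun t => c * f t)).
Proof. by move=> mD hf; exact: (integrableZl mD c hf). Qed.

Lemma integrable_realD (D : set R) (f g : R -> R) :
  measurable (D : set (measurableTypeR R)) -> mu.-integrable D (EFin \o f) ->
  mu.-integrable D (EFin \o g) -> mu.-integrable D (EFin \o (fun t => f t + g t)).
Proof. by move=> mD hf hg; exact: (integrableD mD hf hg). Qed.

Lemma is_derive_expln a u : 0 < u ->
  is_derive u 1 (fun t => expR (a * ln t)) (a * expR (a * ln u) / u).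
Proof.
move=> u0; have dl := is_derive1_ln u0.
have h : is_derive u 1 (fun t => a * ln t) (a / u).
  by apply: is_derive_eq; rewrite /GRing.scale/=; ring.
have H := @is_derive1_comp R expR (fun t => a * ln t) u _ _ (is_derive_expR _) h.
apply: (@is_derive_eq _ _ _ _ _ _ _ _ H).
by ring.
Qed.

Lemma continuous_expln a u : 0 < u -> {for u, continuous (fun t => expR (a * ln t))}.
Proof.
by move=> /(is_derive_expln a)[+ _] => /derivable1_diffP/differentiable_continuous.
Qed.

Lemma continuous_expln_div a u : 0 < u -> {for u, continuous (fun t => expR (a * ln t) / t)}.
Proof.
move=> u0; apply: cvgM; first exact: continuous_expln.
by apply: inv_continuous; rewrite gt_eqF.
Qed.

Lemma expln_le1 a u : 0 <= a -> 0 < u <= 1 -> expR (a * ln u) <= 1.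
Proof. by move=> a0 /andP[u0 u1]; rewrite -expR0 ler_expR mulr_ge0_le0// ln_le0. Qed.

Lemma integrable_expln01 a : 0 < a ->
  mu.-integrable `]0, 1[ (EFin \o (fun u => expR (a * ln u) / u)).
Proof.
move=> a0.
apply: (@integrable_of_antiderivative R _ _ _ _ (fun u => a^-1 * expR (a * ln u)) a^-1
  (exhausts_itv01 R)) => t /=; rewrite in_itv/= => /andP[t0 t1].
- have h := is_derive_expln a t0; apply: is_derive_eq.
  rewrite /GRing.scale/=; field; by rewrite !gt_eqF.
- exact: continuous_expln_div.
- by rewrite divr_ge0 ?expR_ge0// ltW.
- rewrite ger0_norm ?mulr_ge0 ?invr_ge0 ?expR_ge0 ?(ltW a0)//.
  by rewrite ler_piMr ?invr_ge0 ?(ltW a0)// expln_le1 ?(ltW a0)// t0 ltW.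
Qed.

Lemma integrable_expln01_onem b : 0 < b ->
  mu.-integrable `]0, 1[ (EFin \o (fun u => expR (b * ln (1 - u)) / (1 - u))).
Proof.
move=> b0; pose g u := expR (b * ln (1 - u)) / (1 - u).
have D t : `]0, 1[%classic t -> 0 < 1 - t <= 1.
  by rewrite /= in_itv/= => /andP[t0 t1]; rewrite subr_gt0 t1 gerBl ltW.
have dG t : `]0, 1[%classic t ->
    is_derive t 1 (fun u => - b^-1 * expR (b * ln (1 - u))) (g t).
  move=> /D/andP[t1' _].
  have h := @is_derive1_comp R (fun u => expR (b * ln u)) (fun u => 1 - u) t _ _
    (is_derive_expln b t1') (is_derive_onem t).
  have h2 := is_deriveMr (is_derive_cst (- b^-1) t 1) h.
  apply: (@is_derive_eq _ _ _ _ _ _ _ _ h2).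
  by rewrite /cst /g; field; rewrite !gt_eqF.
have cg t : `]0, 1[%classic t -> {for t, continuous g}.
  move=> /D/andP[t1' _].
  apply: (@continuous_comp _ _ _ (fun u => 1 - u) (fun u => expR (b * ln u) / u)).
    by apply: cvgB; [exact: cvg_cst|exact: cvg_id].
  exact: continuous_expln_div.
have g0 t : `]0, 1[%classic t -> 0 <= g t.
  by move=> /D/andP[t1' _]; rewrite divr_ge0 ?expR_ge0// ltW.
have GM t : `]0, 1[%classic t -> `|- b^-1 * expR (b * ln (1 - t))| <= b^-1.
  move=> /D t1; rewrite normrM normrN !ger0_norm ?invr_ge0 ?expR_ge0 ?(ltW b0)//.
  by rewrite ler_piMr ?invr_ge0 ?(ltW b0)// expln_le1 ?(ltW b0).
exact: (integrable_of_antiderivative (exhausts_itv01 R) dG cg g0 GM).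
Qed.

(* [t^a / t / (1 + t^a)^2] is, up to the factor [a], the derivative of the
   bounded function [- 1 / (1 + t^a)]. *)
Lemma integrable_expln0y a : 0 < a ->
  mu.-integrable `]0, +oo[
    (EFin \o (fun t => a * (expR (a * ln t) / t) / (1 + expR (a * ln t)) ^+ 2)).
Proof.
move=> a0.
have p0 t : 0 < 1 + expR (a * ln t) by rewrite addr_gt0// expR_gt0.
have p1 t : 1 <= 1 + expR (a * ln t) by rewrite lerDl expR_ge0.
pose g t := a * (expR (a * ln t) / t) / (1 + expR (a * ln t)) ^+ 2.
have D t : `]0, +oo[%classic t -> 0 < t by rewrite /= in_itv/= andbT.
have dG t : `]0, +oo[%classic t -> is_derive t 1 (fun t => - (1 + expR (a * ln t))^-1) (g t).
  move=> /D t0; have h := is_derive_expln a t0.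
  have h1 : is_derive t 1 (fun t => 1 + expR (a * ln t)) (a * expR (a * ln t) / t).
    by have := is_deriveD (is_derive_cst (1 : R) t 1) h; rewrite add0r.
  have h2 := @is_deriveV _ (fun t => 1 + expR (a * ln t)) t _ _ (lt0r_neq0 (p0 t)) h1.
  apply: (@is_derive_eq _ _ _ _ _ _ _ _ (is_deriveN h2)).
  by rewrite /GRing.scale/= /g; field; rewrite !gt_eqF.
have cg t : `]0, +oo[%classic t -> {for t, continuous g}.
  move=> /D t0.
  apply: cvgM; first by apply: cvgM; [exact: cvg_cst|exact: continuous_expln_div].
  apply: (@continuous_comp _ _ _ (fun t => (1 + expR (a * ln t)) ^+ 2) (fun x => x^-1)).
    apply: (@continuous_comp _ _ _ (fun t => 1 + expR (a * ln t)) (fun x => x ^+ 2)).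
      by apply: cvgD; [exact: cvg_cst|exact: continuous_expln].
    exact: exprn_continuous.
  by apply: inv_continuous; rewrite expf_neq0// gt_eqF.
have g0 t : `]0, +oo[%classic t -> 0 <= g t.
  move=> /D t0.
  by rewrite /g !(mulr_ge0, invr_ge0, exprn_ge0) ?expR_ge0 ?(ltW a0) ?(ltW t0) ?(ltW (p0 t)).
have GM t : `]0, +oo[%classic t -> `|- (1 + expR (a * ln t))^-1| <= 1.
  by move=> _; rewrite normrN ger0_norm ?invr_ge0 ?(ltW (p0 t))// invf_le1.
exact: (integrable_of_antiderivative (exhausts_itv0y R) dG cg g0 GM).
Qed.

Lemma expln_expRN_bounded b : 0 < b ->
  exists2 C : R, 0 <= C & forall t, 0 < t -> expR (b * ln t) * expR (- (t / 2)) <= C.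
Proof.
(* From [ln x <= x] at [x = t / (2 b)]: multiplying by [b] gives [b ln t - t / 2 <= b ln (2 b)]. *)
move=> b0; exists (expR (b * ln (2 * b))); first exact: expR_ge0.
move=> t t0; rewrite -expRD ler_expR.
have c0 : 0 < 2 * b by rewrite mulr_gt0.
have : ln (t / (2 * b)) <= t / (2 * b) by rewrite ltW// ln_sublinear// divr_gt0.
rewrite ln_div ?posrE// lerBlDr -(ler_pM2l b0) mulrDr.
have -> : b * (t / (2 * b)) = t / 2 by field; rewrite gt_eqF.
by rewrite lerBlDr addrC.
Qed.

End Dominating.

Section DominatedIntegrands.
Variables (R : realType) (N : nat).
Local Notation mat := 'M[R[i]]_N.
Local Notation mu := (@lebesgue_measure R).
Implicit Types (A B M : mat) (u t : R).

Lemma nrm_beta_dom A B : positive_stable A -> positive_stable B -> exists2 g : R -> R,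
  mu.-integrable `]0, 1[ (EFin \o g) &
  forall u, 0 < u < 1 -> nrm (pw u (A - 1)) * nrm (pw (1 - u) (B - 1)) <= g u.
Proof.
move=> /nrm_pw_le1[a [C [a0 C0 h]]] /nrm_pw_le1[b [D [b0 D0 k]]].
exists (fun u => C * D * (expR (a * ln u) / u) + C * D * (expR (b * ln (1 - u)) / (1 - u))).
  apply: integrable_realD (measurable_itv _) _ _.
    exact: integrable_real_Zl (measurable_itv _) (integrable_expln01 a0).
  exact: integrable_real_Zl (measurable_itv _) (integrable_expln01_onem b0).
move=> u /andP[u0 u1]; have v0 : 0 < 1 - u by rewrite subr_gt0.
have v1 : 1 - u <= 1 by rewrite gerBl ltW.
have iu : 0 <= u^-1 by rewrite invr_ge0 ltW.
have iv : 0 <= (1 - u)^-1 by rewrite invr_ge0 ltW.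
rewrite (nrm_pw_sub1 A u0) (nrm_pw_sub1 B v0).
have hu : nrm (pw u A) <= C * expR (a * ln u) by apply: h; rewrite u0 ltW.
have hv : nrm (pw (1 - u) B) <= D * expR (b * ln (1 - u)) by apply: k; rewrite v0.
have pu : expR (a * ln u) <= 1 by rewrite expln_le1 ?(ltW a0)// u0 ltW.
have pv : expR (b * ln (1 - u)) <= 1 by rewrite expln_le1 ?(ltW b0)// v0.
move: (expR_ge0 (a * ln u)) (expR_ge0 (b * ln (1 - u))) pu pv hu hv.
move: (expR (a * ln u)) (expR (b * ln (1 - u))) => p q p0 q0 p1 q1 hu hv.
apply: (@le_trans _ _ (u^-1 * (C * p) * ((1 - u)^-1 * (D * q)))).
  apply: ler_pM; [exact: mulr_ge0 iu (nrm_ge0 _)|exact: mulr_ge0 iv (nrm_ge0 _)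
    |by apply: ler_wpM2l|by apply: ler_wpM2l].
rewrite -mulrDr.
have -> : u^-1 * (C * p) * ((1 - u)^-1 * (D * q)) =
    C * D * (p / u * (q / (1 - u))) by field; rewrite !gt_eqF.
apply: ler_wpM2l; first exact: mulr_ge0.
(* Partial fractions, [1 / (u (1 - u)) = 1 / u + 1 / (1 - u)], separate the two endpoint
   singularities; the spare factor [q] or [p] is at most 1. *)
have -> : p / u * (q / (1 - u)) = p / u * q + q / (1 - u) * p.
  by field; rewrite !gt_eqF.
by apply: lerD; rewrite ler_piMr// divr_ge0// ltW.
Qed.

(** The weight is [exp (- t / 2)] rather than [exp (- t)] because the approximating integrands in
    [gamma_limit] only obey the weaker bound [onemX_le_exp]. *)
Lemma nrm_gamma_dom A : positive_stable A -> exists2 g : R -> R,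
  mu.-integrable `]0, +oo[ (EFin \o g) &
  forall t, 0 < t -> expR (- (t / 2)) * nrm (pw t (A - 1)) <= g t.
Proof.
move=> /nrm_pw_le1[a [C [a0 C0 h]]].
(* At infinity [t ^ A] grows at most like [t ^ (nrm A)]; the extra [a] buys the decay [t ^ (- a)]
   required by the majorant. *)
have K0 : 0 < nrm A + a by rewrite ltr_wpDl// nrm_ge0.
have [E E0 hE] := expln_expRN_bounded K0.
set n1 := nrm (1 : mat).
(* With [p = t ^ a], the quantity [4 p / (1 + p)^2] is at least [p] when [p <= 1] and at least
   [1 / p] when [p >= 1], so a single majorant covers both ends; [1 / a] cancels the factor [a] of
   [integrable_expln0y]. *)
pose L := (C + n1 * E) * (4 / a).
have n10 : 0 <= n1 by exact: nrm_ge0.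
exists (fun t => L * (a * (expR (a * ln t) / t) / (1 + expR (a * ln t)) ^+ 2)).
  exact: integrable_real_Zl (measurable_itv _) (integrable_expln0y a0).
move=> t t0; have it : 0 <= t^-1 by rewrite invr_ge0 ltW.
rewrite (nrm_pw_sub1 _ t0).
have p0 := expR_gt0 (a * ln t).
have e0 := expR_ge0 (- (t / 2)).
suff H : expR (- (t / 2)) * nrm (pw t A) <=
    (C + n1 * E) * (4 * expR (a * ln t) / (1 + expR (a * ln t)) ^+ 2).
  rewrite mulrCA; apply: le_trans (ler_wpM2l _ H) _; first by rewrite invr_ge0 ltW.
  rewrite le_eqVlt; apply/orP; left; apply/eqP; rewrite /L.
  by field; rewrite !gt_eqF// addr_gt0.
have [t1|t1] := leP t 1.
  have p1 : expR (a * ln t) <= 1 by rewrite expln_le1 ?(ltW a0)// t0.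
  have ht : nrm (pw t A) <= C * expR (a * ln t) by apply: h; rewrite t0.
  have e1 : expR (- (t / 2)) <= 1 by rewrite -expR0 ler_expR oppr_le0 divr_ge0// ltW.
  apply: (@le_trans _ _ (C * expR (a * ln t))).
    apply: le_trans ht; rewrite -[leRHS]mul1r ler_wpM2r ?nrm_ge0//.
  apply: (@le_trans _ _ ((C + n1 * E) * expR (a * ln t))).
    by rewrite ler_wpM2r ?(ltW p0)// lerDl mulr_ge0.
  apply: ler_wpM2l; first by rewrite addr_ge0 ?mulr_ge0.
  move: p0 p1; move: (expR _) => p p0 p1.
  rewrite ler_pdivlMr ?exprn_gt0 ?addr_gt0// [4 * p]mulrC ler_pM2l//.
  have -> : 4 = 2 ^+ 2 :> R by ring.
  by rewrite ler_sqr ?nnegrE ?addr_ge0 ?(ltW p0)//; lra.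
have p1 : 1 <= expR (a * ln t) by rewrite -expR0 ler_expR mulr_ge0 ?(ltW a0) ?ln_ge0 ?(ltW t1).
have ht : nrm (pw t A) <= n1 * expR (nrm A * ln t) by apply: nrm_pw_ge1; exact: ltW.
have := hE t t0; rewrite mulrDl expRD => hEt.
apply: (@le_trans _ _ ((C + n1 * E) * (expR (a * ln t))^-1)).
  rewrite ler_pdivlMr//; apply: (@le_trans _ _ (n1 * E)); last by rewrite lerDr.
  apply: (@le_trans _ _ (expR (- (t / 2)) * (n1 * expR (nrm A * ln t)) * expR (a * ln t))).
    by rewrite ler_wpM2r ?(ltW p0)// ler_wpM2l.
  have -> : expR (- (t / 2)) * (n1 * expR (nrm A * ln t)) * expR (a * ln t) =
    n1 * (expR (nrm A * ln t) * expR (a * ln t) * expR (- (t / 2))) by ring.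
  by rewrite ler_wpM2l.
apply: ler_wpM2l; first by rewrite addr_ge0 ?mulr_ge0.
move: p0 p1; move: (expR _) => p p0 p1.
rewrite ler_pdivlMr ?exprn_gt0 ?addr_gt0// mulrC ler_pdivrMr//.
have -> : 4 * p * p = (2 * p) ^+ 2 by ring.
by rewrite ler_sqr ?nnegrE ?addr_ge0 ?mulr_ge0 ?(ltW p0)//; lra.
Qed.

End DominatedIntegrands.

(** * The beta integral *)

Section Stability.
Variables (R : realType) (N : nat).
Local Notation mat := 'M[R[i]]_N.
Implicit Types (A B M : mat).

Lemma positive_stable_add A (c : R) : 0 <= c -> positive_stable A ->
  positive_stable (A + c%:C%:M).
Proof.
move=> c0 hA a /eigenvalueP[v hv v0].
have {hv} : eigenvalue A (a - c%:C).
  apply/eigenvalueP; exists v => //.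
  by rewrite scalerBl -hv mulmxDr mul_mx_scalar addrK.
by move=> /hA; rewrite ReD ReN /=; lra.
Qed.

Lemma positive_stable_addn A n : positive_stable A -> positive_stable (A + n%:R%:M).
Proof. by move=> hA; have := positive_stable_add (ler0n R n) hA; rewrite rmorph_nat. Qed.

Lemma positive_stable1 : positive_stable (1 : mat).
Proof.
move=> a /eigenvalueP[v hv v0]; move: hv; rewrite mulmx1 => hv.
have : (a - 1) *: v = 0 by rewrite scalerBl -hv scale1r subrr.
by move/eqP; rewrite scaler_eq0 (negPf v0) orbF subr_eq0 => /eqP ->.
Qed.

Lemma stable_addn_unit A n : positive_stable A -> A + n%:R%:M \in unitmx.
Proof.
move=> /(@positive_stable_addn _ n) hA; set B := A + _ in hA *.
rewrite -row_free_unit -kermx_eq0; apply/negPn/negP => /rowV0Pn[v /sub_kermxP vB v0].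
have : eigenvalue B 0 by apply/eigenvalueP; exists v; rewrite ?scale0r.
by move=> /hA; rewrite ltxx.
Qed.

End Stability.

(* The derivative of [u^A (1 - u)^B], with [X = u^A], [Y = (1 - u)^B], [a = 1 / u],
   [b = 1 / (1 - u)] and [r = 1 - u]. *)
Lemma beta_derivative_identity (K : comPzRingType) (N : nat) (A B X Y : 'M[K]_N) (a b r : K) :
  GRing.comm B X -> r * (a * b) = a -> (1 - r) * (a * b) = b ->
  a *: (A * X) * Y + X * - (b *: (B * Y)) =
  (A + B) * (r *: (a *: X * (b *: Y))) + - B * (a *: X * (b *: Y)).
Proof.
move=> BX h1 h2.
have -> : a *: X * (b *: Y) = (a * b) *: (X * Y) by rewrite scaleMl scaleMr scalerA.
have -> : X * - (b *: (B * Y)) = - (b *: (B * (X * Y))).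
  by rewrite mulrN scaleMr mulrA -BX -mulrA.
have -> : a *: (A * X) * Y = a *: (A * (X * Y)) by rewrite scaleMl mulrA.
rewrite scalerA h1; move: (X * Y) => Z.
rewrite scaleMr mulrDl scalerDr mulNr scaleMr -addrA; congr (_ + _).
by rewrite -{1}h2 mulrBl mul1r h1 scalerBl opprB.
Qed.

Section Beta.
Variables (R : realType) (N : nat).
Local Notation mat := 'M[R[i]]_N.
Local Notation mu := (@lebesgue_measure R).
Implicit Types (A B M : mat) (u t c : R).

Definition bfun A B u : mat := pw u (A - 1) * pw (1 - u) (B - 1).

Fact mbeta_subproof : {f : mat -> mat -> mat |
  forall A B, f A B = mx_integral `]0, 1[ (bfun A B)}.
Proof. by exists (fun A B => mx_integral `]0, 1[ (bfun A B)). Qed.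

Definition mbeta : mat -> mat -> mat := sval mbeta_subproof.

Lemma mbetaE A B : mbeta A B = mx_integral `]0, 1[ (bfun A B).
Proof. exact: (svalP mbeta_subproof). Qed.

Let mI01 : measurable (`]0, 1[%classic : set (measurableTypeR R)).
Proof. exact: measurable_itv. Qed.

Lemma itv01P u : `]0, 1[%classic u -> 0 < u /\ 0 < 1 - u.
Proof. by rewrite /= in_itv/= => /andP[u0 u1]; rewrite subr_gt0. Qed.

Lemma mcont_bfun A B u : `]0, 1[%classic u -> mcont (bfun A B) u.
Proof.
move=> /itv01P[u0 v0]; apply: mcontM.
  exact: mderiv_cont (mderiv_pw (A - 1) u0).
by apply: mderiv_cont; apply: mderiv_pw_onem; rewrite -subr_gt0.
Qed.

Lemma bfun_integrable A B : positive_stable A -> positive_stable B ->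
  mx_integrable `]0, 1[ (bfun A B).
Proof.
move=> hA hB; have [g gi gP] := nrm_beta_dom hA hB.
apply: (mx_integrable_le mI01 _ _ gi).
  exact: mcont_meas (exhausts_itv01 R) (@mcont_bfun A B).
move=> u; rewrite /= in_itv/= => u01.
exact: le_trans (nrmM _ _) (gP u u01).
Qed.

Lemma comm_subr1 A B : GRing.comm A B -> GRing.comm A (B - 1).
Proof. by move=> AB; apply: commrB => //; exact: commr1. Qed.

Lemma comm_bfun M A B u : GRing.comm M A -> GRing.comm M B -> GRing.comm M (bfun A B u).
Proof. by move=> MA MB; apply: commrM; apply/comm_pw/comm_subr1. Qed.

Lemma comm_mbeta M A B : positive_stable A -> positive_stable B ->
  GRing.comm M A -> GRing.comm M B -> GRing.comm M (mbeta A B).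
Proof.
move=> hA hB MA MB; rewrite mbetaE; apply: (comm_mx_integral mI01 (bfun_integrable hA hB)) => u _.
exact: comm_bfun.
Qed.

Lemma bfunSr A B u : 0 < 1 - u -> bfun A (B + 1) u = (1 - u)%:C *: bfun A B u.
Proof.
by move=> v0; rewrite /bfun -scaleMr -(pw_add1 _ v0) subrK addrK.
Qed.

Lemma bfunSl A B u : 0 < u -> bfun (A + 1) B u = u%:C *: bfun A B u.
Proof.
by move=> u0; rewrite /bfun -scaleMl -(pw_add1 _ u0) subrK addrK.
Qed.

Lemma expln_harmonic_cvg0 (a : R) : 0 < a ->
  (fun n => expR (a * ln (n.+3%:R^-1))) @ \oo --> (0 : R).
Proof.
move=> a0; apply/cvgrPdist_le => e e0.
have d0 : 0 < expR (ln e / a) by exact: expR_gt0.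
near=> n; rewrite sub0r normrN ger0_norm ?expR_ge0//.
have n0 : 0 < n.+3%:R^-1 :> R by rewrite invr_gt0 ltr0n.
rewrite -[leRHS]lnK ?posrE// ler_expR mulrC -ler_pdivlMr// -[leRHS]expRK.
rewrite ler_ln ?posrE// ltW//.
near: n; have [n _ hn] := near_infty_natSinv_lt (PosNum d0).
by exists n => // m /= nm; apply: hn => /=; rewrite !leqW.
Unshelve. all: by end_near. Qed.

Lemma mcvg0_nrm_le (u : nat -> mat) (w : nat -> R) : (forall n, nrm (u n) <= w n) ->
  w @ \oo --> (0 : R) -> mcvg u 0.
Proof.
move=> h hw; apply: mcvg_nrm0.
apply: (@squeeze_cvgr _ _ _ _ (fun=> 0) w) => //; last exact: cvg_cst.
by apply: nearW => n; rewrite subr0 nrm_ge0 h.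
Qed.

Lemma mbetaSr A B : GRing.comm A B -> positive_stable A -> positive_stable B ->
  (A + B) * mbeta A (B + 1) = B * mbeta A B.
Proof.
move=> AB hA hB.
have hB1 : positive_stable (B + 1) by exact: (@positive_stable_addn _ _ _ 1).
(* Stability kills the boundary terms: [u ^ A] tends to 0 at the left end and [(1 - u) ^ B] at the
   right end, while the other factor stays bounded. *)
pose F u := pw u A * pw (1 - u) B.
pose F' u := (A + B) * bfun A (B + 1) u + - B * bfun A B u.
have i1 := mx_integralMl (A + B) mI01 (bfun_integrable hA hB1).
have i2 := mx_integralMl (- B) mI01 (bfun_integrable hA hB).
have i3 := mx_integralD mI01 i1.1 i2.1.
have dF u : `]0, 1[%classic u -> mderiv F u (F' u).
  move=> /itv01P[u0 v0]; have u1 : u < 1 by rewrite -subr_gt0.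
  apply: mderiv_eq (mderivM (mderiv_pw A u0) (mderiv_pw_onem B u1)) _.
  rewrite /F' (bfunSr _ _ v0) /bfun (pw_sub1 _ u0) (pw_sub1 _ v0).
  have cB : GRing.comm B (pw u A) by apply/comm_pw/commr_sym.
  apply: beta_derivative_identity cB _ _.
    by rewrite -!rmorphM; congr (_%:C); field; rewrite !gt_eqF.
  rewrite -(rmorph1 (real_complex R)) -rmorphB -!rmorphM; congr (_%:C).
  by field; rewrite !gt_eqF.
have cF' u : `]0, 1[%classic u -> mcont F' u.
  move=> u01 k; have H (M B' : mat) : mcont (fun u => M * bfun A B' u) u.
    by apply: (@mcontM _ _ (fun=> M)); [move=> k'; exact: cvg_cst|exact: mcont_bfun].
  rewrite /prop_for /continuous_at coD; under eq_fun do rewrite coD.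
  by apply: cvgD; exact: H.
have [a [C [a0 C0 hCA]]] := nrm_pw_le1 hA.
have [b [D [b0 D0 hDB]]] := nrm_pw_le1 hB.
have p (n : nat) : 0 < (n.+3%:R^-1 : R) <= 1.
  by rewrite invr_gt0 ltr0n/= invf_le1 ?ltr0n// ler1n.
have q (n : nat) : 0 < 1 - (n.+3%:R^-1 : R) <= 1.
  case/andP: (p n) => p0 p1; rewrite gerBl (ltW p0) andbT subr_gt0.
  by rewrite invf_lt1 ?ltr0n// ltr1n.
have l1 : mcvg (fun n => F (n.+3%:R^-1)) 0.
  apply: (@mcvg0_nrm_le _ (fun n => C * D * expR (a * ln (n.+3%:R^-1)))).
    move=> n; apply: le_trans (nrmM _ _) _; rewrite mulrAC.
    apply: ler_pM; rewrite ?nrm_ge0//; first exact: hCA.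
    apply: le_trans (hDB _ (q n)) _; rewrite ler_piMr//.
    by apply: expln_le1 (q n); exact: ltW.
  by rewrite -(mulr0 (C * D)); apply: cvgM; [exact: cvg_cst|exact: expln_harmonic_cvg0].
have l2 : mcvg (fun n => F (1 - n.+3%:R^-1)) 0.
  apply: (@mcvg0_nrm_le _ (fun n => C * D * expR (b * ln (n.+3%:R^-1)))).
    move=> n; apply: le_trans (nrmM _ _) _; rewrite -mulrA subKr.
    apply: ler_pM; rewrite ?nrm_ge0//; last exact: hDB.
    apply: le_trans (hCA _ (q n)) _; rewrite ler_piMr//.
    by apply: expln_le1 (q n); exact: ltW.
  by rewrite -(mulr0 (C * D)); apply: cvgM; [exact: cvg_cst|exact: expln_harmonic_cvg0].
have := mx_FTC (exhausts_itv01 R) i3.1 dF cF' l1 l2.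
rewrite i3.2 i1.2 i2.2 -!mbetaE subrr mulNr => /eqP; rewrite subr_eq0 => /eqP.
by [].
Qed.

(** No second integration by parts: [u + (1 - u) = 1] gives [B(A + 1, B) = B(A, B) - B(A, B + 1)],
    and [mbetaSr] finishes. *)
Lemma mbetaSl A B : GRing.comm A B -> positive_stable A -> positive_stable B ->
  (A + B) * mbeta (A + 1) B = A * mbeta A B.
Proof.
move=> AB hA hB; have hB1 : positive_stable (B + 1) by exact: (@positive_stable_addn _ _ _ 1).
have i1 := mx_integralMl (- 1) mI01 (bfun_integrable hA hB1).
have i2 := mx_integralD mI01 (bfun_integrable hA hB) i1.1.
have -> : mbeta (A + 1) B = mbeta A B - mbeta A (B + 1).
  have <- : mx_integral `]0, 1[ (fun t => bfun A B t + - 1 * bfun A (B + 1) t) =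
            mbeta A B - mbeta A (B + 1).
    by rewrite i2.2 i1.2 -!mbetaE mulN1r.
  rewrite mbetaE; apply: eq_mx_integral => u /itv01P[u0 v0].
  rewrite (bfunSl _ _ u0) (bfunSr _ _ v0) mulN1r.
  by rewrite -scaleNr -[X in X + _]scale1r -scalerDl rmorphB rmorph1 subKr.
by rewrite mulrBr (mbetaSr AB hA hB) mulrDl addrK.
Qed.

(** The starting value of the recurrences. It is integrated separately because the antiderivative
    [u ^ A] has boundary value 1, not 0, at the right end. *)
Lemma mbeta1r A : positive_stable A -> A * mbeta A 1 = 1.
Proof.
move=> hA; have h1 := @positive_stable1 R N.
have i1 := mx_integralMl A mI01 (bfun_integrable hA h1).
rewrite mbetaE -i1.2.
have dF u : `]0, 1[%classic u -> mderiv (fun u => pw u A) u (A * bfun A 1 u).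
  move=> /itv01P[u0 v0]; apply: mderiv_eq (mderiv_pw A u0) _.
  rewrite /bfun subrr (pw_sub1 _ u0) [pw (1 - u) 0]pwE scaler0 mx_exp0 mulr1.
  by rewrite scaleMr.
have cF' u : `]0, 1[%classic u -> mcont (fun u => A * bfun A 1 u) u.
  by move=> u01; apply: (@mcontM _ _ (fun=> A)); [move=> k'; exact: cvg_cst|exact: mcont_bfun].
have [a [C [a0 C0 hCA]]] := nrm_pw_le1 hA.
have l1 : mcvg (fun n => pw (n.+3%:R^-1) A) 0.
  apply: (@mcvg0_nrm_le _ (fun n => C * expR (a * ln (n.+3%:R^-1)))).
    by move=> n; apply: hCA; rewrite invr_gt0 ltr0n/= invf_le1 ?ltr0n// ler1n.
  by rewrite -(mulr0 C); apply: cvgM; [exact: cvg_cst|exact: expln_harmonic_cvg0].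
have l2 : mcvg (fun n => pw (1 - n.+3%:R^-1) A) 1.
  have c1 := mderiv_cont (mderiv_pw A (ltr01 : 0 < 1 :> R)).
  move=> k; rewrite -(pw1 A).
  have h0 : (fun n => n.+3%:R^-1 : R) @ \oo --> (0 : R).
    by have := @cvg_harmonic R; rewrite -(cvg_shiftn 2) /harmonic/=; under eq_fun do rewrite addn2.
  suff h : (fun n => 1 - n.+3%:R^-1 : R) @ \oo --> (1 : R).
    exact: (cvg_comp (fun n => 1 - n.+3%:R^-1) (fun u => co k (pw u A)) h (c1 k)).
  suff : (fun n => 1 - n.+3%:R^-1 : R) @ \oo --> (1 - 0 : R) by rewrite subr0.
  by apply: cvgB; [exact: cvg_cst|exact: h0].
by rewrite (mx_FTC (exhausts_itv01 R) i1.1 dF cF' l1 l2) subr0.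
Qed.

End Beta.

(** * Gauss's product and the gamma integral *)

Section GammaLimit.
Variables (R : realType) (N : nat).
Local Notation mat := 'M[R[i]]_N.
Local Notation mu := (@lebesgue_measure R).
Implicit Types (A B M : mat) (u t c : R).

Let mI0y : measurable (`]0, +oo[%classic : set (measurableTypeR R)).
Proof. exact: measurable_itv. Qed.

Lemma Gamma_integrandE A t : 0 < t -> Gamma_integrand A t = (expR (- t))%:C *: pw t (A - 1).
Proof. by move=> t0; rewrite /Gamma_integrand mx_cpow_real. Qed.

Lemma onem_div01 t c : 0 < t < c -> 0 < 1 - t / c <= 1.
Proof.
move=> /andP[t0 tc]; have c0 := lt_trans t0 tc.
by rewrite subr_gt0 ltr_pdivrMr// mul1r tc/= gerBl divr_ge0 ?ltW.
Qed.

(** Apply [1 - x <= exp (- x)] at [x = t / (n + 2)] and use [(n + 1) / (n + 2) >= 1 / 2]. *)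
Lemma onemX_le_exp t n : 0 < t < n.+2%:R -> (1 - t / n.+2%:R) ^+ n.+1 <= expR (- (t / 2)).
Proof.
move=> tc; have /andP[x0 _] := onem_div01 tc; have /andP[t0 _] := tc.
apply: (@le_trans _ _ (expR (- (t / n.+2%:R)) ^+ n.+1)).
  by rewrite lerXn2r ?nnegrE ?expR_ge0 ?(ltW x0)//; apply: expR_ge1Dx.
rewrite -expRM_natl ler_expR mulrN lerN2 mulrCA ler_wpM2l ?(ltW t0)//.
rewrite ler_pdivlMr ?ltr0n// mulrC ler_pdivrMr//.
by rewrite -natrM ler_nat mulnC mul2n -addnn !addSn !addnS !ltnS leq_addr.
Qed.

Lemma cvg_harmonic2 : (fun n => n.+2%:R^-1 : R) @ \oo --> (0 : R).
Proof.
by have := @cvg_harmonic R; rewrite -(cvg_shiftn 1) /harmonic/=; under eq_fun do rewrite addn1.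
Qed.

Lemma eventually_lt_natS2 t : \forall n \near \oo, t < n.+2%:R.
Proof.
exists (Num.truncn t) => // n /= tn; apply: lt_trans (truncnS_gt t) _.
by rewrite ltr_nat !ltnS.
Qed.

(** Squeeze from [exp (- x / (1 - x)) <= 1 - x <= exp (- x)] with [x = t h], raised to the power
    [n + 1]; here [h = 1 / (n + 2)] and [(n + 1) h = 1 - h]. *)
Lemma onemX_cvg_exp t : 0 < t ->
  (fun n => (1 - t / n.+2%:R) ^+ n.+1) @ \oo --> expR (- t).
Proof.
move=> t0.
have cexp (v : nat -> R) : v @ \oo --> t -> (fun n => expR (- v n)) @ \oo --> expR (- t).
  move=> hv; apply: (cvg_comp (fun n => - v n) expR); last exact: continuous_expR.
  exact: cvgN.
pose h (n : nat) : R := n.+2%:R^-1.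
have h0 : h @ \oo --> (0 : R) by exact: cvg_harmonic2.
have hn1 n : n.+1%:R * h n = 1 - h n.
  have c0 : (n.+2%:R : R) != 0 by rewrite pnatr_eq0.
  have e : n.+2%:R = n.+1%:R + 1 :> R by rewrite natr1.
  by rewrite /h e in c0 *; field.
apply: (@squeeze_cvgr _ _ _ _ (fun n => expR (- (t * (1 - h n) / (1 - t * h n))))
  (fun n => expR (- (t * (1 - h n))))).
- near=> n; have tn : 0 < t < n.+2%:R.
    by rewrite t0; near: n; exact: eventually_lt_natS2.
  have /andP[x0 x1] := onem_div01 tn; rewrite -/(h n) in x0 x1 *.
  apply/andP; split.
    have -> : - (t * (1 - h n) / (1 - t * h n)) = n.+1%:R * (- (t * h n / (1 - t * h n))).
      by rewrite -hn1; field; rewrite gt_eqF.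
    rewrite expRM_natl lerXn2r ?nnegrE ?expR_ge0 ?(ltW x0)//.
    rewrite expRN invf_ple ?posrE ?expR_gt0//; apply: le_trans (expR_ge1Dx _).
    by rewrite le_eqVlt; apply/orP; left; apply/eqP; field; rewrite gt_eqF.
  have -> : - (t * (1 - h n)) = n.+1%:R * (- (t * h n)) by rewrite -hn1; ring.
  rewrite expRM_natl lerXn2r ?nnegrE ?expR_ge0 ?(ltW x0)//.
  exact: expR_ge1Dx.
- apply: cexp.
  suff : (fun n => t * (1 - h n) / (1 - t * h n)) @ \oo --> t * (1 - 0) / (1 - t * 0).
    by rewrite mulr0 !subr0 !mulr1 divr1.
  apply: cvgM.
    by apply: cvgM; [exact: cvg_cst|apply: cvgB; [exact: cvg_cst|exact: h0]].
  apply: cvgV; first by rewrite mulr0 subr0 oner_neq0.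
  apply: cvgB; first exact: cvg_cst.
  by apply: cvgM; [exact: cvg_cst|exact: h0].
- apply: cexp.
  suff : (fun n => t * (1 - h n)) @ \oo --> t * (1 - 0) by rewrite subr0 mulr1.
  by apply: cvgM; [exact: cvg_cst|apply: cvgB; [exact: cvg_cst|exact: h0]].
Unshelve. all: by end_near. Qed.

Lemma pw_onem_cvg1 B t :
  mcvg (fun n => pw (1 - t / n.+2%:R) B) 1.
Proof.
move=> k; have c1 := mderiv_cont (mderiv_pw B (ltr01 : 0 < 1 :> R)).
rewrite -(pw1 B).
suff h : (fun n => 1 - t / n.+2%:R : R) @ \oo --> (1 : R).
  exact: (cvg_comp (fun n => 1 - t / n.+2%:R) (fun u => co k (pw u B)) h (c1 k)).
suff : (fun n => 1 - t / n.+2%:R : R) @ \oo --> (1 - t * 0 : R) by rewrite mulr0 subr0.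
apply: cvgB; first exact: cvg_cst.
by apply: cvgM; [exact: cvg_cst|exact: cvg_harmonic2].
Qed.

Lemma mcvgZ (a : nat -> R) (l : R) (v : nat -> mat) M : a @ \oo --> l -> mcvg v M ->
  mcvg (fun n => (a n)%:C *: v n) (l%:C *: M).
Proof.
move=> ha hv k; rewrite coZ; under eq_fun do rewrite coZ.
by apply: cvgM; [exact: ha|exact: hv].
Qed.

(** The integrand after [u = t / (n + 2)]. One unit of [n + 2] offsets the [- 1] in the exponent, so
    [(1 - t / (n + 2)) ^ B] remains: bounded by the stability of [B], and tending to 1. *)
Lemma scaled_bfun A B n t : 0 < t < n.+2%:R ->
  (n.+2%:R^-1)%:C *: (pw n.+2%:R A * bfun A (B + n.+2%:R%:M) (t / n.+2%:R)) =
  ((1 - t / n.+2%:R) ^+ n.+1)%:C *: (pw t (A - 1) * pw (1 - t / n.+2%:R) B).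
Proof.
move=> tc; have /andP[x0 _] := onem_div01 tc; have /andP[t0 _] := tc.
have c0 : 0 < n.+2%:R :> R by rewrite ltr0n.
rewrite /bfun.
have -> : B + n.+2%:R%:M - 1 = B + n.+1%:R%:M.
  rewrite -addrA; congr (_ + _).
  have -> : n.+2%:R%:M = n.+1%:R%:M + 1 :> mat by rewrite -[n.+2]addn1 natrD raddfD.
  by rewrite addrK.
rewrite (pw_addn _ _ x0).
have u0 : 0 < t / n.+2%:R by rewrite divr_gt0.
rewrite (pw_sub1 _ u0) (pw_sub1 _ t0).
have -> : pw t A = pw n.+2%:R A * pw (t / n.+2%:R) A.
  by rewrite -(pwM _ c0 u0) mulrC divfK// gt_eqF.
move: (pw n.+2%:R A) (pw (t / n.+2%:R) A) (pw (1 - t / n.+2%:R) B) => X Y Z.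
rewrite scaleMr scaleMl scaleMr scaleMr scaleMl mulrA !scalerA -!rmorphM; congr (_%:C *: _).
by move: (_ ^+ _) => w; field; rewrite !gt_eqF.
Qed.

(** The limit does not depend on [B]. The case [B = 1] gives Gauss's product, and [B + 1] in place
    of [B] gives the other side of [mbeta_Gamma]. *)
Lemma gamma_limit A B : GRing.comm A B -> positive_stable A -> positive_stable B ->
  mx_integrable `]0, +oo[ (Gamma_integrand A) /\
  mcvg (fun n => pw n.+2%:R A * mbeta A (B + n.+2%:R%:M)) (mx_Gamma A).
Proof.
move=> AB hA hB; have [g gi gP] := nrm_gamma_dom hA.
have [b [C [b0 C0 hC]]] := nrm_pw_le1 hB.
pose Gn n t : mat := ((1 - t / n.+2%:R) ^+ n.+1)%:C *: (pw t (A - 1) * pw (1 - t / n.+2%:R) B).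
(* Extension by zero puts all the integrals on the half line, as dominated convergence requires. *)
pose Fn n t : mat := if t \in `]0, n.+2%:R[%classic then Gn n t else 0.
have c0 n : 0 < n.+2%:R :> R by rewrite ltr0n.
have mI0c n : measurable (`]0, n.+2%:R[%classic : set (measurableTypeR R)).
  exact: measurable_itv.
have sub n : `]0, n.+2%:R[%classic `<=` (`]0, +oo[%classic : set R).
  by move=> t /=; rewrite !in_itv/= andbT => /andP[].
have inP n t : t \in `]0, n.+2%:R[%classic = (0 < t < n.+2%:R) :> bool.
  by apply/idP/idP; rewrite inE /= in_itv.
have cGn n t : `]0, n.+2%:R[%classic t -> mcont (Gn n) t.
  rewrite /= in_itv/= => tc; have /andP[x0 _] := onem_div01 tc; have /andP[t0 _] := tc.
  have cx : {for t, continuous (fun t => 1 - t / n.+2%:R : R)}.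
    by apply: cvgB; [exact: cvg_cst|apply: cvgM; [exact: cvg_id|exact: cvg_cst]].
  apply: mcontZ.
    apply: (@continuous_comp _ _ _ (fun t => 1 - t / n.+2%:R) (fun x => x ^+ n.+1) t cx).
    exact: exprn_continuous.
  apply: mcontM; first exact: mderiv_cont (mderiv_pw (A - 1) t0).
  move=> k.
  apply: (@continuous_comp _ _ _ (fun t => 1 - t / n.+2%:R) (fun x => co k (pw x B)) t cx).
  exact: mderiv_cont (mderiv_pw B x0) k.
have mFn n : mmeas `]0, +oo[ (Fn n).
  apply: mmeas_patch (mI0y) (mI0c n) (sub n) _.
  exact: mcont_meas (exhausts_itv0c (c0 n)) (cGn n).
have mF : mmeas `]0, +oo[ (fun t => (expR (- t))%:C *: pw t (A - 1)).
  apply: mcont_meas (exhausts_itv0y R) _ => t; rewrite /= in_itv/= andbT => t0.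
  apply: mcontZ; last exact: mderiv_cont (mderiv_pw (A - 1) t0).
  by apply: (@continuous_comp _ _ _ (fun t => - t) expR); [exact: opp_continuous|exact: continuous_expR].
have hcv t : `]0, +oo[%classic t ->
    mcvg (fun n => Fn n t) ((expR (- t))%:C *: pw t (A - 1)).
  rewrite /= in_itv/= andbT => t0.
  have H : mcvg (fun n => Gn n t) ((expR (- t))%:C *: pw t (A - 1)).
    rewrite -[pw t (A - 1)]mulr1; apply: mcvgZ (onemX_cvg_exp t0) _.
    by apply: mcvgM (mcvg_cst _) _; exact: pw_onem_cvg1.
  move=> k; apply: cvg_trans (H k); apply: near_eq_cvg.
  near=> n; rewrite /Fn inP t0; case: ifP => //= /negP[].
  by near: n; exact: eventually_lt_natS2.
have hb n t : `]0, +oo[%classic t -> nrm (Fn n t) <= C * g t.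
  rewrite /= in_itv/= andbT => t0; have gt := gP t t0.
  have g0 : 0 <= g t by apply: le_trans gt; rewrite mulr_ge0 ?expR_ge0 ?nrm_ge0.
  rewrite /Fn inP; case: ifP => [tc|_]; last by rewrite nrm0 mulr_ge0.
  have xc := onem_div01 tc; have /andP[x0 x1] := xc.
  have hX := onemX_le_exp tc.
  rewrite /Gn nrmZr; last by rewrite exprn_ge0 ?ltW.
  have hBn : nrm (pw (1 - t / n.+2%:R) B) <= C.
    apply: le_trans (hC _ xc) _; rewrite ler_piMr//.
    by apply: expln_le1 xc; exact: ltW.
  have hM := nrmM (pw t (A - 1)) (pw (1 - t / n.+2%:R) B).
  move: hM hBn gt hX.
  move: (nrm (_ * _)) (nrm (pw (1 - t / n.+2%:R) B)) (nrm (pw t (A - 1)))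
    (nrm_ge0 (pw (1 - t / n.+2%:R) B)) (nrm_ge0 (pw t (A - 1))) => p q r q0 r0 hM hBn gt hX.
  apply: (@le_trans _ _ (expR (- (t / 2)) * (r * C))).
    apply: le_trans (ler_wpM2l _ (le_trans hM (ler_wpM2l r0 hBn))) _.
      by rewrite exprn_ge0 ?ltW.
    by rewrite ler_wpM2r// mulr_ge0.
  by rewrite mulrA mulrC ler_wpM2l.
have [i1 lim1] := mx_dominated mI0y mFn mF hcv hb (integrable_real_Zl C mI0y gi).
split.
  apply: eq_mx_integrable mI0y _ i1 => t; rewrite /= in_itv/= andbT => t0.
  by rewrite (Gamma_integrandE _ t0).
have -> : mx_Gamma A = mx_integral `]0, +oo[ (fun t => (expR (- t))%:C *: pw t (A - 1)).
  apply: eq_mx_integral => t; rewrite /= in_itv/= andbT => t0.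
  by rewrite (Gamma_integrandE _ t0).
apply: mcvg_ext lim1 => n.
have iFn : mx_integrable `]0, +oo[ (Fn n).
  exact: mx_integrable_le mI0y (mFn n) (hb n) (integrable_real_Zl C mI0y gi).
have [iGn ->] := mx_integral_patch mI0y (mI0c n) (sub n) iFn.
have mI01 : measurable (`]0, 1[%classic : set (measurableTypeR R)) by exact: measurable_itv.
have hBn : positive_stable (B + n.+2%:R%:M) by exact: positive_stable_addn.
have [i2 E2] := mx_integralMl (pw n.+2%:R A) mI01 (bfun_integrable hA hBn).
rewrite mbetaE -E2.
rewrite -(mx_integral_scale (c0 n) _ i2).
- apply: eq_mx_integral => t; rewrite /= in_itv/= => tc.
  by rewrite (scaled_bfun _ _ tc).
- move=> u u01; apply: (@mcontM _ _ (fun=> pw n.+2%:R A)); first by move=> k; exact: cvg_cst.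
  by apply: mcont_bfun; rewrite /= in_itv.
- apply: eq_mx_integrable (mI0c n) _ iGn => t; rewrite /= in_itv/= => tc.
  by rewrite (scaled_bfun _ _ tc).
Unshelve. all: by end_near. Qed.

End GammaLimit.

(** In use, [gAB] and [gB] are the Gauss products of [A + B] and [B], [p] and [q] the corresponding
    Pochhammer symbols, [X] and [Y] the powers of [n + 2] with exponents [A] and [B], [b] and [b']
    two beta integrals, and [f] is [(n + 2)!]. *)
Lemma gauss_identity (T : pzRingType) (f : nat) (gAB gB X Y b b' p q : T) :
  p * gAB = f%:R * (X * Y) -> q * gB = f%:R * Y -> p * b' = q * b ->
  GRing.comm b p -> GRing.comm X p -> GRing.comm p gB -> GRing.comm gB X ->
  GRing.comm gB q -> GRing.comm b (X * Y) ->
  p * (gB * (X * b')) = p * (b * gAB).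
Proof.
move=> h1 h2 h3 bp Xp pg gX gq bXY.
have -> : p * (b * gAB) = f%:R * (X * Y) * b.
  rewrite mulrA -bp -mulrA h1 mulrA (commr_nat b f) -mulrA bXY mulrA; exact: erefl.
rewrite mulrA pg -mulrA [p * (X * b')]mulrA -Xp -mulrA h3 mulrA gX -mulrA.
rewrite [gB * (q * b)]mulrA gq h2 !mulrA; congr (_ * _ * _).
exact: commr_nat.
Qed.

(** * Pochhammer symbols, Gauss's product and the beta-gamma relation *)

Section BetaGamma.
Variables (R : realType) (N : nat).
Local Notation mat := 'M[R[i]]_N.
Implicit Types (A B M : mat) (m n : nat).

Lemma natr_mx m : (m%:R%:M : mat) = m%:R.
Proof. by elim: m => [|m IH]; [rewrite raddf0|rewrite -addn1 !natrD raddfD/= IH]. Qed.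

Lemma pochS A m : mx_pochhammer A m.+1 = mx_pochhammer A m * (A + m%:R).
Proof. by rewrite /mx_pochhammer big_ord_recr/= natr_mx. Qed.

Lemma poch0 A : mx_pochhammer A 0 = 1.
Proof. by rewrite /mx_pochhammer big_ord0. Qed.

Lemma pochSl A m : mx_pochhammer A m.+1 = A * mx_pochhammer (A + 1) m.
Proof.
elim: m => [|m IH]; first by rewrite pochS !poch0 mul1r mulr1 mulr0n addr0.
by rewrite pochS IH pochS -mulrA -addrA nat1r.
Qed.

Lemma commrD_nat A B m : GRing.comm A B -> GRing.comm A (B + m%:R).
Proof. by move=> AB; apply: commrD => //; exact: commr_nat. Qed.

Lemma comm_poch A B m : GRing.comm A B -> GRing.comm A (mx_pochhammer B m).
Proof.
move=> AB; elim: m => [|m IH]; first by rewrite poch0; exact: commr1.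
by rewrite pochS; apply: commrM => //; exact: commrD_nat.
Qed.

Lemma poch1 m : mx_pochhammer (1 : mat) m = m`!%:R.
Proof.
elim: m => [|m IH]; first by rewrite poch0.
by rewrite pochS IH nat1r -natrM factS mulnC.
Qed.

Lemma mulmx_unit (A B : mat) : A \in unitmx -> B \in unitmx -> A * B \in unitmx.
Proof. by move=> hA hB; have := unitmx_mul A B; rewrite hA hB => h; rewrite [_ * _]/(_ *m _) h. Qed.

Lemma poch_unit A m : (forall k : nat, A + k%:R%:M \in unitmx) -> mx_pochhammer A m \in unitmx.
Proof.
move=> hA; elim: m => [|m IH]; first by rewrite poch0; exact: unitmx1.
by rewrite pochS; apply: mulmx_unit => //; rewrite -natr_mx; exact: hA.
Qed.

Lemma positive_stableS A m : positive_stable A -> positive_stable (A + m%:R).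
Proof. by move=> hA; rewrite -natr_mx; exact: positive_stable_addn. Qed.

Arguments positive_stableS {A} m _.

Lemma mbeta_pochr A B m : GRing.comm A B -> positive_stable A -> positive_stable B ->
  mx_pochhammer (A + B) m * mbeta A (B + m%:R) = mx_pochhammer B m * mbeta A B.
Proof.
move=> AB hA hB; elim: m => [|m IH]; first by rewrite !poch0 mulr0n addr0.
have h := mbetaSr (commrD_nat m AB) hA (positive_stableS m hB).
have c : GRing.comm (B + m%:R) (mx_pochhammer (A + B) m).
  apply: comm_poch; apply/commr_sym/commrD_nat/commr_sym.
  by apply: commrD => //; exact: commr_sym.
have c' : GRing.comm (B + m%:R) (mx_pochhammer B m).
  by apply: comm_poch; exact/commr_sym/commrD_nat.
rewrite !pochS -!mulrA -natr1 [B + (m%:R + 1)]addrA -[A + B + m%:R]addrA h mulrA -c -mulrA IH.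
by rewrite mulrA c' -mulrA.
Qed.

Lemma mbeta_pochl A B m : GRing.comm A B -> positive_stable A -> positive_stable B ->
  mx_pochhammer (A + B) m * mbeta (A + m%:R) B = mx_pochhammer A m * mbeta A B.
Proof.
move=> AB hA hB; elim: m => [|m IH]; first by rewrite !poch0 mulr0n addr0.
have AmB : GRing.comm (A + m%:R) B by apply/commr_sym/commrD_nat/commr_sym.
have h := mbetaSl AmB (positive_stableS m hA) hB.
have c : GRing.comm (A + m%:R) (mx_pochhammer (A + B) m).
  by apply: comm_poch; apply/commr_sym/commrD_nat/commr_sym; exact: commrD.
have c' : GRing.comm (A + m%:R) (mx_pochhammer A m).
  by apply: comm_poch; exact/commr_sym/commrD_nat.
rewrite !pochS -!mulrA -natr1 [A + (m%:R + 1)]addrA [A + B + m%:R]addrAC h mulrA -c -mulrA IH.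
by rewrite mulrA c' -mulrA.
Qed.

(** By [gauss_poch] this is Gauss's product [(n + 2)! (n + 2)^A / (A)_(n + 3)]; the beta form gives
    its limit through [gamma_limit]. *)
Definition gauss A n : mat := pw n.+2%:R A * mbeta A (1 + n.+2%:R).

Lemma gauss_cvg A : positive_stable A -> mcvg (gauss A) (mx_Gamma A).
Proof.
move=> hA; have [_ h] := gamma_limit (commr1 A) hA (@positive_stable1 R N).
by apply: mcvg_ext h => n; rewrite /gauss natr_mx.
Qed.

Lemma gauss_poch A n : positive_stable A ->
  mx_pochhammer A n.+3 * gauss A n = n.+2`!%:R * pw n.+2%:R A.
Proof.
(* The first factor [A] is split off to meet [A * mbeta A 1 = 1]; the remaining [(A + 1)_(n + 2)]
   shifts the second argument down to 1. *)
move=> hA; rewrite /gauss pochSl.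
have h := mbeta_pochr n.+2 (commr1 A) hA (@positive_stable1 R N).
have h1 := mbeta1r hA.
have c : GRing.comm (pw n.+2%:R A) (mx_pochhammer (A + 1) n.+2).
  by apply/comm_poch/(commrD_nat 1)/commr_sym/comm_pw.
have c' : GRing.comm (pw n.+2%:R A) A by apply/commr_sym/comm_pw.
rewrite poch1 in h.
move: (pw n.+2%:R A) (mx_pochhammer (A + 1) n.+2) (mbeta A (1 + n.+2%:R)) (mbeta A 1) h h1 c c'.
move=> X P Y Z h h1 c c'.
rewrite -mulrA [P * (X * Y)]mulrA -c -mulrA h mulrA -c' -mulrA [A * _]mulrA.
by rewrite (commr_nat A) -mulrA h1 mulr1; exact: commr_nat.
Qed.

Lemma comm_gauss M A n : positive_stable A -> GRing.comm M A -> GRing.comm M (gauss A n).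
Proof.
move=> hA MA; apply: commrM; first exact: comm_pw.
apply: comm_mbeta hA (positive_stableS n.+2 (@positive_stable1 R N)) MA _.
by apply: commrD_nat; exact: commr1.
Qed.

Lemma mbeta_Gamma A B : GRing.comm A B -> positive_stable A -> positive_stable B ->
  positive_stable (A + B) -> mbeta A B * mx_Gamma (A + B) = mx_Gamma B * mx_Gamma A.
Proof.
move=> AB hA hB hAB.
have hB1 : positive_stable (B + 1) by exact: (positive_stableS 1).
(* Starting from [B + 1] turns the shift [n + 2] into [B + (n + 3)], which matches the length of the
   Pochhammer symbols in [gauss_poch]. *)
have [_ hX] := gamma_limit (commrD_nat 1 AB) hA hB1.
apply: (mcvg_unique (mcvgM (mcvg_cst (mbeta A B)) (gauss_cvg hAB))).
apply: mcvg_ext (mcvgM (gauss_cvg hB) hX) => n.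
have BA := commr_sym AB.
have cA : GRing.comm A (A + B) by exact: commrD.
have cB : GRing.comm B (A + B) by exact: commrD.
have u : mx_pochhammer (A + B) n.+3 \in unitmx.
  by apply: poch_unit => k; exact: stable_addn_unit.
have h1 := gauss_poch n hAB; have h2 := gauss_poch n hB.
have h3 := mbeta_pochr n.+3 AB hA hB.
have e : B + 1 + n.+2%:R%:M = B + n.+3%:R by rewrite natr_mx -addrA nat1r.
rewrite e; set b := mbeta A B in h3 *; set b' := mbeta A (B + n.+3%:R) in h3 *.
set p := mx_pochhammer (A + B) n.+3 in u h1 h3; set q := mx_pochhammer B n.+3 in h2 h3.
have pwAB := pwD n.+2%:R AB; rewrite pwAB in h1.
have cpb : GRing.comm b p.
  apply/comm_poch/commr_sym; apply: comm_mbeta hA hB _ _; exact: commr_sym.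
have cpA : GRing.comm (pw n.+2%:R A) p by apply/comm_poch/commr_sym/comm_pw/commr_sym.
have cpg : GRing.comm p (gauss B n) by apply: comm_gauss hB _; exact/commr_sym/comm_poch.
have cgA : GRing.comm (gauss B n) (pw n.+2%:R A).
  by apply/comm_pw/commr_sym; exact: comm_gauss.
have cqg : GRing.comm (gauss B n) q by apply/comm_poch/commr_sym; exact: comm_gauss.
have cAB : GRing.comm b (pw n.+2%:R A * pw n.+2%:R B).
  have cbA : GRing.comm b A by apply: commr_sym; exact: comm_mbeta.
  have cbB : GRing.comm b B by apply: commr_sym; exact: comm_mbeta.
  by apply: commrM; exact: comm_pw.
move: h1 h2 h3 u cpb cpA cpg cgA cqg cAB.
move: (gauss (A + B) n) (gauss B n) (pw n.+2%:R A) (pw n.+2%:R B) b b' p q.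
move=> gAB gB X Y b b' p q h1 h2 h3 u cpb cpA cpg cgA cqg cAB.
apply: (can_inj (mulKmx u)).
exact: (gauss_identity h1 h2 h3 cpb cpA cpg cgA cqg cAB).
Qed.

End BetaGamma.

Arguments positive_stableS {R N A} m _.

(** In use, [X] is [(1 - x) ^ A] and [q] is [1 / (1 - x)]; the left side is the product rule for
    [(1 - x)^A (1 + x A)]. *)
Lemma weierstrass_factor_identity (K : comPzRingType) (N : nat) (A X : 'M[K]_N) (x q : K) :
  GRing.comm A X -> q - 1 = x * q ->
  - (q *: (A * X)) * (1 + x *: A) + X * A = - ((x * q) *: (A * X * (1 + A))).
Proof.
move=> c h; rewrite -c; move: (A * X) => W.
rewrite mulNr scaleMl mulrDr mulr1 scaleMr [W * (1 + A)]mulrDr mulr1 !scalerDr.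
rewrite scalerA [q * x]mulrC -h opprD addrAC opprD; congr (_ + _).
by rewrite scalerBl scale1r opprB addrC.
Qed.

Lemma weierstrass_step_identity (K : comPzRingType) (N : nat) (X Y Y' P Z : 'M[K]_N) (r r' s : K) :
  GRing.comm Y P -> Y' * Y = 1 -> r' * s = r ->
  r' *: (X * (P * (s *: Z))) = r *: (X * Y' * P) * (Y * Z).
Proof.
move=> YP YY <-; rewrite !scaleMr scalerA scaleMl; congr (_ *: _).
by rewrite -!mulrA (mulrA P Y Z) -YP -(mulrA Y P Z) (mulrA Y' Y) YY mul1r.
Qed.

(** * Invertibility of the gamma matrix *)

Section GammaUnit.
Variables (R : realType) (N : nat).
Local Notation mat := 'M[R[i]]_N.
Implicit Types (A B M : mat) (m n : nat) (x : R).

Lemma nrm_eq0 M : nrm M <= 0 -> M = 0.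
Proof.
move=> h; apply: coP => k; rewrite co0; apply/eqP; rewrite -normr_le0.
exact: le_trans (co_le_nrm _ _) h.
Qed.

Let f A x : mat := pw (1 - x) A * (1 + x%:C *: A).

(** The factor [x] is what matters: the first-order terms of [(1 - x)^A] and [1 + x A] cancel, so
    integrating from 0 gives a quadratic deviation from 1. *)
Lemma weierstrass_factor_derive A x : x < 1 ->
  mderiv (f A) x (- ((x * (1 - x)^-1)%:C *: (A * pw (1 - x) A * (1 + A)))).
Proof.
move=> x1; have d1 := mderiv_pw_onem A x1.
have d2 : mderiv (fun x => 1 + x%:C *: A) x A.
  have := mderivD (mderiv_cst 1 x) (mderivZ (@is_derive_id _ _ x 1) (mderiv_cst A x)).
  by move=> h; apply: mderiv_eq h _; rewrite scaler0 addr0 add0r rmorph1 scale1r.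
apply: mderiv_eq (mderivM d1 d2) _.
have c : GRing.comm A (pw (1 - x) A) by exact: comm_pw.
have x0 : 1 - x != 0 by rewrite subr_eq0 gt_eqF.
have e : ((1 - x)^-1)%:C - 1 = x%:C * ((1 - x)^-1)%:C :> R[i].
  by rewrite -(rmorph1 (real_complex R)) -rmorphB -rmorphM; congr (_%:C); field.
by rewrite rmorphM; exact: weierstrass_factor_identity.
Qed.

Lemma weierstrass_factor_bound A : exists2 C : R, 0 <= C &
  forall x, 0 <= x <= 2^-1 -> nrm (f A x - 1) <= C * x ^+ 2.
Proof.
have half_gt x : 0 <= x <= 2^-1 -> x < 1 /\ 1 <= (1 - x)^-1 <= 2.
  move=> /andP[x0 x1]; have x1' : x < 1 by lra.
  split => //; rewrite invf_ge1 ?subr_gt0// gerBl x0/=.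
  by rewrite -[leRHS]invrK lef_pV2 ?posrE ?invr_gt0 ?subr_gt0//; lra.
(* For [x <= 1/2], [(1 - x)^A] is a power of [1 / (1 - x)], a base between 1 and 2, with exponent
   [- A]. *)
pose E := nrm (1 : mat) * expR (nrm (- A) * ln 2).
have E0 : 0 <= E by rewrite mulr_ge0 ?nrm_ge0 ?expR_ge0.
have hE x : 0 <= x <= 2^-1 -> nrm (pw (1 - x) A) <= E.
  move=> hx; have [x1 /andP[q1 q2]] := half_gt x hx.
  rewrite -[1 - x]invrK pw_inv ?invr_gt0 ?subr_gt0//.
  apply: le_trans (nrm_pw_ge1 _ q1) _; rewrite ler_wpM2l ?nrm_ge0// ler_expR.
  rewrite ler_wpM2l ?nrm_ge0// ler_ln ?posrE ?invr_gt0 ?subr_gt0//.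
pose K := 2 * (nrm A * E * nrm (1 + A)).
have K0 : 0 <= K by rewrite !mulr_ge0 ?nrm_ge0.
exists (#|{: bool * ('I_N * 'I_N)}|%:R * (K / 2)); first by rewrite mulr_ge0 ?divr_ge0.
move=> x hx; have /andP[x0 x1] := hx.
have f0 : f A 0 = 1 by rewrite /f subr0 pw1 mul1r rmorph0 scale0r addr0.
rewrite -f0 -mulrA.
have := @mderiv_ineq R N (f A) (fun x => - ((x * (1 - x)^-1)%:C *: (A * pw (1 - x) A * (1 + A))))
  (fun x => K / 2 * x ^+ 2) (fun x => K * x) 0 x x0.
rewrite expr0n mulr0 subr0; apply.
- move=> t /andP[t0 tx]; apply: weierstrass_factor_derive; lra.
- move=> t _; have h := is_deriveMr (is_derive_id t (1 : R)) (is_derive_id t (1 : R)).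
  have h2 := is_deriveMr (is_derive_cst (K / 2) t 1) h.
  apply: (is_derive_ext (f := fun s => K / 2 * (s * s))) => [s|]; first by rewrite expr2.
  by apply: (@is_derive_eq _ _ _ _ _ _ _ _ h2); rewrite /cst; field.
- move=> t /andP[t0 tx]; have ht : 0 <= t <= 2^-1 by rewrite t0 (le_trans tx).
  have [t1 /andP[q1 q2]] := half_gt t ht.
  have tq : 0 <= t * (1 - t)^-1 by rewrite mulr_ge0// (le_trans _ q1).
  rewrite nrmN nrmZr// /K.
  have h : nrm (A * pw (1 - t) A * (1 + A)) <= nrm A * E * nrm (1 + A).
    apply: le_trans (nrmM _ _) _; rewrite ler_wpM2r ?nrm_ge0//.
    by apply: le_trans (nrmM _ _) _; rewrite ler_wpM2l ?nrm_ge0// hE.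
  apply: le_trans (ler_wpM2l tq h) _.
  have -> : 2 * (nrm A * E * nrm (1 + A)) * t = t * 2 * (nrm A * E * nrm (1 + A)) by ring.
  apply: ler_wpM2r; first by rewrite !mulr_ge0 ?nrm_ge0.
  exact: ler_wpM2l.
Qed.

(* Up to the factor [A], the inverse of Gauss's product; consecutive terms differ by the
   factor [f A (1 / (m + 1)) = 1 + O(1 / m^2)], whence boundedness. *)
Definition weierstrass A m : mat :=
  (m`!%:R^-1)%:C *: (pw m%:R (- A) * mx_pochhammer (A + 1) m).

Lemma weierstrassS A m : (0 < m)%N -> weierstrass A m.+1 = weierstrass A m * f A (m.+1%:R^-1).
Proof.
move=> m0; rewrite /weierstrass pochS factS natrM.
have m0' : 0 < m%:R :> R by rewrite ltr0n.
have m1 : 0 < m.+1%:R :> R by rewrite ltr0n.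
have r0 : 0 < m%:R / m.+1%:R :> R by rewrite divr_gt0.
have e : 1 - m.+1%:R^-1 = m%:R / m.+1%:R :> R.
  have e1 : m.+1%:R = m%:R + 1 :> R by rewrite natr1.
  by rewrite e1; field; rewrite -e1 gt_eqF.
have E : pw m%:R (- A) = pw m.+1%:R (- A) * pw (m%:R / m.+1%:R) (- A).
  by rewrite -(pwM _ m1 r0) mulrC divfK// gt_eqF.
rewrite /f e.
have c1 : GRing.comm (pw (m%:R / m.+1%:R) A) (mx_pochhammer (A + 1) m).
  by apply/comm_poch/(commrD_nat 1)/commr_sym/comm_pw.
have c2 := pwVl (m%:R / m.+1%:R) A.
have E2 : A + 1 + m%:R = m.+1%:R%:C *: (1 + (m.+1%:R^-1)%:C *: A).
  rewrite scalerDr scalerA -rmorphM mulfV ?gt_eqF// rmorph1 scale1r -addrA nat1r addrC.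
  by congr (_ + _); rewrite rmorph_nat -natr_mx -[m.+1%:R%:M]scalemx1.
rewrite E E2; apply: weierstrass_step_identity c1 c2 _.
by rewrite -rmorphM invfM mulrAC mulVf ?mul1r// gt_eqF.
Qed.

Lemma weierstrass_bounded A : exists2 K : R, 0 <= K & forall m, (0 < m)%N ->
  nrm (weierstrass A m) <= K.
Proof.
have [C C0 hC] := weierstrass_factor_bound A.
exists (nrm (weierstrass A 1) * expR C); first by rewrite mulr_ge0 ?nrm_ge0 ?expR_ge0.
(* The induction needs a telescoping bound: with [x = 1 / (m + 2)], [x^2] is at most
   [1 / (m + 1) - 1 / (m + 2)], so the exponents add up to less than [C]. *)
suff H m : nrm (weierstrass A m.+1) <= nrm (weierstrass A 1) * expR (C * (1 - m.+1%:R^-1)).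
  case=> // m _; apply: le_trans (H m) _; rewrite ler_wpM2l ?nrm_ge0// ler_expR.
  by rewrite ler_piMr// gerBl invr_ge0.
elim: m => [|m IH]; first by rewrite invr1 subrr mulr0 expR0 mulr1.
rewrite weierstrassS//; set x : R := m.+2%:R^-1.
have x0 : 0 < x by rewrite invr_gt0 ltr0n.
have x1 : x <= 2^-1 by rewrite lef_pV2 ?posrE ?ltr0n// ler_nat.
have xm : x ^+ 2 <= (1 - x) - (1 - m.+1%:R^-1).
  have m0 : 0 < m.+1%:R :> R by rewrite ltr0n.
  have e2 : m.+2%:R = m.+1%:R + 1 :> R by rewrite natr1.
  rewrite /x e2; move: (m.+1%:R : R) m0 => c c0.
  have -> : 1 - (c + 1)^-1 - (1 - c^-1) = (c * (c + 1))^-1.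
    by field; rewrite !gt_eqF// addr_gt0.
  rewrite exprVn lef_pV2 ?posrE ?exprn_gt0 ?mulr_gt0 ?addr_gt0//.
  by rewrite expr2 ler_pM2r ?addr_gt0// lerDl.
have h := hC x; rewrite (ltW x0) x1 in h; have {}h := h isT.
have hstep : nrm (weierstrass A m.+1 * f A x) <= nrm (weierstrass A m.+1) * expR (C * x ^+ 2).
  have -> : weierstrass A m.+1 * f A x = weierstrass A m.+1 + weierstrass A m.+1 * (f A x - 1).
    by rewrite mulrBr mulr1 addrC subrK.
  apply: le_trans (nrmD _ _) _.
  apply: (@le_trans _ _ (nrm (weierstrass A m.+1) * (1 + C * x ^+ 2))).
    rewrite [leRHS]mulrDr mulr1 lerD2l; apply: le_trans (nrmM _ _) _.
    by rewrite ler_wpM2l ?nrm_ge0.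
  by rewrite ler_wpM2l ?nrm_ge0// expR_ge1Dx.
apply: le_trans hstep _.
apply: le_trans (ler_wpM2r (expR_ge0 _) IH) _.
rewrite -mulrA -expRD ler_wpM2l ?nrm_ge0// ler_expR -mulrDr ler_wpM2l//.
by rewrite -lerBrDl.
Qed.

Lemma gauss_weierstrass A n : positive_stable A ->
  gauss A n * (A * weierstrass A n.+2) = 1.
Proof.
move=> hA; have h := gauss_poch n hA.
have c : GRing.comm (gauss A n) (mx_pochhammer A n.+3).
  by apply/comm_poch/commr_sym; exact: comm_gauss.
have f0 : n.+2`!%:R != 0 :> R by rewrite pnatr_eq0 -lt0n fact_gt0.
have cA : GRing.comm A (pw n.+2%:R (- A)) by apply/comm_pw/commrN.
have c2 : GRing.comm (gauss A n) (pw n.+2%:R (- A)).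
  by apply/comm_pw/commrN/commr_sym; exact: comm_gauss.
rewrite /weierstrass scaleMr scaleMr.
have -> : gauss A n * (A * (pw n.+2%:R (- A) * mx_pochhammer (A + 1) n.+2)) =
    pw n.+2%:R (- A) * (mx_pochhammer A n.+3 * gauss A n).
  rewrite -c (pochSl A n.+2); move: (gauss A n) (pw _ _) (mx_pochhammer _ _) cA c2 => G V P cA c2.
  by rewrite (mulrA A V P) cA -mulrA (mulrA G V) c2 -mulrA.
rewrite h -natr_mx.
have -> : n.+2`!%:R%:M * pw n.+2%:R A = n.+2`!%:R%:C *: pw n.+2%:R A.
  have -> : n.+2`!%:R%:C = n.+2`!%:R :> R[i] by rewrite rmorph_nat.
  exact: mul_scalar_mx.
by rewrite scaleMr pwVl scalerA -rmorphM mulVf// rmorph1 scale1r.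
Qed.

Lemma Gamma_unit A : positive_stable A -> mx_Gamma A \in unitmx.
Proof.
move=> hA; have [K K0 hK] := weierstrass_bounded A.
have hG := mcvg_nrm (gauss_cvg hA).
rewrite -row_free_unit -kermx_eq0; apply/eqP.
set X := kermx (mx_Gamma A).
have XG : X * mx_Gamma A = 0 by exact: mulmx_ker.
apply: nrm_eq0; apply/ler_addgt0Pr => e e0; rewrite add0r.
have L0 : 0 <= nrm X * (nrm A * K) by rewrite !mulr_ge0 ?nrm_ge0.
have d0 : 0 < e / (nrm X * (nrm A * K) + 1) by rewrite divr_gt0// ltr_wpDl.
have /cvgrPdist_le /(_ _ d0) [n _ /(_ n (leqnn n))] /= := hG.
rewrite sub0r normrN ger0_norm ?nrm_ge0// => hn.
(* The kernel matrix annihilates [mx_Gamma A], so only the difference survives; it tends to 0 while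
   the last factor stays bounded, which forces [X = 0]. *)
have -> : X = X * (gauss A n - mx_Gamma A) * (A * weierstrass A n.+2).
  by rewrite mulrBr XG subr0 -mulrA gauss_weierstrass// mulr1.
have hW : nrm (A * weierstrass A n.+2) <= nrm A * K.
  by apply: le_trans (nrmM _ _) _; rewrite ler_wpM2l ?nrm_ge0// hK.
apply: le_trans (nrmM _ _) _.
apply: le_trans (ler_pM (nrm_ge0 _) (nrm_ge0 _) (nrmM _ _) hW) _.
apply: (@le_trans _ _ (e / (nrm X * (nrm A * K) + 1) * (nrm X * (nrm A * K)))).
  have -> : nrm X * nrm (gauss A n - mx_Gamma A) * (nrm A * K) =
    nrm (gauss A n - mx_Gamma A) * (nrm X * (nrm A * K)) by ring.
  exact: ler_wpM2r.
rewrite -mulrA ler_piMr ?(ltW e0)// mulrC ler_pdivrMr ?mul1r ?ltr_wpDl//.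
by rewrite lerDl.
Qed.

End GammaUnit.

(** * The binomial series *)

Section ComplexLog.
Variable R : realType.
Implicit Types (a b t x y : R).

(** On the right half plane the argument is an arctangent, which is differentiable. Since [1 - z t]
    stays there for [|z| < 1] and [t] in [0, 1], the principal logarithm can be differentiated along
    this segment. *)
Lemma Clog_right a b : 0 < a ->
  Clog (a +i* b) = (ln (a ^+ 2 + b ^+ 2) / 2) +i* atan (b / a).
Proof.
move=> a0.
have d0 : 0 < a ^+ 2 + b ^+ 2 by rewrite ltr_pwDl ?sqr_ge0// exprn_gt0.
have s0 : 0 < Num.sqrt (a ^+ 2 + b ^+ 2) by rewrite sqrtr_gt0.
have E : a / Num.sqrt (a ^+ 2 + b ^+ 2) = cos (atan (b / a)).
  rewrite cos_atan.
  have -> : 1 + (b / a) ^+ 2 = (a ^+ 2 + b ^+ 2) * (a^-1) ^+ 2 by field; rewrite gt_eqF.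
  rewrite sqrtrM ?(ltW d0)// sqrtr_sqr ger0_norm ?invr_ge0 ?(ltW a0)//.
  by rewrite invfM invrK mulrC.
have h1 := atan_ltpi2 (b / a); have h2 := atan_gtNpi2 (b / a).
have p0 := @pi_gt0 R.
have L : ln (Num.sqrt (a ^+ 2 + b ^+ 2)) = ln (a ^+ 2 + b ^+ 2) / 2.
  rewrite -[X in _ = ln X / 2](sqr_sqrtr (ltW d0)) lnXn// mulr2n; lra.
rewrite /Clog /Carg /= L E; congr (_ +i* _).
have [b0|b0] := leP 0 b.
  have t0 : 0 <= atan (b / a) by rewrite -(@atan0 R); apply: (ltW_homo (@lt_atan R)); rewrite divr_ge0// ltW.
  by rewrite cosK// in_itv/= t0; lra.
have t0 : atan (b / a) <= 0.
  by rewrite -(@atan0 R); apply: (ltW_homo (@lt_atan R)); rewrite pmulr_lle0 ?invr_gt0// ltW.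
by rewrite -cosN cosK ?opprK// in_itv/=; lra.
Qed.

Lemma is_derive_half_ln (d : R -> R) d' t : 0 < d t -> is_derive t 1 d d' ->
  is_derive t 1 (fun s => ln (d s) / 2) (d' / (2 * d t)).
Proof.
move=> d0 hd; have h := @is_derive1_comp R (@ln R) d t _ _ (is_derive1_ln d0) hd.
have h2 := is_deriveMr h (is_derive_cst (2^-1 : R) t 1).
apply: (@is_derive_eq _ _ _ _ _ _ _ _ h2).
by rewrite /cst; field; rewrite gt_eqF.
Qed.

Lemma is_derive_affine (c t : R) : is_derive t 1 (fun s => 1 - s * c) (- c).
Proof. by apply: is_derive_eq; rewrite /GRing.scale/=; ring. Qed.

Lemma is_derive_lin (c t : R) : is_derive t 1 (fun s => - (s * c)) (- c).
Proof. by apply: is_derive_eq; rewrite /GRing.scale/=; ring. Qed.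

Lemma is_derive_exprn n t : is_derive t 1 (fun s => s ^+ n) (n%:R * t ^+ n.-1).
Proof.
elim: n => [|n IH].
  rewrite mul0r; apply: is_derive_ext (is_derive_cst (1 : R) t 1) => s.
  by rewrite expr0.
apply: (is_derive_ext (f := fun s => s * s ^+ n)) => [s|]; first by rewrite exprS.
apply: (@is_derive_eq _ _ _ _ _ _ _ _ (is_deriveMr (@is_derive_id _ _ t (1 : R)) IH)).
rewrite mul1r -natr1 mulrDl mul1r addrC /=; congr (_ + _).
by case: n {IH} => [|n] /=; [rewrite !mul0r mulr0|rewrite exprS mulrCA].
Qed.

End ComplexLog.

Section GeometricBound.
Variable R : realType.

Lemma geometric_bound (v : nat -> R) (rho : R) M : 0 < rho -> (forall n, 0 <= v n) ->
  (forall n, (M <= n)%N -> v n.+1 <= rho * v n) ->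
  exists2 K, 0 <= K & forall n, v n <= K * rho ^+ n.
Proof.
move=> r0 v0 h.
have q0 n : 0 < rho ^+ n by rewrite exprn_gt0.
(* The indices up to [M] are covered one by one by the summands; beyond [M] the recursion preserves
   the bound. *)
exists (\sum_(k < M.+1) v k / rho ^+ k).
  by apply: sumr_ge0 => k _; rewrite divr_ge0 ?v0// ltW.
have small n : (n <= M)%N -> v n <= (\sum_(k < M.+1) v k / rho ^+ k) * rho ^+ n.
  move=> nM; rewrite -ler_pdivrMr//.
  rewrite (bigD1 (Ordinal (nM : (n < M.+1)%N)))//= lerDl.
  by apply: sumr_ge0 => k _; rewrite divr_ge0 ?v0// ltW.
elim=> [|n IH]; first exact: small.
have [nM|nM] := leqP n.+1 M; first exact: small.
apply: le_trans (h n nM) _.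
by rewrite exprS mulrCA ler_pM2l.
Qed.

End GeometricBound.

Lemma log_derivative_identity (R : realType) (N : nat) (P X Y : 'M[R[i]]_N) (u v : R)
    (w : R[i]) : GRing.comm P X -> u +i* v = w ->
  u%:C *: (P * X) * Y + X * (v%:C *: ('i *: P * Y)) = w *: (P * (X * Y)).
Proof.
move=> PX <-.
have -> : X * (v%:C *: ('i *: P * Y)) = (v%:C * 'i) *: (P * (X * Y)).
  by rewrite (scaleMl 'i P Y) scalerA scaleMr (mulrA X P Y) -PX -(mulrA P X Y).
rewrite scaleMl -mulrA -scalerDl; congr (_ *: _).
by apply/eqP; rewrite eq_complex /=; apply/andP; split; apply/eqP; ring.
Qed.

(** In use, [E] is [(1 - z t)^P], [S] a partial binomial sum, [S'] its derivative and [w] is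
    [1 - z t]: the derivative of [E S] reduces to the remainder of the differential equation of
    [S]. *)
Lemma binomial_ode_identity (K : fieldType) (N : nat) (P E S S' c : 'M[K]_N) (z w k : K) :
  GRing.comm P E -> w != 0 -> w *: S' - z *: (P * S) = - (k *: c) ->
  (- z / w) *: (P * E) * S + E * S' = - ((w^-1 * k) *: (E * c)).
Proof.
move=> PE w0 h.
have -> : (- z / w) *: (P * E) * S = w^-1 *: (E * (- (z *: (P * S)))).
  by rewrite PE scaleMl mulrN scaleMr scalerN scalerA -scaleNr -mulrA mulNr [z / w]mulrC.
have -> : E * S' = w^-1 *: (E * (w *: S')) by rewrite scaleMr scalerA mulVf// scale1r.
by rewrite -scalerDr -mulrDr addrC h mulrN scalerN scaleMr scalerA.
Qed.

Lemma bsum_ode_identity (K : comPzRingType) (N : nat) (P c : 'M[K]_N) (k s z t : K) (n : nat) :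
  GRing.comm c P -> t * k = n%:R * s ->
  - (k *: c) + ((1 - z * t) *: (k *: c) - z *: (P * (s *: c))) =
  - (s *: (z *: (c * (P + n%:R)))).
Proof.
move=> cP h; rewrite mulrDr cP mulr_natr scaleMr; move: (P * c) => X.
rewrite -scaler_nat !scalerDr !scalerA opprD addrA addrC [z * s]mulrC -!scaleNr -scalerDl.
congr (_ + _); congr (_ *: _).
have -> : - k + (1 - z * t) * k = - (z * (t * k)) by ring.
by rewrite h; ring.
Qed.

Section BinomialSeries.
Variables (R : realType) (N : nat).
Local Notation mat := 'M[R[i]]_N.
Variables (P : mat) (z : R[i]).
Hypothesis z1 : normc z < 1.
Implicit Types (n m : nat) (t : R).

Let x := complex.Re z.
Let y := complex.Im z.
Let r := normc z.

Definition bcoef m : mat := (z ^+ m / m`!%:R) *: mx_pochhammer P m.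
Definition bsum n t : mat := \sum_(0 <= m < n) (t ^+ m)%:C *: bcoef m.

Lemma bcoefS m : m.+1%:R *: bcoef m.+1 = z *: (bcoef m * (P + m%:R)).
Proof.
rewrite /bcoef pochS scaleMl !scalerA; congr (_ *: _).
have f0 : m`!%:R != 0 :> R[i] by rewrite pnatr_eq0 -lt0n fact_gt0.
have m0 : m.+1%:R != 0 :> R[i] by rewrite pnatr_eq0.
rewrite factS natrM exprS.
by move: (m.+1%:R : R[i]) (m`!%:R : R[i]) (z ^+ m) m0 f0 => a b w a0 b0; field; rewrite a0 b0.
Qed.

Lemma normc_nat m : normc (m%:R : R[i]) = m%:R.
Proof. by rewrite -(rmorph_nat (real_complex R)) normc_real ger0_norm. Qed.

Lemma nrm_mulrn (M : mat) m : nrm (M * m%:R) = m%:R * nrm M.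
Proof.
have -> : M * m%:R = (m%:R : R[i]) *: M by rewrite -natr_mx; exact: mul_mx_scalar.
by rewrite nrmZ normc_nat.
Qed.

Lemma nrm_bcoefS m : m.+1%:R * nrm (bcoef m.+1) <= r * (nrm P + m%:R) * nrm (bcoef m).
Proof.
rewrite -(normc_nat m.+1) -(nrmZ m.+1%:R (bcoef m.+1)) bcoefS (nrmZ z).
rewrite -mulrA ler_wpM2l ?normc_ge0// mulrDr; apply: le_trans (nrmD _ _) _.
rewrite nrm_mulrn [leRHS]mulrDl; apply: lerD => //.
by rewrite [leRHS]mulrC nrmM.
Qed.

(** Any ratio strictly between [r = |z|] and 1 would do; the midpoint is taken. *)
Let rho := (1 + r) / 2.

Let r_ge0 : 0 <= r. Proof. exact: normc_ge0. Qed.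
Let rho0 : 0 < rho. Proof. by rewrite /rho; have := r_ge0; lra. Qed.
Let rho1 : rho < 1. Proof. by rewrite /rho /r; move: z1; lra. Qed.
Let r_rho : r < rho. Proof. by rewrite /rho /r; move: z1; lra. Qed.

(** The weighted bound is needed because the remainder in [bsum_ode] is [n t^(n - 1)] times a
    coefficient. The threshold [M] in the proof is where [r (nrm P + n) <= rho n] starts to hold. *)
Lemma bcoef_bound : exists2 K, 0 <= K &
  forall n, nrm (bcoef n) <= K * rho ^+ n /\ n%:R * nrm (bcoef n) <= K * rho ^+ n.
Proof.
pose v n := n%:R * nrm (bcoef n).
have v0 n : 0 <= v n by rewrite mulr_ge0// nrm_ge0.
pose M := (Num.truncn (r * nrm P / (rho - r))).+1.
have [n Mn|K K0 hK] := @geometric_bound R v rho M rho0 v0.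
  apply: le_trans (nrm_bcoefS n) _; rewrite /v mulrA; apply: ler_wpM2r; first exact: nrm_ge0.
  have d0 : 0 < rho - r by rewrite subr_gt0.
  have : r * nrm P / (rho - r) <= n%:R.
    apply: ltW; apply: lt_le_trans (truncnS_gt _) _.
    by rewrite ler_nat.
  rewrite ler_pdivrMr// mulrBr => h; lra.
exists (nrm (bcoef 0) + K); first by rewrite addr_ge0// nrm_ge0.
have q0 n : 0 <= rho ^+ n by rewrite exprn_ge0// ltW.
move=> n; split; last first.
  by apply: le_trans (hK n) _; rewrite ler_wpM2r// lerDr nrm_ge0.
case: n => [|n]; first by rewrite expr0 mulr1 lerDl.
apply: (@le_trans _ _ (v n.+1)).
  by rewrite /v ler_peMl ?nrm_ge0// ler1n.
by apply: le_trans (hK n.+1) _; rewrite ler_wpM2r// lerDr nrm_ge0.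
Qed.

Lemma bsum_bound : exists2 K, 0 <= K & forall n t, 0 <= t <= 1 -> nrm (bsum n t) <= K.
Proof.
have [K K0 hK] := bcoef_bound.
have d0 : 0 < 1 - rho by rewrite subr_gt0.
exists (K / (1 - rho)); first by rewrite divr_ge0// ltW.
move=> n t /andP[t0 t1]; apply: le_trans (nrm_sum _ _) _.
apply: (@le_trans _ _ (\sum_(0 <= m < n) K * rho ^+ m)).
  apply: ler_sum => m _; rewrite nrmZr ?exprn_ge0//.
  by apply: le_trans (hK m).1; rewrite ler_piMl ?nrm_ge0// exprn_ile1.
rewrite -mulr_sumr ler_wpM2l// -[leRHS]mul1r ler_pdivlMr//.
have -> : (\sum_(0 <= m < n) rho ^+ m) * (1 - rho) = 1 - rho ^+ n.
  elim: n => [|n IH]; first by rewrite big_geq// mul0r expr0 subrr.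
  by rewrite big_nat_recr//= mulrDl IH exprSr; ring.
by rewrite gerBl exprn_ge0// ltW.
Qed.

(** Real part [a] and imaginary part [b] of [1 - z t], its squared modulus [d], and the real and
    imaginary parts [lr], [li] of its logarithm. *)
Let a t := 1 - t * x.
Let b t := - (t * y).
Let d t := a t ^+ 2 + b t ^+ 2.
Let lr t := ln (d t) / 2.
Let li t := atan (b t / a t).

Lemma one_sub_zt t : 1 - z * t%:C = a t +i* b t.
Proof.
rewrite /a /b /x /y; case: z => p q.
by apply/eqP; rewrite eq_complex /=; apply/andP; split; apply/eqP; ring.
Qed.

Lemma a_gt0 t : 0 <= t <= 1 -> 1 - r <= a t.
Proof.
move=> /andP[t0 t1]; have := Re_le_normc z; rewrite -/x -/r => xr.
rewrite /a lerD2l lerN2; apply: le_trans (ler_norm _) _; rewrite normrM (ger0_norm t0).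
by apply: le_trans xr; rewrite ler_piMl.
Qed.

Let r1 : 0 < 1 - r. Proof. by rewrite subr_gt0. Qed.

Lemma d_bounds t : 0 <= t <= 1 -> (1 - r) ^+ 2 <= d t <= 2 ^+ 3.
Proof.
move=> t01; have at0 := a_gt0 t01; have /andP[t0 t1] := t01.
have hx : `|t * x| <= 1.
  rewrite normrM (ger0_norm t0) -[leRHS]mulr1; apply: ler_pM => //.
  by apply: le_trans (Re_le_normc z) _; exact: ltW.
have hy : `|t * y| <= 1.
  rewrite normrM (ger0_norm t0) -[leRHS]mulr1; apply: ler_pM => //.
  by apply: le_trans (Im_le_normc z) _; exact: ltW.
apply/andP; split.
  apply: (@le_trans _ _ (a t ^+ 2)); last by rewrite lerDl sqr_ge0.
  by rewrite lerXn2r ?nnegrE ?(ltW r1)// (le_trans (ltW r1)).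
move: hx hy; rewrite !ler_norml => /andP[x1 x2] /andP[y1 y2].
rewrite /d /a /b; move: (t * x) (t * y) x1 x2 y1 y2 => p q x1 x2 y1 y2.
have h1 : (1 - p) ^+ 2 <= 2 ^+ 2.
  by rewrite ler_sqr ?nnegrE; lra.
have h2 : (- q) ^+ 2 <= 1.
  have hq : 0 <= (1 - q) * (1 + q) by apply: mulr_ge0; lra.
  have -> : (- q) ^+ 2 = 1 - (1 - q) * (1 + q) by ring.
  lra.
have -> : 2 ^+ 3 = 8 :> R by ring.
have e : 2 ^+ 2 = 4 :> R by ring.
rewrite e in h1; lra.
Qed.

(* [(1 - z t)^P] for [t] in [0, 1]. *)
Definition blog t : mat := mx_exp ((lr t)%:C *: P + (li t)%:C *: ('i *: P)).

Lemma mx_cpow_blog t (A : mat) : 0 <= t <= 1 ->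
  mx_cpow (1 - z * t%:C) A = mx_exp ((lr t)%:C *: A + (li t)%:C *: ('i *: A)).
Proof.
move=> t01; rewrite /mx_cpow one_sub_zt Clog_right; last exact: lt_le_trans (a_gt0 t01).
suff -> : (ln (a t ^+ 2 + b t ^+ 2) / 2 +i* atan (b t / a t)) =
    (lr t)%:C + (li t)%:C * 'i by rewrite scalerDl -scalerA.
by apply/eqP; rewrite eq_complex /lr /d /li /=; apply/andP; split; apply/eqP; ring.
Qed.

Lemma blogV t : 0 <= t <= 1 -> mx_cpow (1 - z * t%:C) (- P) * blog t = 1.
Proof.
move=> t01; rewrite (mx_cpow_blog _ t01) /blog.
have -> : (lr t)%:C *: - P + (li t)%:C *: ('i *: - P) =
   - ((lr t)%:C *: P + (li t)%:C *: ('i *: P)) by rewrite !scalerN opprD.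
have := mx_expN (- ((lr t)%:C *: P + (li t)%:C *: ('i *: P))).
by rewrite opprK.
Qed.

Lemma blog_bound : exists2 K : R, 0 <= K & forall t, 0 <= t <= 1 -> nrm (blog t) <= K.
Proof.
pose L := `|ln ((1 - r) ^+ 2)| + `|ln (2 ^+ 3 : R)| + pi.
exists (nrm (1 : mat) * expR (L * nrm P + L * nrm ('i *: P))).
  by rewrite mulr_ge0 ?nrm_ge0 ?expR_ge0.
move=> t t01; apply: le_trans (nrm_mx_exp _) _; rewrite ler_wpM2l ?nrm_ge0// ler_expR.
apply: le_trans (nrmD _ _) _; rewrite !nrmZ !normc_real.
have /andP[h1 h2] := d_bounds t01.
have q0 : 0 < (1 - r) ^+ 2 by rewrite exprn_gt0.
have d0 : 0 < d t by exact: lt_le_trans h1.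
have l1 : ln ((1 - r) ^+ 2) <= ln (d t) by rewrite ler_ln ?posrE.
have l2 : ln (d t) <= ln (2 ^+ 3) by rewrite ler_ln ?posrE// exprn_gt0.
have p0 := @pi_gt0 R.
have n1 := ler_norm (ln (2 ^+ 3 : R)).
have n2 : - `|ln ((1 - r) ^+ 2)| <= ln ((1 - r) ^+ 2) by rewrite lerNl ler_normr lexx orbT.
have n3 := normr_ge0 (ln (2 ^+ 3 : R)).
have n4 := normr_ge0 (ln ((1 - r) ^+ 2)).
have b1 : `|lr t| <= L by rewrite /L /lr ler_norml; apply/andP; split; lra.
have b2 : `|li t| <= L.
  have h3 := atan_ltpi2 (b t / a t); have h4 := atan_gtNpi2 (b t / a t).
  by rewrite /L /li ler_norml; apply/andP; split; lra.
by apply: lerD; apply: ler_wpM2r => //; rewrite ?mulr_ge0 ?normc_ge0 ?nrm_ge0.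
Qed.

(** The chain rule is applied to [lr] and [li] separately, the exponential being split into two
    commuting factors; the two real derivatives recombine into [- z / (1 - z t)]. *)
Lemma mderiv_blog t : 0 <= t <= 1 ->
  mderiv blog t ((- z / (1 - z * t%:C)) *: (P * blog t)).
Proof.
move=> t01; have at0 : 0 < a t by exact: lt_le_trans (a_gt0 t01).
have d0 : 0 < d t by rewrite /d ltr_pwDl ?sqr_ge0// exprn_gt0.
have da : is_derive t 1 a (- x) by exact: is_derive_affine.
have db : is_derive t 1 b (- y) by exact: is_derive_lin.
have dd : is_derive t 1 d (2 * (a t * - x + b t * - y)).
  apply: (is_derive_ext (f := fun s => a s * a s + b s * b s)) => [s|].
    by rewrite /d !expr2.
  apply: (@is_derive_eq _ _ _ _ _ _ _ _ (is_deriveD (is_deriveMr da da) (is_deriveMr db db))).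
  by ring.
have dlr := is_derive_half_ln d0 dd.
have dq : is_derive t 1 (fun s => b s / a s) ((- y * a t + b t * x) / a t ^+ 2).
  have dv := @is_deriveV _ a t _ _ (lt0r_neq0 at0) da.
  apply: (@is_derive_eq _ _ _ _ _ _ _ _ (is_deriveMr db dv)).
  by rewrite /GRing.scale/=; field; rewrite gt_eqF.
have dli := @is_derive1_comp R (@atan R) (fun s => b s / a s) t _ _ (is_derive1_atan _) dq.
have iP : GRing.comm P ('i *: P) by apply: commZ.
have cXY s : GRing.comm ((lr s)%:C *: P) ((li s)%:C *: ('i *: P)).
  by apply/commZ/commr_sym/commZ/commr_sym.
have d1 := mderiv_exp_comp P dlr.
have d2 := mderiv_exp_comp ('i *: P) dli.
have cP : GRing.comm P (mx_exp ((lr t)%:C *: P)) by apply/comm_mx_exp/commZ.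
apply: (@mderiv_ext _ _ (fun s => mx_exp ((lr s)%:C *: P) * mx_exp ((li s)%:C *: ('i *: P)))).
  by move=> s; rewrite /blog (mx_expD (cXY s)).
rewrite /blog (mx_expD (cXY t)).
apply: mderiv_eq (mderivM d1 d2) _.
move: (mx_exp ((lr t)%:C *: P)) (mx_exp ((li t)%:C *: ('i *: P))) cP => X Y cP.
apply: log_derivative_identity cP _.
rewrite one_sub_zt; move: at0 d0; rewrite /d.
have -> : z = x +i* y by rewrite /x /y; case: z.
move: (a t) (b t) => p q p0 d0.
have pq0 : p +i* q != 0 by rewrite eq_complex /= gt_eqF.
apply: (canRL (mulfK pq0)).
apply/eqP; rewrite eq_complex /=; apply/andP; split; apply/eqP; field; rewrite ?gt_eqF//.
Qed.

Definition dbsum n t : mat := \sum_(0 <= m < n) (m%:R * t ^+ m.-1)%:C *: bcoef m.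

Lemma mderiv_bsum n t : mderiv (bsum n) t (dbsum n t).
Proof.
elim: n => [|n IH].
  rewrite /dbsum big_geq//; apply: mderiv_ext (mderiv_cst 0 t) => s.
  by rewrite /bsum big_geq.
rewrite /dbsum big_nat_recr//= -/(dbsum n t).
apply: (@mderiv_ext _ _ (fun s => bsum n s + (s ^+ n)%:C *: bcoef n)).
  by move=> s; rewrite /bsum big_nat_recr.
have dX := is_derive_exprn n t.
apply: mderivD IH _.
by apply: mderiv_eq (mderivZ dX (mderiv_cst (bcoef n) t)) _; rewrite scaler0 addr0.
Qed.

Lemma bsumS n t : bsum n.+1 t = bsum n t + (t ^+ n)%:C *: bcoef n.
Proof. by rewrite /bsum big_nat_recr. Qed.

Lemma dbsumS n t : dbsum n.+1 t = dbsum n t + (n%:R * t ^+ n.-1)%:C *: bcoef n.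
Proof. by rewrite /dbsum big_nat_recr. Qed.

(** Partial sums satisfy the differential equation of [(1 - z t)^(- P)] up to the derivative of the
    first omitted term. *)
Lemma bsum_ode n t :
  (1 - z * t%:C) *: dbsum n t - z *: (P * bsum n t) = - ((n%:R * t ^+ n.-1)%:C *: bcoef n).
Proof.
elim: n => [|n IH].
  by rewrite /dbsum /bsum !big_geq// mulr0 !scaler0 subrr mul0r rmorph0 scale0r oppr0.
rewrite (dbsumS n t) (bsumS n t).
rewrite mulrDr !scalerDr opprD addrACA IH /=.
have -> : (n.+1%:R * t ^+ n)%:C *: bcoef n.+1 = (t ^+ n)%:C *: (z *: (bcoef n * (P + n%:R))).
  rewrite -bcoefS (scalerA (t ^+ n)%:C _ (bcoef n.+1)).
  by rewrite -[in RHS](rmorph_nat (real_complex R)) -rmorphM mulrC.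
apply: bsum_ode_identity.
  by apply/commr_sym; rewrite /bcoef; exact/commZ/comm_poch.
rewrite rmorphM rmorph_nat.
case: n {IH} => [|n] /=; first by rewrite !mul0r mulr0.
by rewrite exprS rmorphM mulrCA.
Qed.

Lemma nrm_blog_bsum : exists2 K : R, 0 <= K & forall n t, 0 <= t <= 1 ->
  nrm (blog t * bsum n.+1 t - 1) <= K * rho ^+ n.+1.
Proof.
have [B B0 hB] := blog_bound; have [K K0 hK] := bcoef_bound.
pose D := #|{: bool * ('I_N * 'I_N)}|%:R : R.
have D0 : 0 <= D by [].
(* [D] comes from [mderiv_ineq], [B] bounds [blog], [K] the weighted coefficients, and [1 - r]
   bounds [|1 - z t|] from below. *)
exists (D * (B * K / (1 - r))).
  by rewrite mulr_ge0// divr_ge0 ?mulr_ge0// ltW.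
move=> n t t01; have /andP[t0 t1] := t01.
pose F s := blog s * bsum n.+1 s.
pose F' s := - (((1 - z * s%:C)^-1 * (n.+1%:R * s ^+ n)%:C) *: (blog s * bcoef n.+1)).
have dF s : 0 <= s <= 1 -> mderiv F s (F' s).
  move=> s01; apply: mderiv_eq (mderivM (mderiv_blog s01) (mderiv_bsum n.+1 s)) _.
  have cP : GRing.comm P (blog s).
    by apply: comm_mx_exp; apply: commrD; apply: commZ => //; exact: commZ.
  have w0 : 1 - z * s%:C != 0.
    rewrite one_sub_zt eq_complex /= gt_eqF//; exact: lt_le_trans (a_gt0 s01).
  have ode := bsum_ode n.+1 s.
  rewrite /F' /=.
  exact: binomial_ode_identity cP w0 ode.
(* Here the index [n.+1] matters: the sum must contain the constant term, since the empty sum is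
   0. *)
have F0 : F 0 = 1.
  have l0 : lr 0 = 0 by rewrite /lr /d /a /b !mul0r subr0 oppr0 expr1n expr0n addr0 ln1 mul0r.
  have i0 : li 0 = 0 by rewrite /li /b mul0r oppr0 mul0r atan0.
  rewrite /F /blog l0 i0 !rmorph0 !scale0r addr0 mx_exp0 mul1r /bsum big_nat_recl//.
  rewrite big1 ?addr0 => [|m _]; last by rewrite expr0n rmorph0 scale0r.
  by rewrite expr0 rmorph1 scale1r /bcoef poch0 expr0 fact0 divr1 scale1r.
have := @mderiv_ineq R N F F' (fun s => B * K / (1 - r) * rho ^+ n.+1 * s)
  (fun=> B * K / (1 - r) * rho ^+ n.+1) 0 t t0.
have c0 : 0 <= B * K / (1 - r) * rho ^+ n.+1.
  by rewrite mulr_ge0 ?exprn_ge0 ?(ltW rho0)// divr_ge0 ?mulr_ge0// ltW.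
rewrite F0 mulr0 subr0 => h; apply: le_trans (h _ _ _) _.
- by move=> s /andP[s0 st]; apply: dF; rewrite s0 (le_trans st).
- by move=> s _; apply: is_derive_eq; rewrite /GRing.scale/=; ring.
- move=> s /andP[s0 st]; have s01 : 0 <= s <= 1 by rewrite s0 (le_trans st).
  rewrite /F' nrmN nrmZ normcM normc_real ComplexField.Normc.normcV.
  have hz : 1 - r <= normc (1 - z * s%:C).
    apply: le_trans (a_gt0 s01) _; rewrite one_sub_zt.
    by apply: le_trans (ler_norm _) _; exact: (Re_le_normc (a s +i* b s)).
  have hz0 := lt_le_trans r1 hz.
  have hv : (normc (1 - z * s%:C))^-1 <= (1 - r)^-1 by rewrite lef_pV2 ?posrE.
  have sn : 0 <= s ^+ n <= 1 by rewrite exprn_ge0// exprn_ile1//; case/andP: s01.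
  have hs : `|n.+1%:R * s ^+ n| <= n.+1%:R :> R.
    case/andP: sn => sn0 sn1; rewrite ger0_norm ?mulr_ge0//.
    by rewrite ler_piMr.
  have hb := nrmM (blog s) (bcoef n.+1).
  have hc := (hK n.+1).2.
  apply: (@le_trans _ _ ((1 - r)^-1 * n.+1%:R * (B * nrm (bcoef n.+1)))).
    apply: ler_pM.
    + by rewrite mulr_ge0 ?invr_ge0 ?(ltW hz0).
    + exact: nrm_ge0.
    + by apply: ler_pM => //; rewrite invr_ge0 ltW.
    + by apply: le_trans hb _; rewrite ler_wpM2r ?nrm_ge0// hB.
  have -> : (1 - r)^-1 * n.+1%:R * (B * nrm (bcoef n.+1)) =
    B / (1 - r) * (n.+1%:R * nrm (bcoef n.+1)) by ring.
  have -> : B * K / (1 - r) * rho ^+ n.+1 = B / (1 - r) * (K * rho ^+ n.+1) by ring.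
  by rewrite ler_wpM2l// divr_ge0// ltW.
- rewrite -/D -!mulrA ler_wpM2l// !mulrA ler_piMr//.
Qed.

Lemma binomial_series_cvg t : 0 <= t <= 1 ->
  mcvg (fun n => bsum n t) (mx_cpow (1 - z * t%:C) (- P)).
Proof.
move=> t01; have [K K0 hK] := nrm_blog_bsum.
have h : mcvg (fun n => blog t * bsum n.+1 t) 1.
  apply: mcvg_nrm0; apply: (@squeeze_cvgr _ _ _ _ (fun=> 0) (fun n => K * rho ^+ n.+1)).
  - by apply: nearW => n; rewrite nrm_ge0 hK.
  - exact: cvg_cst.
  - suff : (fun n => K * rho ^+ n.+1) @ \oo --> K * 0 by rewrite mulr0.
    apply: cvgM; first exact: cvg_cst.
    have := @cvg_expr R rho; rewrite ger0_norm ?(ltW rho0)// => /(_ rho1).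
    by rewrite -(cvg_shiftn 1); under eq_fun do rewrite addn1.
have inv := blogV t01; move: (mx_cpow _ _) inv => X inv.
have h' : mcvg (fun n => X * (blog t * bsum n.+1 t)) (X * 1) by exact: mcvgM (mcvg_cst X) h.
have h2 : mcvg (fun n => bsum n.+1 t) X.
  by move: h'; rewrite mulr1; apply: mcvg_ext => n; rewrite mulrA inv mul1r.
by move=> k; rewrite -(cvg_shiftn 1); under eq_fun do rewrite addn1; exact: h2.
Qed.

End BinomialSeries.

(** * Euler's integral *)

Section Duplication.
Variables (R : realType) (N : nat).
Local Notation mat := 'M[R[i]]_N.
Implicit Types (A B M : mat) (m n : nat).

Lemma comm_invmx A B : GRing.comm A B -> GRing.comm A (invmx B).
Proof.
(* On a singular matrix [invmx] returns its argument, so the commutation holds there as well. *)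
move=> AB; have [uB|nB] := boolP (B \in unitmx); last by rewrite /invmx (negbTE nB).
apply: (can_inj (mulKmx uB)); rewrite /GRing.comm.
have e : B *m (A * invmx B) = A by rewrite mulmxA [B *m A](esym AB) mulmxK.
have e' : B *m (invmx B * A) = A by rewrite mulKVmx.
by rewrite e e'.
Qed.

Lemma natr_scalar m : (m%:R : mat) = (m%:R : R[i]) *: (1 : mat).
Proof. by rewrite -natr_mx scalemx1. Qed.

Lemma half_add A m : 2^-1 *: A + m%:R = 2^-1 *: (A + m.*2%:R).
Proof.
rewrite scalerDr; congr (_ + _); rewrite !natr_scalar scalerA; congr (_ *: _).
by rewrite -mul2n natrM mulKf// pnatr_eq0.
Qed.

(** The factors of [(A)_(2m)] split by the parity of the shift, each of the [2m] halved factors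
    contributing [1/2]. *)
Lemma poch_duplication A m :
  mx_pochhammer (2^-1 *: A) m * mx_pochhammer (2^-1 *: (A + 1)) m =
  (4^-1 ^+ m) *: mx_pochhammer A m.*2.
Proof.
elim: m => [|m IH]; first by rewrite !poch0 expr0 scale1r mulr1.
rewrite doubleS !pochS !half_add !scaleMr.
have c : GRing.comm (A + m.*2%:R) (mx_pochhammer (2^-1 *: (A + 1)) m).
  apply/comm_poch/commZ/(commrD_nat 1)/commr_sym/commrD_nat; exact: erefl.
have e : A + 1 + m.*2%:R = A + m.*2.+1%:R by rewrite -addrA nat1r.
rewrite e; move: (mx_pochhammer (2^-1 *: A) m) (mx_pochhammer (2^-1 *: (A + 1)) m)
  (mx_pochhammer A m.*2) (A + m.*2%:R) (A + m.*2.+1%:R) IH c => X Y Z U V IH c.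
rewrite scaleMl scalerA !mulrA -(mulrA X U Y) c mulrA IH !scaleMl scalerA; congr (_ *: _).
by rewrite exprSr -invfM -natrM mulrC.
Qed.

Lemma bfun_addn A B u m : 0 < u -> bfun (A + m%:R) B u = (u ^+ m)%:C *: bfun A B u.
Proof.
by move=> u0; rewrite /bfun addrAC -natr_mx (pw_addn _ _ u0) scaleMl.
Qed.

End Duplication.

Lemma euler_term_identity (T : pzRingType) (b b' c X Y D : T) :
  X * b = D * b' -> Y * D = 1 -> GRing.comm X Y -> GRing.comm b c ->
  GRing.comm b X -> GRing.comm b Y -> b * (c * X * Y) = c * b'.
Proof.
move=> h YD XY bc bX bY.
rewrite -(mulrA c X Y) (mulrA b c) bc -(mulrA c b) (mulrA b X Y) bX -(mulrA X b Y) bY.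
by rewrite (mulrA X Y b) XY -(mulrA Y X b) h (mulrA Y D) YD mul1r.
Qed.

Lemma mul_inverses (T : pzRingType) (Z Z' D D' : T) :
  Z * D = 1 -> Z' * D' = 1 -> GRing.comm Z' D -> Z * Z' * (D * D') = 1.
Proof.
by move=> e1 e2 c; rewrite -mulrA (mulrA Z' D D') c -(mulrA D Z' D') e2 mulr1.
Qed.

Section Euler.
Variables (R : realType) (N : nat).
Local Notation mat := 'M[R[i]]_N.
Variables (P Q S : mat) (z : R[i]).
Hypotheses (PQ : GRing.comm P Q) (PS : GRing.comm P S) (QS : GRing.comm Q S).
Hypotheses (hQ : positive_stable Q) (hS : positive_stable S) (hT : positive_stable (S - Q)).
Hypothesis z1 : normc z < 1.

Let T := S - Q.
Let Ps := [:: P; 2^-1 *: Q; 2^-1 *: (Q + 1)].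
Let Qs := [:: 2^-1 *: S; 2^-1 *: (S + 1)].
Let b := mbeta Q T.

Let QT : GRing.comm Q T. Proof. by apply: commrB QS (commr_refl Q). Qed.
Let PT : GRing.comm P T. Proof. exact: commrB. Qed.
Let QTS : Q + T = S. Proof. by rewrite /T addrC subrK. Qed.

Lemma half_unit A m : positive_stable A -> 2^-1 *: A + m%:R%:M \in @unitmx R[i] N.
Proof.
move=> hA; rewrite natr_mx half_add.
have u := stable_addn_unit m.*2 hA; rewrite natr_mx in u.
by rewrite unitmxZ// unitfE invr_eq0 pnatr_eq0.
Qed.

Let hS1 : positive_stable (S + 1). Proof. exact: (positive_stableS 1). Qed.

Lemma euler_term m : b * pFq_term Ps Qs z m = bcoef P z m * mbeta (Q + m.*2%:R) T.
Proof.
have -> : pFq_term Ps Qs z m = bcoef P z m *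
    (mx_pochhammer (2^-1 *: Q) m * mx_pochhammer (2^-1 *: (Q + 1)) m) *
    (invmx (mx_pochhammer (2^-1 *: S) m) * invmx (mx_pochhammer (2^-1 *: (S + 1)) m)).
  by rewrite /pFq_term /Ps /Qs !big_cons !big_nil !mulr1 /bcoef -!scaleMl -!mulrA.
have QS1 : GRing.comm Q (S + 1) by exact: (commrD_nat 1).
have cb M : GRing.comm M Q -> GRing.comm M T -> GRing.comm b M.
  by move=> MQ MT; apply/commr_sym; exact: (comm_mbeta hQ hT MQ MT).
have bQ : GRing.comm b Q := cb Q (commr_refl Q) QT.
have bT : GRing.comm b T := cb T (commr_sym QT) (commr_refl T).
have bS : GRing.comm b S by rewrite -QTS; exact: commrD.
have bP : GRing.comm b P := cb P PQ PT.
have bQ1 : GRing.comm b (Q + 1) := commrD_nat 1 bQ.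
have bS1 : GRing.comm b (S + 1) := commrD_nat 1 bS.
apply: (@euler_term_identity _ b _ _ _ _
  (mx_pochhammer (2^-1 *: S) m * mx_pochhammer (2^-1 *: (S + 1)) m)).
(* The powers of [4^-1] from numerator and denominator cancel, leaving
   [(Q)_(2m) B(Q, T) = (S)_(2m) B(Q + 2m, T)], an instance of [mbeta_pochl]. *)
- rewrite !poch_duplication !scaleMl; congr (_ *: _).
  by have := mbeta_pochl m.*2 QT hQ hT; rewrite QTS => ->.
- have u1 : mx_pochhammer (2^-1 *: S) m \in unitmx by apply: poch_unit => k; exact: half_unit.
  have u2 : mx_pochhammer (2^-1 *: (S + 1)) m \in unitmx by apply: poch_unit => k; exact: half_unit.
  have c : GRing.comm (invmx (mx_pochhammer (2^-1 *: (S + 1)) m)) (mx_pochhammer (2^-1 *: S) m).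
    apply/commr_sym/comm_invmx/comm_poch/commZ/(commrD_nat 1)/commr_sym/comm_poch/commZ.
    exact: erefl.
  exact: (@mul_inverses _ _ _ _ _ (mulVmx u1) (mulVmx u2) c).
- have cQ X : GRing.comm Q X -> GRing.comm
      (mx_pochhammer (2^-1 *: Q) m * mx_pochhammer (2^-1 *: (Q + 1)) m) X.
    move=> QX; apply/commr_sym; apply: commrM; apply/comm_poch/commZ; first exact: commr_sym.
    by apply: (commrD_nat 1); exact: commr_sym.
  by apply: cQ; apply: commrM; apply/comm_invmx/comm_poch/commZ; assumption.
- by rewrite /bcoef; exact/commZ/comm_poch.
- by apply: commrM; apply/comm_poch/commZ; assumption.
- by apply: commrM; apply/comm_invmx/comm_poch/commZ; assumption.
Qed.

Let mI01 : measurable (`]0, 1[%classic : set (measurableTypeR R)).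
Proof. exact: measurable_itv. Qed.

Let Fn n u : mat := bsum P z n (u ^+ 2) * bfun Q T u.

Lemma Fn_sum n u : 0 < u ->
  Fn n u = \sum_(0 <= m < n) bcoef P z m * bfun (Q + m.*2%:R) T u.
Proof.
move=> u0; rewrite /Fn /bsum mulr_suml; apply: eq_bigr => m _.
by rewrite (bfun_addn _ _ _ u0) scaleMl scaleMr -exprM mul2n.
Qed.

Lemma Fn_integral n : mx_integrable `]0, 1[ (Fn n) /\
  mx_integral `]0, 1[ (Fn n) = b * series (pFq_term Ps Qs z) n.
Proof.
have im m : mx_integrable `]0, 1[ (fun u => bcoef P z m * bfun (Q + m.*2%:R) T u) /\
    mx_integral `]0, 1[ (fun u => bcoef P z m * bfun (Q + m.*2%:R) T u) =
    b * pFq_term Ps Qs z m.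
  have hQm : positive_stable (Q + m.*2%:R) by exact: positive_stableS.
  rewrite euler_term mbetaE; exact: mx_integralMl mI01 (bfun_integrable hQm hT).
have [i E] := mx_integral_sum n mI01 (fun m => (im m).1).
split.
  apply: eq_mx_integrable mI01 _ i => u /itv01P[u0 _].
  by rewrite (Fn_sum n u0).
rewrite /series /= mulr_sumr -(eq_bigr _ (fun m _ => (im m).2)) -E.
by apply: eq_mx_integral => u /itv01P[u0 _]; rewrite (Fn_sum n u0).
Qed.

Let F (u : R) : mat := mx_cpow u%:C (Q - 1%:M) *m mx_cpow (1 - u)%:C (S - Q - 1%:M)
  *m mx_cpow (1 - z * u%:C ^+ 2) (- P).

Lemma FE u : `]0, 1[%classic u -> F u = mx_cpow (1 - z * (u ^+ 2)%:C) (- P) * bfun Q T u.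
Proof.
move=> /itv01P[u0 v0]; rewrite /F (mx_cpow_real _ u0) (mx_cpow_real _ v0) rmorphXn.
apply: commr_sym; apply: comm_bfun; apply/commr_sym/comm_mx_exp/commZ/commrN/commr_sym => //.
Qed.

(** By [Fn_integral] the truncated integrals are exactly the partial sums times [b]. The majorant is
    the beta one times the uniform bound on the partial binomial sums. *)
Lemma euler_limit : mx_integrable `]0, 1[ F /\
  mcvg (fun n => b * series (pFq_term Ps Qs z) n) (mx_integral `]0, 1[ F).
Proof.
have [g gi gP] := nrm_beta_dom hQ hT.
have [K K0 hK] := bsum_bound P z1.
have sq (u : R) : `]0, 1[%classic u -> 0 <= u ^+ 2 <= 1.
  by rewrite /= in_itv/= => /andP[u0 u1]; rewrite sqr_ge0 exprn_ile1 ?ltW.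
have mFn n : mmeas `]0, 1[ (Fn n).
  apply: mcont_meas (exhausts_itv01 R) _ => u u01.
  apply: mcontM; last exact: mcont_bfun.
  have := mderiv_comp (g := fun u => u ^+ 2) (mderiv_bsum P z n (u ^+ 2)) (is_derive_exprn 2 u).
  exact: mderiv_cont.
have cv u : `]0, 1[%classic u -> mcvg (fun n => Fn n u) (F u).
  move=> u01; rewrite (FE u01).
  have h := @binomial_series_cvg R N P z z1 _ (sq u u01).
  exact: (mcvgM h (mcvg_cst (bfun Q T u))).
have mF : mmeas `]0, 1[ F.
  move=> k; apply: (@measurable_fun_cvg _ _ _ _ (fun n u => co k (Fn n u))).
    by move=> n; exact: mFn.
  by move=> u u01; exact: cv.
have hb n u : `]0, 1[%classic u -> nrm (Fn n u) <= K * g u.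
  move=> u01; apply: le_trans (nrmM _ _) _; apply: ler_pM; rewrite ?nrm_ge0//.
    by apply: hK; exact: sq.
  by apply: le_trans (nrmM _ _) _; apply: gP; move: u01; rewrite /= in_itv.
have [iF lim] := mx_dominated mI01 mFn mF cv hb (integrable_real_Zl K mI01 gi).
by split => //; apply: mcvg_ext lim => n; rewrite (Fn_integral n).2.
Qed.

End Euler.

Arguments euler_limit {R N P Q S z}.

(* [R : realType] is the field of real numbers; the matrix called R in the
   informal statement is [S] here. *)
Theorem theorem2p1 (R : realType) (N : nat) (P Q S : 'M[R[i]]_N)
    (hPQ : comm_mx P Q) (hPS : comm_mx P S) (hQS : comm_mx Q S)
    (hQ : positive_stable Q) (hS : positive_stable S)
    (hSQ : positive_stable (S - Q))
    (z : R[i]) (hz : `|z| < 1) :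
  let Ps := [:: P; 2^-1 *: Q; 2^-1 *: (Q + 1%:M)] in
  let Qs := [:: 2^-1 *: S; 2^-1 *: (S + 1%:M)] in
  let F (u : R) := mx_cpow u%:C (Q - 1%:M)
                   *m mx_cpow (1 - u)%:C (S - Q - 1%:M)
                   *m mx_cpow (1 - z * u%:C ^+ 2) (- P) in
  [/\ (* both sides are meaningful *)
      [/\ mx_integrable `]0, +oo[ (Gamma_integrand S),
          mx_integrable `]0, +oo[ (Gamma_integrand Q) &
          mx_integrable `]0, +oo[ (Gamma_integrand (S - Q))],
      mx_Gamma Q \in unitmx /\ mx_Gamma (S - Q) \in unitmx,
      pFq_defined Ps Qs z,
      mx_integrable `]0, 1[ F &
      pFq Ps Qs z =
        mx_Gamma S *m invmx (mx_Gamma Q) *m invmx (mx_Gamma (S - Q))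
          *m mx_integral `]0, 1[ F].
Proof.
have z1 : normc z < 1.
  by move: hz; rewrite [`|z|]/(normc z)%:C -(rmorph1 (real_complex R)) ltcR.
move=> Ps Qs F.
have QT : GRing.comm Q (S - Q) := commrB hQS (commr_refl Q).
have hQT : positive_stable (Q + (S - Q)) by rewrite addrC subrK.
have uQ := Gamma_unit hQ; have uS := Gamma_unit hS; have uT := Gamma_unit hSQ.
have bG := mbeta_Gamma QT hQ hSQ hQT.
rewrite [Q + _]addrC subrK in bG.
have [iF lim] := euler_limit hPQ hPS hQS hQ hS hSQ z1.
(* The product with [mx_Gamma S] is a product of two invertible gamma matrices, so each of its
   factors is invertible. *)
have ub : mbeta Q (S - Q) \in unitmx.
  have : mbeta Q (S - Q) * mx_Gamma S \in unitmx by rewrite bG; exact: mulmx_unit.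
  by rewrite [_ * _]/(_ *m _) unitmx_mul => /andP[].
have cvg : mcvg (series (pFq_term Ps Qs z))
    (invmx (mbeta Q (S - Q)) * mx_integral `]0, 1[ F).
  apply: mcvg_ext (mcvgM (mcvg_cst (invmx (mbeta Q (S - Q)))) lim) => n.
  exact: mulKmx.
have [cs sE] := mx_series_cvgP cvg.
split.
- have h A (hA : positive_stable A) : mx_integrable `]0, +oo[ (Gamma_integrand A) :=
    (gamma_limit (commr1 A) hA (@positive_stable1 R N)).1.
  by split; apply: h.
- exact: (conj uQ uT).
- split; last exact: cs.
  move=> X; rewrite !inE => /orP[/eqP ->|/eqP ->] m.
    exact: half_unit.
  exact: (half_unit m (positive_stableS 1 hS)).
- exact: iF.
rewrite /pFq sE; congr (_ *m _).
(* After multiplication by the beta matrix, the beta-gamma relation turns the prefactor into a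
   product that collapses to the identity. *)
apply: (can_inj (mulKmx ub)); rewrite (mulmxV ub) !mulmxA.
have -> : mbeta Q (S - Q) *m mx_Gamma S = mx_Gamma (S - Q) *m mx_Gamma Q by exact: bG.
by rewrite (mulmxK uQ) (mulmxV uT).
Qed.
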